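(* Let $n\ge 1$, $1<p<\infty$, $p\neq 2$. Let $\lambda:\mathbb{R}^n\to(0,\infty)$ be continuous and bounded and let $\psi=(\psi_1,\dots,\psi_n)$ with each $\psi_j:\mathbb{R}^n\to(0,\infty)$ continuous. For $\xi\in\mathbb{R}^n$ put $$S(\xi)=\{\eta\in\mathbb{R}^n:\ \psi_j(\eta)\le\psi_j(\xi),\ j=1,\dots,n\}.$$ Assume that there are positive constants $c,C$, independent of $\xi$, such that for every $\xi\in\mathbb{R}^n$ with $|\xi|\ge C$ there exists an $n$-dimensional interval $$I(\xi)=\{\eta\in\mathbb{R}^n:\ |\eta_j|\le l_j(\xi),\ j=1,\dots,n\}$$ with $l_j(\xi)\in\mathbb{R}$, $l_j(\xi)\ge c\,\psi_j(\xi)$ for $j=1,\dots,n$, and $$I(\xi)\subseteq S(\xi),\qquad \mu(S(\xi))\le C\,\mu(I(\xi)),$$ where $\mu$ is Lebesgue measure on $\mathbb{R}^n$. Let $$F_p(\xi)=\Bigl(\inf_{\eta\in S(\xi)}\lambda(\eta)\Bigr)\Bigl(\mu(S(\xi))\prod_{j=1}^n\psi_j(\xi)^{-1}\Bigr)^{\left|\frac1p-\frac12\right|},\qquad |\xi|\ge C.$$ If $F_p$ is unbounded, then there exists a symbol $\sigma\in\mathcal{M}^\lambda_\psi$ such that $$\|\sigma(D)\|_{\mathcal{L}(L^p(\mathbb{R}^n))}=\infty.$$ Equivalently, if $\sigma(D)$ extends to a bounded operator on $L^p(\mathbb{R}^n)$ for every $\sigma\in\mathcal{M}^\lambda_\psi$,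 then $F_p$ is bounded.
   Context: For a multi-index $\alpha=(\alpha_1,\dots,\alpha_n)$ of non-negative integers, $\psi(\xi)^{-\alpha}=\prod_{i=1}^n\psi_i(\xi)^{-\alpha_i}$, and $D^\alpha$ is the partial derivative of order $\alpha$ (up to a factor of modulus one). The symbol class $\mathcal{M}^\lambda_\psi$ is the space of all (complex-valued) $\sigma\in C^\infty(\mathbb{R}^n)$ such that for every multi-index $\alpha$ there is a constant $C_\alpha\ge0$ with $|D^\alpha\sigma(\xi)|\le C_\alpha\lambda(\xi)\psi(\xi)^{-\alpha}$ for all $\xi\in\mathbb{R}^n$. For $\sigma\in\mathcal{M}^\lambda_\psi$ (in particular $\sigma$ is bounded), $\sigma(D)$ is the operator defined on Schwartz functions $u\in\mathcal{S}(\mathbb{R}^n)$ by $[\sigma(D)u](x)=(2\pi)^{-n}\int e^{i\langle\xi,x\rangle}\sigma(\xi)\widehat{u}(\xi)\,d\xi$, with $\widehat{u}(\xi)=\int e^{-i\langle x,\xi\rangle}u(x)\,dx$. $\mathcal{L}(L^p(\mathbb{R}^n))$ is the space of bounded linear operators on $L^p(\mathbb{R}^n)$, and $\|\sigma(D)\|_{\mathcal{L}(L^p(\mathbb{R}^n))}\in[0,\infty]$ is the supremum of $\|\sigma(D)u\|_{L^p}/\|u\|_{L^p}$ over $0\ne u\in\mathcal{S}(\mathbb{R}^n)$ (equal to $\infty$ exactly when $\sigma(D)$ does not extend to a bounded operator on $L^p(\mathbb{R}^n)$). *)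

(* Defs.v *)
From HB Require Import structures.
From mathcomp Require Import all_boot all_order all_algebra.
From mathcomp Require Import all_classical all_reals all_analysis.
From mathcomp Require Export complex.

Set Implicit Arguments.
Unset Strict Implicit.
Unset Printing Implicit Defensive.
Import Order.TTheory GRing.Theory Num.Theory.
Import numFieldTopology.Exports numFieldNormedType.Exports.
Import ComplexField.Normc.

Local Open Scope classical_set_scope.
Local Open Scope ring_scope.

(* 'rV[R]_n carries the sigma-algebra generated by the coordinate maps; this is
   the Borel sigma-algebra of R^n. *)
Definition measure_rV_display : measure_display -> measure_display.
Proof. exact. Qed.

Section measurable_rV.
Context {R : realType} {n : nat}.

Definition rV_coord (i : 'I_n) (v : 'rV[R]_n) : R := v 0 i.

Let rV_set0 : g_sigma_preimage rV_coord set0.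
Proof. exact: sigma_algebra0. Qed.

Let rV_setC A : g_sigma_preimage rV_coord A -> g_sigma_preimage rV_coord (~` A).
Proof. exact: sigma_algebraC. Qed.

Let rV_bigcup (F : _^nat) : (forall i, g_sigma_preimage rV_coord (F i)) ->
  g_sigma_preimage rV_coord (\bigcup_i (F i)).
Proof. exact: sigma_algebra_bigcup. Qed.

HB.instance Definition _ :=
  @isMeasurable.Build (measure_rV_display default_measure_display)
    'rV[R]_n (g_sigma_preimage rV_coord) rV_set0 rV_setC rV_bigcup.

Lemma measurable_rV_coord (i : 'I_n) : measurable_fun [set: 'rV[R]_n] (rV_coord i).
Proof.
move=> _ Y mY; rewrite setTI; apply: sub_sigma_algebra => /=.
rewrite -bigcup_seq/=; exists i => /=; first by rewrite mem_index_enum.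
by exists Y => //; rewrite setTI.
Qed.

Lemma measurable_fun_rV d (T : measurableType d) (f : T -> 'rV[R]_n) :
  (forall i, measurable_fun [set: T] (rV_coord i \o f)) ->
  measurable_fun [set: T] f.
Proof.
move=> mf.
suff H : g_sigma_preimage (fun i => rV_coord i \o f) `<=` measurable.
  by move=> _ A mA; apply: H; rewrite g_sigma_preimage_comp; exists A.
apply: smallest_sub; first exact: sigma_algebra_measurable.
move=> A; rewrite -bigcup_seq => -[i _ [B mB <-]].
exact: mf.
Qed.

End measurable_rV.

Section lebesgue_rV.
Context {R : realType}.

Definition rV_cons n (xv : measurableTypeR R * 'rV[R]_n) : 'rV[R]_n.+1 :=
  row_mx xv.1%:M xv.2.

Lemma rV_cons0 n xv : @rV_cons n xv 0 ord0 = xv.1.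
Proof.
rewrite /rV_cons (_ : ord0 = lshift n (ord0 : 'I_1)); last exact: val_inj.
by rewrite (row_mxEl (xv.1)%:M) mxE.
Qed.

Lemma rV_consS n xv i : @rV_cons n xv 0 (lift ord0 i) = xv.2 0 i.
Proof.
rewrite /rV_cons (_ : lift ord0 i = rshift 1 i); last exact: val_inj.
by rewrite (row_mxEr (xv.1)%:M).
Qed.

Lemma measurable_rV_cons n : measurable_fun setT (@rV_cons n).
Proof.
apply: measurable_fun_rV => i; case: (unliftP ord0 i) => [j ->|->].
- rewrite (_ : _ \o _ = rV_coord j \o snd); last first.
    by apply/funext => xv; exact: rV_consS.
  by apply: measurableT_comp => //; exact: measurable_rV_coord.
- rewrite (_ : _ \o _ = fst) //.
  by apply/funext => xv; exact: rV_cons0.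
Qed.

Section step.
Context {n : nat}.
Variable m : {sigma_finite_measure set 'rV[R]_n -> \bar R}.

Definition lebesgue_rV_step : set 'rV[R]_n.+1 -> \bar R :=
  pushforward ((@lebesgue_measure R) \x m)%E (@rV_cons n).

Let lebesgue_rV_step0 : lebesgue_rV_step set0 = 0%E.
Proof. by rewrite /lebesgue_rV_step /pushforward preimage_set0 measure0. Qed.

Let lebesgue_rV_step_ge0 A : (0 <= lebesgue_rV_step A)%E.
Proof. by rewrite /lebesgue_rV_step /pushforward; exact: measure_ge0. Qed.

Let lebesgue_rV_step_sigma_additive : semi_sigma_additive lebesgue_rV_step.
Proof.
move=> F mF tF mUF; rewrite /lebesgue_rV_step /pushforward preimage_bigcup.
apply: measure_semi_sigma_additive.
- by move=> k; rewrite -[X in measurable X]setTI; exact: measurable_rV_cons.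
- apply/trivIsetP => /= i j _ _ ij; rewrite -preimage_setI.
  by move/trivIsetP : tF => /(_ _ _ _ _ ij) ->//; rewrite preimage_set0.
- rewrite -preimage_bigcup -[X in measurable X]setTI.
  exact: measurable_rV_cons.
Qed.

HB.instance Definition _ := isMeasure.Build _ _ _ lebesgue_rV_step
  lebesgue_rV_step0 lebesgue_rV_step_ge0 lebesgue_rV_step_sigma_additive.

Lemma lebesgue_rV_stepE (A : set R) (B : set 'rV[R]_n) :
  measurable A -> measurable B ->
  lebesgue_rV_step [set v : 'rV[R]_n.+1 |
    A (v 0 ord0) /\ B (\row_i v 0 (lift ord0 i))] =
  (lebesgue_measure (A : set (measurableTypeR R)) * m B)%E.
Proof.
move=> mA mB; rewrite /lebesgue_rV_step /pushforward.
rewrite -product_measure1E//; congr ((_ \x _)%E _).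
apply/seteqP; split=> -[x v] /=; rewrite rV_cons0;
  rewrite (_ : \row_i _ = v)//; by apply/rowP => i; rewrite mxE rV_consS.
Qed.

Lemma measurable_rV_split (A : set R) (B : set 'rV[R]_n) :
  measurable A -> measurable B ->
  measurable [set v : 'rV[R]_n.+1 |
    A (v 0 ord0) /\ B (\row_i v 0 (lift ord0 i))].
Proof.
move=> mA mB; apply: measurableI.
- rewrite -[X in measurable X]setTI.
  exact: (measurable_rV_coord (ord0 : 'I_n.+1)).
- rewrite -[X in measurable X]setTI.
  have mf : measurable_fun [set: 'rV[R]_n.+1]
      (fun v => \row_i v 0 (lift ord0 i) : 'rV[R]_n).
    apply: measurable_fun_rV => i.
    rewrite (_ : _ \o _ = rV_coord (lift ord0 i)).
      exact: measurable_rV_coord.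
    by apply/funext => v; rewrite /= /rV_coord mxE.
  exact: mf.
Qed.

Let lebesgue_rV_step_sigma_finite : sigma_finite setT lebesgue_rV_step.
Proof.
have /sigma_finiteP[F [TF ndF Foo]] := sigma_finiteT (@lebesgue_measure R).
have /sigma_finiteP[G [TG ndG Goo]] := sigma_finiteT m.
exists (fun k => [set v : 'rV[R]_n.+1 | F k (v 0 ord0) /\
  G k (\row_i v 0 (lift ord0 i))]).
  apply/esym; rewrite -subTset => v _.
  have : [set: measurableTypeR R] (v 0 ord0) by [].
  rewrite TF => -[k _ Fk].
  have : [set: 'rV[R]_n] (\row_i v 0 (lift ord0 i)) by [].
  rewrite TG => -[l _ Gl].
  exists (maxn k l) => //; split.
  - by move: (v 0 ord0) Fk; exact/subsetPset/ndF/leq_maxl.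
  - by move: (\row_i _) Gl; exact/subsetPset/ndG/leq_maxr.
move=> k; have [mF Fk] := Foo k; have [mG Gk] := Goo k; split.
  exact: measurable_rV_split.
by rewrite lebesgue_rV_stepE// lte_mul_pinfty// ge0_fin_numE.
Qed.

HB.instance Definition _ := Measure_isSigmaFinite.Build _ _ _ lebesgue_rV_step
  lebesgue_rV_step_sigma_finite.

End step.

Fixpoint lebesgue_rV n : {sigma_finite_measure set 'rV[R]_n -> \bar R} :=
  match n with
  | 0 => \d_(0 : 'rV[R]_0)
  | n'.+1 => lebesgue_rV_step (lebesgue_rV n')
  end.

(* Together with sigma-finiteness this characterizes Lebesgue measure on R^n. *)
Lemma lebesgue_rV_box n (A : 'I_n -> set R) : (forall j, measurable (A j)) ->
  lebesgue_rV n [set v : 'rV[R]_n | forall j, A j (v 0 j)] =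
  (\prod_(j < n) lebesgue_measure (A j : set (measurableTypeR R)))%E.
Proof.
move=> mA.
suff [] : measurable [set v : 'rV[R]_n | forall j, A j (v 0 j)] /\
  lebesgue_rV n [set v : 'rV[R]_n | forall j, A j (v 0 j)] =
  (\prod_(j < n) lebesgue_measure (A j : set (measurableTypeR R)))%E by [].
elim: n A mA => [|n IH] A mA.
  have -> : [set v : 'rV[R]_0 | forall j, A j (v 0 j)] = setT.
    by apply/seteqP; split=> // v _ [].
  by split=> //; rewrite big_ord0; exact: diracT.
have [mB IHB] := IH (fun j => A (lift ord0 j)) (fun j => mA _).
have -> : [set v : 'rV[R]_n.+1 | forall j, A j (v 0 j)] =
   [set v | A ord0 (v 0 ord0) /\ [set w : 'rV[R]_n | forall j,
      A (lift ord0 j) (w 0 j)] (\row_i v 0 (lift ord0 i))].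
  apply/seteqP; split=> v /=.
    by move=> Av; split=> // j; rewrite mxE.
  move=> [A0 AS] j; case: (unliftP ord0 j) => [k ->|-> //].
  by have := AS k; rewrite mxE.
split; first exact: measurable_rV_split.
rewrite big_ord_recl /= -IHB.
exact: (lebesgue_rV_stepE (lebesgue_rV n) (mA ord0) mB).
Qed.

End lebesgue_rV.

Section euclidean_space.
Context {R : realType} {n : nat}.
Implicit Types (x xi : 'rV[R]_n) (f : 'rV[R]_n -> R[i]).

Definition dotrV x xi : R := \sum_(j < n) x 0 j * xi 0 j.

(* The library norm `|xi| on 'rV[R]_n is the maximum norm. *)
Definition enorm xi : R := Num.sqrt (\sum_(j < n) xi 0 j ^+ 2).

Definition interval_rV (l : 'I_n -> R) : set 'rV[R]_n :=
  [set eta | forall j, `|eta 0 j| <= l j].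

Definition pderiv (j : 'I_n) (g : 'rV[R]_n -> R) : 'rV[R]_n -> R :=
  fun x => 'D_(delta_mx 0 j) g x.

Definition pderivs (s : seq 'I_n) (g : 'rV[R]_n -> R) : 'rV[R]_n -> R :=
  foldr pderiv g s.

(* All iterated partial derivatives, in any order, exist and are continuous. *)
Definition smooth_real (g : 'rV[R]_n -> R) : Prop := forall s : seq 'I_n,
  continuous (pderivs s g) /\
  forall j x, derivable (pderivs s g) x (delta_mx 0 j).

Definition smooth f : Prop :=
  smooth_real (fun x => complex.Re (f x)) /\
  smooth_real (fun x => complex.Im (f x)).

(* The word in which each j occurs alpha j times; by symmetry of the iterated
   partial derivatives of smooth functions its order is immaterial. *)
Definition mderiv_word (alpha : 'I_n -> nat) : seq 'I_n :=
  flatten [seq nseq (alpha j) j | j <- enum 'I_n].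

(* No factor (-i)^|alpha|: it has modulus one and only moduli of derivatives
   are used below. *)
Definition mderiv (alpha : 'I_n -> nat) f : 'rV[R]_n -> R[i] := fun x =>
  (pderivs (mderiv_word alpha) (fun y => complex.Re (f y)) x +i*
   pderivs (mderiv_word alpha) (fun y => complex.Im (f y)) x)%C.

Definition schwartz f : Prop :=
  smooth f /\
  forall alpha beta : 'I_n -> nat, exists M : R, forall x,
    `|\prod_(j < n) x 0 j ^+ beta j| * normc (mderiv alpha f x) <= M.

Definition cexp_i (t : R) : R[i] := (cos t +i* sin t)%C.

Definition cintegral f : R[i] :=
  ((\int[lebesgue_rV n]_x complex.Re (f x)) +i*
   (\int[lebesgue_rV n]_x complex.Im (f x)))%C.

Definition fourier (u : 'rV[R]_n -> R[i]) : 'rV[R]_n -> R[i] := fun xi =>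
  cintegral (fun x => cexp_i (- dotrV x xi) * u x).

Definition multiplier (sigma u : 'rV[R]_n -> R[i]) : 'rV[R]_n -> R[i] :=
  fun x => (((2 * pi) ^- n)%:C)%C *
    cintegral (fun xi => cexp_i (dotrV xi x) * sigma xi * fourier u xi).

Definition cLnorm (p : R) f : \bar R :=
  ('N[lebesgue_rV n]_(p%:E)[EFin \o (@normc R \o f)])%E.

(* For Schwartz u <> 0 the denominator is positive and finite. *)
Definition multiplier_norm (p : R) (sigma : 'rV[R]_n -> R[i]) : \bar R :=
  ereal_sup [set (cLnorm p (multiplier sigma u) / cLnorm p u)%E |
              u in [set u | schwartz u /\ u <> (fun=> 0)]].

(* L^p(R^n), before quotienting by almost everywhere equality. *)
Definition cLp (p : R) : set ('rV[R]_n -> R[i]) :=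
  [set f | [/\ measurable_fun setT (fun x => complex.Re (f x)),
               measurable_fun setT (fun x => complex.Im (f x)) &
               (cLnorm p f < +oo)%E]].

(* T is an operator on representatives; linearity and boundedness make it
   compatible with almost everywhere equality. *)
Definition extends_bounded (p : R) (sigma : 'rV[R]_n -> R[i]) : Prop :=
  exists T : ('rV[R]_n -> R[i]) -> ('rV[R]_n -> R[i]),
  [/\ forall f, cLp p f -> cLp p (T f),
      forall (a : R[i]) f g, cLp p f -> cLp p g ->
        {ae lebesgue_rV n, forall x,
          T (fun y => a * f y + g y) x = a * T f x + T g x},
      exists A : R, 0 <= A /\
        forall f, cLp p f -> (cLnorm p (T f) <= A%:E * cLnorm p f)%E &
      forall u, schwartz u ->
        {ae lebesgue_rV n, forall x, T u x = multiplier sigma u x}].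

Definition symbol_class (lam : 'rV[R]_n -> R) (psi : 'I_n -> 'rV[R]_n -> R) :
    set ('rV[R]_n -> R[i]) :=
  [set sigma | smooth sigma /\
    forall alpha : 'I_n -> nat, exists Ca : R, 0 <= Ca /\
      forall xi, normc (mderiv alpha sigma xi) <=
        Ca * lam xi * \prod_(j < n) psi j xi ^- alpha j].

Definition sublevel (psi : 'I_n -> 'rV[R]_n -> R) xi : set 'rV[R]_n :=
  [set eta | forall j, psi j eta <= psi j xi].

(* inf is over a nonempty set of positive reals. fine discards only the case of
   infinite measure, excluded by mu(S(xi)) <= C mu(I(xi)) when |xi| >= C. *)
Definition Fp (p : R) (lam : 'rV[R]_n -> R) (psi : 'I_n -> 'rV[R]_n -> R) xi : R :=
  inf (lam @` sublevel psi xi) *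
  (fine (lebesgue_rV n (sublevel psi xi)) * \prod_(j < n) (psi j xi)^-1)
    `^ `|p^-1 - 2^-1|.

End euclidean_space.

(* Main.v *)
Require Import Defs.
From HB Require Import structures.
From mathcomp Require Import all_boot all_order all_algebra.
From mathcomp Require Import all_classical all_reals all_analysis.
From mathcomp Require Import measurable_realfun ring lra.
Import Order.TTheory GRing.Theory Num.Theory.
Import numFieldTopology.Exports numFieldNormedType.Exports.
Import ComplexField.Normc.
Local Open Scope classical_set_scope.
Local Open Scope ring_scope.
Set Implicit Arguments.
Unset Strict Implicit.
Unset Printing Implicit Defensive.

(** Fix [xi] and round the ratios [l_j(xi) / psi_j(xi)] down to powers of two
    [N_j].  On the interval [I(xi)] take the multiplier [inf_{S(xi)} lam] times
    the tensor product of bumps of width [l_j] multiplied by normalised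
    Rudin-Shapiro polynomials with [N_j] terms.  As the exponentials oscillate on
    the scale [l_j / N_j ~ psi_j] and the polynomials are bounded by
    [sqrt (2 N_j)], these pieces satisfy the symbol estimates uniformly in [xi].
    Pair such a multiplier with a sum of [prod_j N_j] disjoint translates of one
    bump carrying Rudin-Shapiro signs against a single bump (the two roles being
    exchanged for [p < 2]); by Hoelder's inequality its norm on [L^p] is at least
    a constant times [inf lam * (prod_j N_j) ^ |1/p - 1/2|], hence at least a
    constant times [F_p(xi)].  If [F_p] is unbounded, then either one piece is
    already an unbounded multiplier, or a gliding hump argument produces a rapidly
    convergent combination of the pieces which is. *)

(** * Families with uniformly controlled derivatives *)

(** A bound [A] on an operator is used only through a bilinear pairing: Fubini and Hoelder turn it
    into an upper bound for the integral of the symbol against a Fourier transform times a reverse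
    Fourier transform. For the tensor pieces this integral is computed exactly. One test function
    carries the same Rudin-Shapiro word as the symbol, so only the nonnegative integrals
    [bump_energy] remain, and because |P|^2 + |Q|^2 is constant, one of the two words of length N
    has energy of order N. After the normalisation by 1/sqrt N the pairing has order sqrt N, while
    the norms of the test functions contribute N^(1/2 - theta) with theta = |1/p - 1/2|; the
    quotient is N^theta.

    The inclusion of I(xi) in S(xi) is used twice. On the support of a piece it lets the values of
    [psi] at xi and the infimum of [lam] be replaced by the values at the current point. As I(xi)
    contains 0, it also gives psi_j(0) <= psi_j(xi), hence derivative bounds common to all pieces,
    which make series of pieces smooth. The gliding hump works on the scalar pairings alone, so the
    symbol class is never given a topology. *)

Section derive_fun.
Context {R : realType} {V : normedModType R}.
Implicit Types (f g : V -> R) (x v : V).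

Lemma is_derive_addf f g x v df dg :
  is_derive x v f df -> is_derive x v g dg ->
  is_derive x v (fun y => f y + g y) (df + dg).
Proof. exact: is_deriveD. Qed.

Lemma is_derive_mulf f g x v df dg :
  is_derive x v f df -> is_derive x v g dg ->
  is_derive x v (fun y => f y * g y) (f x * dg + df * g x).
Proof. by move=> hf hg; rewrite [df * _]mulrC; exact: is_deriveM. Qed.

Lemma is_derive_mulrf f c x v df :
  is_derive x v f df -> is_derive x v (fun y => c * f y) (c * df).
Proof. exact: is_deriveZ. Qed.

End derive_fun.

Section tame.
Context {R : realType} {V : normedModType R} {J : Type} (e : J -> V).

(* For a family [F] indexed by [th], all derivatives of order at most [k] in the
   directions [e j] exist, are continuous and, multiplied by [w th] and one factor
   [r th j] per derivative, are bounded uniformly in [th].  Stating this by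
   recursion on [k] lets the closure properties be proved by induction without
   Leibniz or chain rule expansions. *)
Fixpoint tame {Th : Type} (r : Th -> J -> R) (w : Th -> R) (k : nat)
    (F : Th -> V -> R) : Prop :=
  [/\ exists M, forall th x, `|w th * F th x| <= M,
      forall th, continuous (F th) &
      if k is k'.+1 then forall j, exists G : Th -> V -> R,
        (forall th x, is_derive x (e j) (F th) (G th x)) /\
        tame r (fun th => w th * r th j) k' G
      else True].

Lemma tameW Th (r : Th -> J -> R) w k F : tame r w k.+1 F -> tame r w k F.
Proof.
elim: k w F => [|k IH] w F /= [bF cF dF]; first by split.
split=> // j; have [G [dG tG]] := dF j.
by exists G; split=> //; apply: IH.
Qed.

Lemma tame_bounded Th (r : Th -> J -> R) w k F : tame r w k F ->
  exists M, 0 <= M /\ forall th x, `|w th * F th x| <= M.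
Proof.
case: k => [|k] [[M hM] _ _]; exists `|M|; split=> // th x;
  exact: le_trans (hM th x) (ler_norm _).
Qed.

Lemma tame_continuous Th (r : Th -> J -> R) w k F : tame r w k F ->
  forall th, continuous (F th).
Proof. by case: k => [|k] []. Qed.

Lemma tameD Th (r : Th -> J -> R) w k F G : tame r w k F -> tame r w k G ->
  tame r w k (fun th x => F th x + G th x).
Proof.
elim: k w F G => [|k IH] w F G /= [[M hM] cF dF] [[N hN] cG dG].
  split=> // [|th x]; last by apply: continuousD; [exact: cF|exact: cG].
  exists (M + N) => th x; rewrite mulrDr.
  by apply: le_trans (ler_normD _ _) _; apply: lerD.
split=> // [|th x|j]; last 2 first.
- by apply: continuousD; [exact: cF|exact: cG].
- have [F' [dF' tF']] := dF j; have [G' [dG' tG']] := dG j.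
  exists (fun th x => F' th x + G' th x); split; last exact: IH.
  by move=> th x; apply: is_deriveD.
exists (M + N) => th x; rewrite mulrDr.
by apply: le_trans (ler_normD _ _) _; apply: lerD.
Qed.

(** The product rule, one derivative at a time: the differentiated factor absorbs the rate [r th j]
    into its weight, so both summands carry the weight [w1 th * w2 th * r th j]. The other factor is
    used one order lower, through [tameW]. *)
Lemma tameM Th (r : Th -> J -> R) w1 w2 k F G :
  tame r w1 k F -> tame r w2 k G ->
  tame r (fun th => w1 th * w2 th) k (fun th x => F th x * G th x).
Proof.
elim: k w1 w2 F G => [|k IH] w1 w2 F G.
  move=> /= [[M hM] cF dF] [[N hN] cG dG].
  split=> // [|th x]; last by apply: continuousM; [exact: cF|exact: cG].
  exists (M * N) => th x; rewrite mulrACA normrM.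
  exact: ler_pM.
move=> tF tG; have {}IHF := IH _ _ _ _ (tameW tF); have {}IHG := IH _ _ _ _ _ (tameW tG).
move: tF tG => /= [[M hM] cF dF] [[N hN] cG dG].
split=> // [|th x|j]; last 2 first.
- by apply: continuousM; [exact: cF|exact: cG].
- have [F' [dF' tF']] := dF j; have [G' [dG' tG']] := dG j.
  exists (fun th x => F th x * G' th x + F' th x * G th x); split.
    by move=> th x; exact: is_derive_mulf.
  apply: tameD.
    by have := IHF _ _ tG'; under eq_fun do rewrite mulrA.
  by have := IHG _ _ tF'; under eq_fun do rewrite mulrAC.
exists (M * N) => th x; rewrite mulrACA normrM.
exact: ler_pM.
Qed.

Lemma tame_cst Th (r : Th -> J -> R) w k (c : Th -> R) M :
  (forall th, `|w th * c th| <= M) -> tame r w k (fun th _ => c th).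
Proof.
elim: k w c M => [|k IH] w c M hM.
  by split=> // [|th]; [exists M|exact: cst_continuous].
split=> // [|th|j]; first by exists M.
  exact: cst_continuous.
exists (fun _ _ => 0); split; first by move=> th x; exact: is_derive_cst.
by apply: (IH _ _ 0) => th; rewrite mulr0 normr0.
Qed.

(** Rates and weights may be multiplied by bounded factors. This brings families with different
    natural scales to a common rate, as [tameM] requires. *)
Lemma tame_scale Th (r : Th -> J -> R) w k F (h : Th -> J -> R) (u : Th -> R) K K' :
  (forall th j, `|h th j| <= K) -> (forall th, `|u th| <= K') ->
  tame r w k F ->
  tame (fun th j => h th j * r th j) (fun th => u th * w th) k F.
Proof.
move=> hK; elim: k w F u K' => [|k IH] w F u K' hK'.
  move=> /= [[M hM] cF _]; split=> //; exists (K' * M) => th x.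
  by rewrite -mulrA normrM ler_pM.
move=> /= [[M hM] cF dF]; split=> // [|j].
  by exists (K' * M) => th x; rewrite -mulrA normrM ler_pM.
have [G [dG tG]] := dF j; exists G; split=> //.
have := IH _ _ (fun th => u th * h th j) (K' * K) _ tG.
under [fun th => u th * h th j * _]eq_fun do rewrite mulrACA.
by apply=> th; rewrite normrM ler_pM.
Qed.

Lemma tame_mulr Th (r : Th -> J -> R) w k F (c : Th -> R) :
  tame r (fun th => w th * c th) k F ->
  tame r w k (fun th x => c th * F th x).
Proof.
elim: k w F => [|k IH] w F /= [[M hM] cF dF].
  split=> // [|th x]; last by apply: continuousM; [exact: cst_continuous|exact: cF].
  by exists M => th x; rewrite mulrA.
split=> // [|th x|j]; first by exists M => th x; rewrite mulrA.
  by apply: continuousM; [exact: cst_continuous|exact: cF].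
have [G [dG tG]] := dF j; exists (fun th x => c th * G th x); split.
  by move=> th x; exact: is_derive_mulrf.
by apply: IH; under eq_fun do rewrite mulrAC.
Qed.

Lemma tame_reindex Th Th' (phi : Th' -> Th) (r : Th -> J -> R) w k F :
  tame r w k F -> tame (r \o phi) (w \o phi) k (fun th => F (phi th)).
Proof.
elim: k w F => [|k IH] w F /= [[M hM] cF dF].
  by split=> //; exists M.
split=> // [|j]; first by exists M.
have [G [dG tG]] := dF j; exists (fun th => G (phi th)); split=> //.
exact: (IH _ _ tG).
Qed.

End tame.

Definition e1 {R : realType} : unit -> R := fun _ => 1.

Section tame_line.
Context {R : realType}.

(** Every derivative of the composite produces a factor [s th], which the new rate has to
    compensate. *)
Lemma tame_affine Th (r r' : Th -> unit -> R) (w : Th -> R) k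
    (F : Th -> R -> R) (s u : Th -> R) :
  (forall th, r' th tt * s th = r th tt) ->
  tame e1 r w k F -> tame e1 r' w k (fun th t => F th (s th * t + u th)).
Proof.
have caff : forall th, continuous (fun t => s th * t + u th).
  move=> th t; apply: cvgD; last exact: cvg_cst.
  by apply: cvgM; [exact: cvg_cst|exact: cvg_id].
move=> rr'; elim: k w F => [|k IH] w F /= [[M hM] cF dF].
  split=> // [|th t]; first by exists M.
  by apply: continuous_comp; [exact: caff|exact: cF].
split=> // [|th t|j]; first by exists M.
  by apply: continuous_comp; [exact: caff|exact: cF].
have [G [dG tG]] := dF j.
exists (fun th t => s th * G th (s th * t + u th)); split.
  move=> th t; rewrite mulrC.
  apply: (@is_derive1_comp _ (F th) (fun t => s th * t + u th)).
  rewrite -[X in is_derive _ _ _ X]addr0; apply: is_derive_addf.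
  by rewrite -[X in is_derive _ _ _ X]mulr1; apply: is_derive_mulrf.
apply: tame_mulr; apply: IH.
by case: j tG {dG} => tG; under eq_fun do rewrite -mulrA rr'.
Qed.

Lemma tame_comp_coord n (j : 'I_n) Th (r : Th -> unit -> R)
    (r' : Th -> 'I_n -> R) w k (F : Th -> R -> R) :
  (forall th, r' th j = r th tt) -> tame e1 r w k F ->
  tame (fun i => delta_mx 0 i : 'rV[R]_n) r' w k (fun th x => F th (x 0 j)).
Proof.
move=> rr'; elim: k w F => [|k IH] w F /= [[M hM] cF dF].
  split=> // [|th x]; first by exists M.
  by apply: (continuous_comp (@coord_continuous _ _ _ 0 j x)); exact: cF.
split=> // [|th x|i]; first by exists M.
  by apply: (continuous_comp (@coord_continuous _ _ _ 0 j x)); exact: cF.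
have [G [dG tG]] := dF tt.
(* The difference quotient along the [i]-th basis vector is literally that of [F th] along the
   number which is the [j]-th entry of that vector, 1 or 0. *)
have E : forall th (x : 'rV[R]_n) (d : R), is_derive (x 0 j) ((delta_mx 0 i : 'rV[R]_n) 0 j) (F th) d ->
    is_derive x (delta_mx 0 i : 'rV[R]_n) (fun x : 'rV[R]_n => F th (x 0 j)) d.
  move=> th x d; suff E : (fun h : R => h^-1 *: (((fun x : 'rV[R]_n => F th (x 0 j)) \o shift x)
      (h *: (delta_mx 0 i : 'rV[R]_n)) - F th (x 0 j))) =
    (fun h : R => h^-1 *: ((F th \o shift (x 0 j))
      (h *: (delta_mx 0 i : 'rV[R]_n) 0 j) - F th (x 0 j))).
    by case=> D1 D2; split; rewrite /derivable /derive E.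
  by apply/funext => h; rewrite /shift/= !mxE.
have [ij|ij] := eqVneq i j.
  exists (fun th x => G th (x 0 j)); split; last first.
    by apply: IH; rewrite ij; under eq_fun do rewrite rr'.
  by move=> th x; apply: E; rewrite mxE ij !eqxx; exact: dG.
exists (fun th x => 0); split; last by apply: (@tame_cst _ _ _ _ _ _ _ _ _ 0) => th; rewrite mulr0 normr0.
move=> th x; apply: E; rewrite mxE [j == i]eq_sym (negbTE ij) andbF.
exact: is_derive0.
Qed.

End tame_line.

Section tame_pderivs.
Context {R : realType} {n : nat}.
Notation dir := (fun i => delta_mx 0 i : 'rV[R]_n).

(** Passes from the existential derivatives in [tame] to the actual [pderivs]. Order [k.+1] is
    assumed for words of length [k], the spare order giving differentiability of the last
    derivative. *)
Lemma tame_pderivs Th (r : Th -> 'I_n -> R) w (F : Th -> 'rV[R]_n -> R) :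
  (forall k, tame dir r w k F) ->
  (forall th, smooth_real (F th)) /\
  forall s, exists M, 0 <= M /\
    forall th x, `|w th * (\prod_(j <- s) r th j) * pderivs s (F th) x| <= M.
Proof.
move=> tF.
have H k s w' G : size s = k -> tame dir r w' k.+1 G ->
    (forall th, continuous (pderivs s (G th)) /\
      forall j x, derivable (pderivs s (G th)) x (delta_mx 0 j)) /\
    exists M, 0 <= M /\
      forall th x, `|w' th * (\prod_(j <- s) r th j) * pderivs s (G th) x| <= M.
  elim: k s w' G => [|k IH] s w' G.
    move/size0nil => -> tG; have [M [M0 hM]] := tame_bounded tG.
    split; last by exists M; split=> // th x; rewrite big_nil mulr1; exact: hM.
    move=> th; split; first exact: tame_continuous tG th.
    by case: tG => _ _ dG j x; have [H [dH _]] := dG j; exact: ex_derive.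
  (* [pderivs] is a [foldr], so the last letter of the word is differentiated first; this is the
     derivative that [tame] exposes. *)
  case: (lastP s) => [//|{}s j]; rewrite size_rcons => -[sk] [_ _ /(_ j) [H [dH tH]]].
  have [H1 [M [M0 hM]]] := IH s _ _ sk tH.
  have GH th : pderivs (rcons s j) (G th) = pderivs s (H th).
    rewrite /pderivs foldr_rcons; congr foldr.
    by apply/funext => x; rewrite /pderiv; exact: derive_val.
  split; first by move=> th; rewrite GH.
  exists M; split=> // th x; rewrite GH big_rcons/=.
  by rewrite [_ * r th j]mulrC !mulrA.
split=> [th s|s].
  by have [] := H _ s _ _ erefl (tF _).
by have [] := H _ s _ _ erefl (tF _).
Qed.

End tame_pderivs.

(** * A smooth bump *)

Section smooth_bump.
Context {R : realType}.

(* The functions [t^-k exp(-1/t)] have derivatives in their own linear span, which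
   makes the induction on the order of differentiation go through. *)
Definition flat k (t : R) : R :=
  if 0 < t then t^-1 ^+ k * expR (- t^-1) else 0.

Lemma flat_ge0 k t : 0 <= flat k t.
Proof.
rewrite /flat; case: ifPn => // t0.
by rewrite mulr_ge0 ?expR_ge0// exprn_ge0// invr_ge0 ltW.
Qed.

(** The power divided by the factorial is a single term of the exponential series of [s]. *)
Lemma expr_expRN_le k (s : R) : 0 <= s -> s ^+ k * expR (- s) <= k`!%:R.
Proof.
move=> s0; case: k => [|k].
  by rewrite expr0 mul1r fact0 -expR0 ler_expR oppr_le0.
rewrite expRN ler_pdivrMr ?expR_gt0//.
have k0 : 0 < (k.+1`!)%:R :> R by rewrite ltr0n fact_gt0.
rewrite mulrC -ler_pdivrMr//; apply: le_trans (expR_ge1Dxn k s0).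
by rewrite lerDr.
Qed.

Lemma flat_le k t : flat k t <= k`!%:R.
Proof.
rewrite /flat; case: ifPn => // t0.
by rewrite expr_expRN_le// invr_ge0 ltW.
Qed.

Lemma flatS k t : flat k t = t * flat k.+1 t.
Proof.
rewrite /flat; case: ifPn => [t0|_]; last by rewrite mulr0.
by rewrite exprS !mulrA divff ?mul1r// gt_eqF.
Qed.

Lemma flat0 k : flat k 0 = 0. Proof. by rewrite /flat ltxx. Qed.

Lemma is_derive_flat k (t : R) :
  is_derive t 1 (flat k) (flat k.+2 t - k%:R * flat k.+1 t).
Proof.
have [t0|t0|->] := ltgtP t 0.
- have -> : flat k.+2 t - k%:R * flat k.+1 t = 0.
    by rewrite /flat ltNge (ltW t0)/= mulr0 subr0.
  apply: (near_eq_is_derive (f := (cst 0 : R -> R))).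
  near=> s; rewrite /flat/= ltNge ifF//; apply/negbTE; rewrite negbK.
  by near: s; apply: filterS (lt_nbhsl t0) => y; exact: ltW.
- apply: (near_eq_is_derive (f := fun s : R => s^-1 ^+ k * expR (- s^-1))).
    near=> s; rewrite /flat/= ifT//.
    by near: s; exact: (lt_nbhsr t0).
  have dV : is_derive t 1 (fun s : R => s^-1) (- t ^- 2).
    have := @is_deriveV R id t 1 1 (lt0r_neq0 t0) (is_derive_id t 1).
    by rewrite [_ *: _]mulr1.
  have dX : is_derive t 1 (fun s : R => s^-1 ^+ k) ((- t ^- 2) * (k%:R * t^-1 ^+ k.-1)).
    have := is_deriveX k dV.
    by rewrite exprfctE [X in _ -> is_derive _ _ _ X]mulrC.
  have dE : is_derive t 1 (fun s : R => expR (- s^-1)) (expR (- t^-1) * t ^- 2).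
    apply: (@is_derive1_comp _ expR (fun s : R => - s^-1)).
    by rewrite -[t ^- 2]opprK; exact: is_deriveN.
  have := is_derive_mulf dX dE.
  set d := (X in is_derive _ _ _ X); set d' := (X in _ -> is_derive _ _ _ X).
  suff -> : d = d' by [].
  rewrite /d /d' /flat t0; case: k {dX d d'} => [|k]; rewrite !exprS; field.
    exact: lt0r_neq0.
  exact: lt0r_neq0.
- rewrite !flat0 mulr0 subr0.
  have H : (fun h : R => h^-1 *: ((flat k \o shift 0) (h *: 1) - flat k 0)) @ 0^' --> (0 : R).
    apply/cvgrPdist_le => /= e e0; near=> h.
    have h0 : h != 0 by near: h; exact: nbhs_dnbhs_neq.
    rewrite sub0r normrN /shift/= addr0 flat0 subr0 [h *: 1]mulr1.
    (* [flat k h] equals [h ^+ 2 * flat k.+2 h] with [flat k.+2] bounded, so the difference quotient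
       at 0 is of order [h]. *)
    rewrite flatS flatS /GRing.scale/= mulKf// normrM [`|flat _ _|]ger0_norm ?flat_ge0//.
    apply: (@le_trans _ _ (`|h| * k.+2`!%:R)).
      by rewrite ler_wpM2l ?flat_le.
    rewrite -ler_pdivlMr ?ltr0n ?fact_gt0//.
    by near: h; apply: dnbhs0_le; rewrite divr_gt0 ?ltr0n ?fact_gt0.
  split; first by apply/cvg_ex; exists 0.
  exact: cvg_lim.
Unshelve. all: by end_near. Qed.

Lemma tame_flat k m : tame e1 (fun _ _ => 1) (fun _ => 1) m (fun _ : unit => flat k).
Proof.
elim: m k => [|m IH] k.
  split=> // [|_ t]; last first.
    by apply: differentiable_continuous; apply/derivable1_diffP; have [] := is_derive_flat k t.
  by exists k`!%:R => _ t; rewrite mul1r ger0_norm ?flat_ge0// flat_le.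
split=> // [|_ t|j].
- by exists k`!%:R => _ t; rewrite mul1r ger0_norm ?flat_ge0// flat_le.
- by apply: differentiable_continuous; apply/derivable1_diffP; have [] := is_derive_flat k t.
exists (fun _ t => flat k.+2 t + - k%:R * flat k.+1 t); split.
  by move=> _ t; rewrite mulNr; exact: is_derive_flat.
rewrite (_ : (fun _ => _ * _) = fun=> 1); last by apply/funext => ?; rewrite mulr1.
apply: tameD; first exact: IH.
have H : tame e1 (fun _ _ => 1) (fun _ : unit => 1) m (fun _ (_ : R) => - k%:R : R).
  by apply: (@tame_cst _ _ _ _ _ _ _ _ _ k%:R) => _; rewrite mul1r normrN ger0_norm.
have := tameM H (IH k.+1).
by rewrite (_ : (fun _ => _ * _) = fun=> 1)//; apply/funext => ?; rewrite mulr1.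
Qed.

(** On []0, 1[] this is exp(-1/t - 1/(1-t)). The support has length one, so integer translates do
    not overlap. *)
Definition smooth_bump (t : R) : R := flat 0 t * flat 0 (1 - t).

Lemma tame_bump m : tame e1 (fun _ _ => 1) (fun _ => 1) m (fun _ : unit => smooth_bump).
Proof.
have H : tame e1 (fun _ _ => 1) (fun _ : unit => 1) m (fun _ t => flat 0 (1 - t)).
  (* The rate -1 is chosen because the reflection [1 - t] contributes a factor -1 per derivative,
     which restores the rate 1. *)
  have H : tame e1 (fun _ _ => -1) (fun _ : unit => 1 : R) m (fun _ => flat 0).
    have := @tame_scale R R unit e1 unit (fun _ _ => 1) (fun _ => 1) m (fun _ => flat 0)
      (fun _ _ => -1) (fun _ => 1) 1 1.
    rewrite !mulr1; apply; last exact: tame_flat.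
      by move=> _ _; rewrite normrN normr1.
    by move=> _; rewrite normr1.
  have -> : (fun (_ : unit) (t : R) => flat 0 (1 - t)) =
      (fun _ t => flat 0 (-1 * t + 1)).
    by apply/funext => _; apply/funext => t; rewrite mulN1r addrC.
  apply: (@tame_affine R unit (fun _ _ => -1) (fun _ _ => 1) (fun _ => 1) m
    (fun=> flat 0) (fun=> -1) (fun=> 1) _ H) => _.
  by rewrite mul1r.
have := tameM (tame_flat 0 m) H.
by rewrite (_ : (fun _ => 1 * 1) = fun=> 1)//; apply/funext => ?; rewrite mulr1.
Qed.

Lemma bump_ge0 t : 0 <= smooth_bump t.
Proof. by rewrite mulr_ge0 ?flat_ge0. Qed.

Lemma bump_le1 t : smooth_bump t <= 1.
Proof. by rewrite /smooth_bump mulr_ile1 ?flat_ge0 ?flat_le. Qed.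

Lemma bump_eq0 t : t \notin `]0, 1[ -> smooth_bump t = 0.
Proof.
rewrite in_itv/= negb_and -!leNgt /smooth_bump /flat => /orP[t0|t1].
  by rewrite ltNge t0 mul0r.
by rewrite subr_gt0 [t < 1]ltNge t1 mulr0.
Qed.

Lemma continuous_bump : continuous smooth_bump.
Proof. by move=> t; exact: (tame_continuous (tame_bump 0) (th := tt)). Qed.

End smooth_bump.

(** * Complex numbers through their real and imaginary parts *)

Section complex_parts.
Context {R : realType}.
Implicit Types z w : R[i].

Lemma RecD z w : complex.Re (z + w) = complex.Re z + complex.Re w.
Proof. by case: z; case: w. Qed.

Lemma ImcD z w : complex.Im (z + w) = complex.Im z + complex.Im w.
Proof. by case: z; case: w. Qed.

Lemma RecM z w : complex.Re (z * w) =
  complex.Re z * complex.Re w - complex.Im z * complex.Im w.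
Proof. by case: z; case: w. Qed.

Lemma ImcM z w : complex.Im (z * w) =
  complex.Re z * complex.Im w + complex.Im z * complex.Re w.
Proof. by case: z; case: w => a b c d /=; rewrite [c * b]mulrC [d * a]mulrC. Qed.

Lemma Rec_sum I (r : seq I) (P : pred I) (F : I -> R[i]) :
  complex.Re (\sum_(i <- r | P i) F i) = \sum_(i <- r | P i) complex.Re (F i).
Proof. by apply: (big_morph (@complex.Re R)) => //; exact: RecD. Qed.

Lemma Imc_sum I (r : seq I) (P : pred I) (F : I -> R[i]) :
  complex.Im (\sum_(i <- r | P i) F i) = \sum_(i <- r | P i) complex.Im (F i).
Proof. by apply: (big_morph (@complex.Im R)) => //; exact: ImcD. Qed.

Lemma normc_sqrtE z : normc z = Num.sqrt (complex.Re z ^+ 2 + complex.Im z ^+ 2).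
Proof. by case: z. Qed.

Lemma normc_ge0 z : 0 <= normc z.
Proof. by rewrite normc_sqrtE sqrtr_ge0. Qed.

Lemma normc_sqr z : normc z ^+ 2 = complex.Re z ^+ 2 + complex.Im z ^+ 2.
Proof. by rewrite normc_sqrtE sqr_sqrtr// addr_ge0// sqr_ge0. Qed.

Lemma Re_le_normc z : `|complex.Re z| <= normc z.
Proof.
rewrite -(ler_pXn2r (n := 2)) ?nnegrE ?normc_ge0// normc_sqr real_normK ?num_real//.
by rewrite lerDl sqr_ge0.
Qed.

Lemma Im_le_normc z : `|complex.Im z| <= normc z.
Proof.
rewrite -(ler_pXn2r (n := 2)) ?nnegrE ?normc_ge0// normc_sqr real_normK ?num_real//.
by rewrite lerDr sqr_ge0.
Qed.

Lemma normc_le_Re_Im z : normc z <= `|complex.Re z| + `|complex.Im z|.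
Proof.
rewrite -(ler_pXn2r (n := 2)) ?nnegrE ?normc_ge0 ?addr_ge0// normc_sqr sqrrD.
rewrite !real_normK ?num_real// addrAC lerDl.
by rewrite mulrn_wge0 // mulr_ge0.
Qed.

Lemma normc_real (x : R) : normc (x%:C)%C = `|x|.
Proof. by rewrite normc_sqrtE/= expr0n/= addr0 sqrtr_sqr. Qed.

Lemma normc_cexp_i (t : R) : normc (cexp_i t) = 1.
Proof. by rewrite normc_sqrtE/= cos2Dsin2 sqrtr1. Qed.

Lemma cexp_iD (s t : R) : cexp_i (s + t) = cexp_i s * cexp_i t.
Proof. by rewrite /cexp_i sinD cosD; simpc; rewrite [sin s * cos t + _]addrC. Qed.

Lemma cexp_i0 : cexp_i 0 = 1 :> R[i].
Proof. by rewrite /cexp_i sin0 cos0. Qed.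

Lemma normc_sum I (r : seq I) (P : pred I) (F : I -> R[i]) :
  normc (\sum_(i <- r | P i) F i) <= \sum_(i <- r | P i) normc (F i).
Proof.
elim/big_rec2 : _ => [|i y x _ h]; first by rewrite normc0.
by apply: le_trans (le_normcD _ _) _; rewrite lerD2l.
Qed.

Lemma normc_prod I (r : seq I) (P : pred I) (F : I -> R[i]) :
  normc (\prod_(i <- r | P i) F i) = \prod_(i <- r | P i) normc (F i).
Proof. by apply: (big_morph (@normc R)); [exact: normcM|exact: normc1]. Qed.

End complex_parts.

(** * Rudin-Shapiro polynomials *)

Section rudin_shapiro.
Context {R : realType}.

(* [b] selects between the two Rudin-Shapiro sequences P and Q of length [2 ^ m]:
   P_{m+1} = P_m Q_m and Q_{m+1} = P_m (-Q_m) as concatenations of words. *)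
Fixpoint rs (b : bool) (m k : nat) : R :=
  if m is m'.+1 then
    if (k < 2 ^ m')%N then rs true m' k
    else (-1) ^+ (~~ b) * rs false m' (k - 2 ^ m')
  else 1.

Lemma normr_rs b m k : `|rs b m k| = 1.
Proof.
elim: m b k => [|m IH] b k /=; first by rewrite normr1.
by case: ifP => _; rewrite ?normrM ?IH// normrX normrN1 expr1n mul1r.
Qed.

(* The factor [j ^ k] accounts for [k] derivatives of the trigonometric polynomial. *)
Definition rs_sum b m k (t : R) : R[i] :=
  \sum_(j < 2 ^ m) ((rs b m j * j%:R ^+ k)%:C)%C * cexp_i (j%:R * t).

Lemma rs_sum0 b k t : rs_sum b 0 k t = ((0 ^+ k)%:C)%C.
Proof. by rewrite /rs_sum expn0 big_ord1 mul0r cexp_i0 mulr1 mul1r. Qed.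

(** In the second half of the word the frequencies are shifted by [2 ^ m]: the exponential of the
    shift factors out, and the binomial expansion of [(j + 2 ^ m) ^ k] leaves the sums of order
    [i <= k] at level [m]. *)
Lemma rs_sumS b m k t : rs_sum b m.+1 k t = rs_sum true m k t +
  ((-1) ^+ (~~ b)) * (cexp_i (2 ^+ m * t) *
   \sum_(i < k.+1) ((('C(k, i))%:R * (2 ^+ m) ^+ (k - i))%:C)%C * rs_sum false m i t).
Proof.
have E1 : rs_sum b m.+1 k t = rs_sum true m k t + \sum_(j < 2 ^ m)
    (((-1) ^+ (~~ b) * rs false m j * (j + 2 ^ m)%:R ^+ k)%:C)%C *
    cexp_i ((j + 2 ^ m)%:R * t).
  rewrite /rs_sum expnS mul2n -addnn big_split_ord/=; congr (_ + _).
    by apply: eq_bigr => j _; rewrite ltn_ord.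
  apply: eq_bigr => j _.
  by rewrite ltnNge leq_addr/= addKn [(2 ^ m + j)%N]addnC.
rewrite E1; congr (_ + _); rewrite mulr_sumr mulr_sumr.
under [RHS]eq_bigr => i _.
  rewrite /rs_sum mulr_sumr mulr_sumr mulr_sumr.
  over.
rewrite exchange_big/=; apply: eq_bigr => j _.
rewrite natrD !mulrDl cexp_iD natrX [_ + 2 ^+ m]addrC exprDn.
rewrite mulr_sumr !rmorph_sum/= mulr_suml; apply: eq_bigr => i _.
rewrite -mulr_natr !rmorphM/= rmorphXn/= rmorphN1.
by ring.
Qed.

(** The two Rudin-Shapiro polynomials are estimated together as a vector, since the parallelogram
    law controls only the sum of their squares. *)
Definition nrm2 (z w : R[i]) : R := Num.sqrt (normc z ^+ 2 + normc w ^+ 2).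

Lemma nrm2_ge0 z w : 0 <= nrm2 z w. Proof. exact: sqrtr_ge0. Qed.

Lemma nrm2_sqr z w : nrm2 z w ^+ 2 = normc z ^+ 2 + normc w ^+ 2.
Proof. by rewrite sqr_sqrtr// addr_ge0// sqr_ge0. Qed.

Lemma nrm2_triangle z w z' w' : nrm2 (z + z') (w + w') <= nrm2 z w + nrm2 z' w'.
Proof.
have E a b : nrm2 a b = normc (normc a +i* normc b)%C by rewrite normc_sqrtE.
apply: (@le_trans _ _ (normc ((normc z +i* normc w) + (normc z' +i* normc w'))%C)).
  rewrite normc_sqrtE/= ler_wsqrtr// lerD// ler_pXn2r ?nnegrE ?normc_ge0 ?addr_ge0 ?normc_ge0//;
    exact: le_normcD.
by apply: le_trans (le_normcD _ _) _; rewrite -!E.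
Qed.

Lemma normc_le_nrm2r z w : normc w <= nrm2 z w.
Proof.
by rewrite -(ler_pXn2r (n := 2)) ?nnegrE ?normc_ge0 ?nrm2_ge0// nrm2_sqr lerDr sqr_ge0.
Qed.

Lemma normc_le_nrm2l z w : normc z <= nrm2 z w.
Proof.
by rewrite -(ler_pXn2r (n := 2)) ?nnegrE ?normc_ge0 ?nrm2_ge0// nrm2_sqr lerDl sqr_ge0.
Qed.

Lemma normc_parallelogram (z w : R[i]) :
  normc (z + w) ^+ 2 + normc (z - w) ^+ 2 = 2 * (normc z ^+ 2 + normc w ^+ 2).
Proof. by rewrite !normc_sqr; case: z w => [a b] [c d] /=; ring. Qed.

(** The two polynomials of level [m.+1] are the sum and the difference of the same two terms, and
    the exponential between them is unimodular. *)
Lemma rs_sum_nrm2 m k t : nrm2 (rs_sum true m.+1 k t) (rs_sum false m.+1 k t) =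
  Num.sqrt 2 * nrm2 (rs_sum true m k t)
   (\sum_(i < k.+1) ((('C(k, i))%:R * (2 ^+ m) ^+ (k - i))%:C)%C * rs_sum false m i t).
Proof.
rewrite !rs_sumS/= expr0 expr1 mul1r mulN1r /nrm2 normc_parallelogram.
by rewrite normcM normc_cexp_i mul1r sqrtrM.
Qed.

Lemma rs_sum_energy m t :
  normc (rs_sum true m 0 t) ^+ 2 + normc (rs_sum false m 0 t) ^+ 2 = 2 * 2 ^+ m.
Proof.
elim: m => [|m IH].
  by rewrite !rs_sum0 !expr0 normc_real normr1 expr1n mulr1.
rewrite -nrm2_sqr rs_sum_nrm2 exprMn sqr_sqrtr// big_ord1 bin0 mulr1 mul1r.
by rewrite nrm2_sqr IH -exprS.
Qed.

(** A Bernstein inequality: each derivative costs a factor [2 ^ m]. With M = 2^m the binomial sum of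
    the inductive bounds collapses to (M + M)^k = (2^(m+1))^k, so the constant does not grow with
    [m] or [k]. *)
Lemma rs_sum_bound m k t : nrm2 (rs_sum true m k t) (rs_sum false m k t) <=
  Num.sqrt 2 * Num.sqrt (2 ^+ m) * (2 ^+ m) ^+ k.
Proof.
elim: m k => [|m IH] k.
  rewrite expr0 sqrtr1 mulr1 expr1n mulr1 /nrm2 !rs_sum0 normc_real.
  case: k => [|k]; last by rewrite !expr0n/= normr0 expr0n addr0 sqrtr0 sqrtr_ge0.
  by rewrite expr0 normr1 expr1n.
rewrite rs_sum_nrm2 [2 ^+ m.+1]exprS sqrtrM// -!mulrA ler_wpM2l ?sqrtr_ge0//.
set M : R := 2 ^+ m; have M0 : 0 <= M by rewrite exprn_ge0.
set K := Num.sqrt 2 * Num.sqrt M; have K0 : 0 <= K by rewrite mulr_ge0 ?sqrtr_ge0.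
apply: (@le_trans _ _ (K * (M + M) ^+ k)); last first.
  by rewrite /K mulrA (_ : M + M = 2 * M)//; ring.
rewrite exprDn big_ord_recr/= subnn expr0 binn !mul1r.
rewrite -[rs_sum true m k t]add0r.
(* The term [i = k] together with the first polynomial is the pair of the induction hypothesis; the
   terms of lower order form a vector with first entry 0. *)
apply: le_trans (nrm2_triangle _ _ _ _) _.
rewrite big_ord_recr/= subnn binn mulrDr; apply: lerD; last first.
  by rewrite expr0 mul1r mulr1n; exact: IH.
rewrite /nrm2 normc0 expr0n/= add0r sqrtr_sqr ger0_norm ?normc_ge0//.
apply: le_trans (normc_sum _ _ _) _.
rewrite mulr_sumr; apply: ler_sum => i _.
rewrite normcM normc_real ger0_norm ?mulr_ge0 ?exprn_ge0//.
apply: (@le_trans _ _ ('C(k, i)%:R * M ^+ (k - i) * (K * M ^+ i))).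
  rewrite ler_wpM2l ?mulr_ge0 ?exprn_ge0//.
  exact: le_trans (normc_le_nrm2r _ _) (IH i).
by rewrite le_eqVlt; apply/orP; left; apply/eqP; rewrite -mulr_natl; ring.
Qed.

Lemma Re_rs_sum b m k t : complex.Re (rs_sum b m k t) =
  \sum_(j < 2 ^ m) rs b m j * j%:R ^+ k * cos (j%:R * t).
Proof.
by rewrite Rec_sum; apply: eq_bigr => j _; rewrite RecM/= mul0r subr0.
Qed.

Lemma Im_rs_sum b m k t : complex.Im (rs_sum b m k t) =
  \sum_(j < 2 ^ m) rs b m j * j%:R ^+ k * sin (j%:R * t).
Proof.
by rewrite Imc_sum; apply: eq_bigr => j _; rewrite ImcM/= mul0r addr0.
Qed.

Lemma is_derive_sumf n (h : 'I_n -> R -> R) (dh : 'I_n -> R) (t : R) :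
  (forall j, is_derive t 1 (h j) (dh j)) ->
  is_derive t 1 (fun t => \sum_j h j t) (\sum_j dh j).
Proof.
move=> H; rewrite (_ : (fun t => _) = \sum_j h j); first exact: is_derive_sum.
by apply/funext => s; rewrite fct_sumE.
Qed.

Lemma is_derive_Re_rs_sum b m k (t : R) :
  is_derive t 1 (fun t => complex.Re (rs_sum b m k t))
    (- complex.Im (rs_sum b m k.+1 t)).
Proof.
under eq_fun do rewrite Re_rs_sum.
rewrite Im_rs_sum -sumrN; apply: is_derive_sumf => j.
rewrite exprSr mulrA -mulrA -mulrN; apply: is_derive_mulrf.
rewrite mulrC -mulNr.
apply: (@is_derive1_comp _ cos (fun t => j%:R * t)).
by rewrite -[X in is_derive _ _ _ X]mulr1; apply: is_derive_mulrf.
Qed.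

Lemma is_derive_Im_rs_sum b m k (t : R) :
  is_derive t 1 (fun t => complex.Im (rs_sum b m k t))
    (complex.Re (rs_sum b m k.+1 t)).
Proof.
under eq_fun do rewrite Im_rs_sum.
rewrite Re_rs_sum; apply: is_derive_sumf => j.
rewrite exprSr mulrA -mulrA; apply: is_derive_mulrf.
rewrite mulrC.
apply: (@is_derive1_comp _ sin (fun t => j%:R * t)).
by rewrite -[X in is_derive _ _ _ X]mulr1; apply: is_derive_mulrf.
Qed.

Lemma rs_sum_weight_bound b m k (t : R) :
  `|(Num.sqrt (2 ^+ m))^-1 * (2 ^+ m)^-1 ^+ k| * normc (rs_sum b m k t) <= Num.sqrt 2.
Proof.
have M0 : 0 < 2 ^+ m :> R by rewrite exprn_gt0.
have W0 : 0 <= (Num.sqrt (2 ^+ m))^-1 * (2 ^+ m)^-1 ^+ k :> R.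
  by rewrite mulr_ge0 ?invr_ge0 ?sqrtr_ge0// exprn_ge0// invr_ge0 ltW.
rewrite ger0_norm//; apply: (@le_trans _ _ ((Num.sqrt (2 ^+ m))^-1 * (2 ^+ m)^-1 ^+ k *
    (Num.sqrt 2 * Num.sqrt (2 ^+ m) * (2 ^+ m) ^+ k))).
  rewrite ler_wpM2l//; apply: le_trans (rs_sum_bound m k t).
  by case: b; [exact: normc_le_nrm2l|exact: normc_le_nrm2r].
have S0 : Num.sqrt (2 ^+ m) != 0 :> R by rewrite gt_eqF// sqrtr_gt0.
rewrite exprVn; move: (2 ^+ m) M0 S0 => M M0 S0 {W0}.
have MK0 : M ^+ k != 0 by rewrite expf_neq0// gt_eqF.
move: (M ^+ k) MK0 => MK MK0; rewrite le_eqVlt; apply/orP; left; apply/eqP.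
by field; rewrite MK0 S0.
Qed.

(** The induction on [n] is generalised over [k]: up to sign, differentiation swaps real and
    imaginary part and raises [k] by one, and the weight for [k.+1] is the weight for [k] times the
    rate. *)
Lemma tame_rs_sum n k :
  let r (bm : bool * nat) (_ : unit) : R := (2 ^+ bm.2)^-1 in
  let w (bm : bool * nat) : R := (Num.sqrt (2 ^+ bm.2))^-1 * (2 ^+ bm.2)^-1 ^+ k in
  tame e1 r w n (fun bm t => complex.Re (rs_sum bm.1 bm.2 k t)) /\
  tame e1 r w n (fun bm t => complex.Im (rs_sum bm.1 bm.2 k t)).
Proof.
move=> r; elim: n k => [|n IH] k w.
all: have cR bm : continuous (fun t => complex.Re (rs_sum bm.1 bm.2 k t) : R)
  by move=> t; apply: differentiable_continuous; apply/derivable1_diffP;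
     have [] := is_derive_Re_rs_sum bm.1 bm.2 k t.
all: have cI bm : continuous (fun t => complex.Im (rs_sum bm.1 bm.2 k t) : R)
  by move=> t; apply: differentiable_continuous; apply/derivable1_diffP;
     have [] := is_derive_Im_rs_sum bm.1 bm.2 k t.
all: have bR : exists M : R, forall bm (t : R), `|w bm * complex.Re (rs_sum bm.1 bm.2 k t)| <= M
  by exists (Num.sqrt 2) => bm t; apply: le_trans (rs_sum_weight_bound bm.1 bm.2 k t);
     rewrite normrM ler_wpM2l// Re_le_normc.
all: have bI : exists M : R, forall bm (t : R), `|w bm * complex.Im (rs_sum bm.1 bm.2 k t)| <= M
  by exists (Num.sqrt 2) => bm t; apply: le_trans (rs_sum_weight_bound bm.1 bm.2 k t);
     rewrite normrM ler_wpM2l// Im_le_normc.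
  by split.
have [IHR IHI] := IH k.+1.
have wE : (fun bm => w bm * r bm tt) =
    (fun bm => (Num.sqrt (2 ^+ bm.2))^-1 * (2 ^+ bm.2)^-1 ^+ k.+1).
  by apply/funext => bm; rewrite /w /r exprSr mulrA.
split; split=> // -[].
- exists (fun bm t => -1 * complex.Im (rs_sum bm.1 bm.2 k.+1 t)); split.
    by move=> bm t; rewrite mulN1r; exact: is_derive_Re_rs_sum.
  have N1 : tame e1 r (fun=> 1) n (fun _ (_ : R) => -1).
    by apply: (@tame_cst _ _ _ _ _ _ _ _ _ 1) => _; rewrite mul1r normrN normr1.
  rewrite wE; have := tameM N1 IHI.
  by rewrite (_ : (fun th => 1 * _) = fun bm => (Num.sqrt (2 ^+ bm.2))^-1 * (2 ^+ bm.2)^-1 ^+ k.+1)//;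
    apply/funext => bm; rewrite mul1r.
- exists (fun bm t => complex.Re (rs_sum bm.1 bm.2 k.+1 t)); split; last by rewrite wE.
  by move=> bm t; exact: is_derive_Im_rs_sum.
Qed.

End rudin_shapiro.

(** * Complex integrals *)

Section complex_integral.
Context {d} {T : measurableType d} {R : realType}.
Variable mu : {measure set T -> \bar R}.
Implicit Types (f g : T -> R[i]) (h : T -> R).

Definition cmeasurable f : Prop :=
  measurable_fun setT (fun x => complex.Re (f x)) /\
  measurable_fun setT (fun x => complex.Im (f x)).

Definition rintegrable h : Prop := mu.-integrable setT (EFin \o h).

Definition cintegrable f : Prop :=
  rintegrable (fun x => complex.Re (f x)) /\ rintegrable (fun x => complex.Im (f x)).

(** At [lebesgue_rV n] this is [cintegral]; other measures occur on the line and on products. *)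
Definition cint f : R[i] :=
  ((\int[mu]_x complex.Re (f x)) +i* (\int[mu]_x complex.Im (f x)))%C.

Lemma cmeasurableM f g : cmeasurable f -> cmeasurable g ->
  cmeasurable (fun x => f x * g x).
Proof.
move=> [fR fI] [gR gI]; split.
  under eq_fun do rewrite RecM.
  by apply: measurable_funB; exact: measurable_funM.
under eq_fun do rewrite ImcM.
by apply: measurable_funD; exact: measurable_funM.
Qed.

Lemma cmeasurableD f g : cmeasurable f -> cmeasurable g ->
  cmeasurable (fun x => f x + g x).
Proof.
move=> [fR fI] [gR gI]; split.
  under eq_fun do rewrite RecD.
  exact: measurable_funD.
under eq_fun do rewrite ImcD.
exact: measurable_funD.
Qed.

Lemma cmeasurable_cst (z : R[i]) : cmeasurable (fun=> z).
Proof. by split; exact: measurable_cst. Qed.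

Lemma cmeasurable_real h : measurable_fun setT h -> cmeasurable (fun x => (h x)%:C%C).
Proof. by move=> mh; split=> //=; exact: measurable_cst. Qed.

Lemma cmeasurable_sum I (s : seq I) (F : I -> T -> R[i]) :
  (forall i, cmeasurable (F i)) -> cmeasurable (fun x => \sum_(i <- s) F i x).
Proof.
move=> mF; elim: s => [|i s IH].
  by under eq_fun do rewrite big_nil; exact: cmeasurable_cst.
by under eq_fun do rewrite big_cons; exact: cmeasurableD.
Qed.

Lemma cmeasurable_prod I (s : seq I) (F : I -> T -> R[i]) :
  (forall i, cmeasurable (F i)) -> cmeasurable (fun x => \prod_(i <- s) F i x).
Proof.
move=> mF; elim: s => [|i s IH].
  by under eq_fun do rewrite big_nil; exact: cmeasurable_cst.
by under eq_fun do rewrite big_cons; exact: cmeasurableM.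
Qed.

Lemma measurable_normc f : cmeasurable f -> measurable_fun setT (fun x => normc (f x)).
Proof.
move=> [fR fI]; under eq_fun do rewrite normc_sqrtE.
apply: (measurableT_comp (continuous_measurable_fun (@sqrt_continuous R))); apply: measurable_funD; exact: measurable_funX.
Qed.

Lemma cintegrable_measurable f : cintegrable f -> cmeasurable f.
Proof.
by move=> [/measurable_int/measurable_EFinP fR /measurable_int/measurable_EFinP fI].
Qed.

Lemma rintegrable_le h k : measurable_fun setT h -> rintegrable k ->
  (forall x, `|h x| <= k x) -> rintegrable h.
Proof.
move=> mh ik hk; apply: (le_integrable measurableT _ _ ik).
  exact/measurable_EFinP.
by move=> x _ /=; rewrite lee_fin (le_trans (hk x))// ler_norm.
Qed.

Lemma cintegrable_le f k : cmeasurable f -> rintegrable k ->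
  (forall x, normc (f x) <= k x) -> cintegrable f.
Proof.
move=> [fR fI] ik fk; split; apply: (rintegrable_le _ ik) => // x.
  exact: le_trans (Re_le_normc _) (fk x).
exact: le_trans (Im_le_normc _) (fk x).
Qed.

Lemma rintegrableD h k : rintegrable h -> rintegrable k ->
  rintegrable (fun x => h x + k x).
Proof. by move=> ih ik; have := integrableD measurableT ih ik. Qed.

Lemma rintegrableB h k : rintegrable h -> rintegrable k ->
  rintegrable (fun x => h x - k x).
Proof. by move=> ih ik; have := integrableB measurableT ih ik. Qed.

Lemma rintegrableZ (r : R) h : rintegrable h -> rintegrable (fun x => r * h x).
Proof. by move=> ih; have := integrableZl measurableT r ih. Qed.

Lemma rintegrable_abs h : rintegrable h -> rintegrable (fun x => `|h x|).
Proof. by move=> ih; have := integrable_abse ih. Qed.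

Lemma rintegrable_normc f : cintegrable f -> rintegrable (fun x => normc (f x)).
Proof.
move=> fi; have [fR fI] := fi.
apply: (rintegrable_le _ (rintegrableD (rintegrable_abs fR) (rintegrable_abs fI))).
  exact/measurable_normc/cintegrable_measurable.
by move=> x; rewrite ger0_norm ?normc_ge0// normc_le_Re_Im.
Qed.

Lemma cintegrableD f g : cintegrable f -> cintegrable g ->
  cintegrable (fun x => f x + g x).
Proof.
move=> [fR fI] [gR gI]; split.
  by under eq_fun do rewrite RecD; exact: rintegrableD.
by under eq_fun do rewrite ImcD; exact: rintegrableD.
Qed.

Lemma cintegrableZ (z : R[i]) f : cintegrable f -> cintegrable (fun x => z * f x).
Proof.
move=> [fR fI]; split.
  under eq_fun do rewrite RecM.
  by apply: rintegrableB; exact: rintegrableZ.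
under eq_fun do rewrite ImcM.
by apply: rintegrableD; exact: rintegrableZ.
Qed.

Lemma cintegrableM_bounded f g M : cintegrable f -> cmeasurable g ->
  (forall x, normc (g x) <= M) -> cintegrable (fun x => g x * f x).
Proof.
move=> fi mg gM.
apply: (cintegrable_le _ (rintegrableZ M (rintegrable_normc fi))).
  by apply: cmeasurableM => //; exact: cintegrable_measurable.
by move=> x; rewrite normcM ler_wpM2r ?normc_ge0.
Qed.

Lemma cintD f g : cintegrable f -> cintegrable g ->
  cint (fun x => f x + g x) = cint f + cint g.
Proof.
move=> [fR fI] [gR gI]; rewrite /cint.
under eq_Rintegral do rewrite RecD.
under [X in (_ +i* X)%C]eq_Rintegral do rewrite ImcD.
by rewrite !RintegralD.
Qed.

Lemma cintZ (z : R[i]) f : cintegrable f -> cint (fun x => z * f x) = z * cint f.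
Proof.
move=> [fR fI]; rewrite /cint.
under eq_Rintegral do rewrite RecM.
under [X in (_ +i* X)%C]eq_Rintegral do rewrite ImcM.
rewrite RintegralB ?RintegralD//; [|exact: rintegrableZ..].
rewrite !RintegralZl//.
by apply/eqP; rewrite eq_complex; apply/andP; split; rewrite ?RecM ?ImcM.
Qed.

Lemma cintegrable_sum n (F : 'I_n -> T -> R[i]) : (forall i, cintegrable (F i)) ->
  cintegrable (fun x => \sum_i F i x).
Proof.
elim: n F => [|n IH] F iF.
  by under eq_fun do rewrite big_ord0; split; exact: integrable0.
under eq_fun do rewrite big_ord_recl.
by apply: cintegrableD => //; exact: (IH (fun i => F (lift ord0 i))).
Qed.

Lemma cint_sum n (F : 'I_n -> T -> R[i]) : (forall i, cintegrable (F i)) ->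
  cint (fun x => \sum_i F i x) = \sum_i cint (F i).
Proof.
elim: n F => [|n IH] F iF.
  rewrite big_ord0 /cint; under eq_Rintegral do rewrite big_ord0.
  under [X in (_ +i* X)%C]eq_Rintegral do rewrite big_ord0.
  by rewrite /= Rintegral_cst// mul0r.
rewrite big_ord_recl -IH// -cintD//; last exact: cintegrable_sum.
by congr cint; apply/funext => x; rewrite big_ord_recl.
Qed.

(** The factor 2 comes from estimating real and imaginary part separately; it recurs in the
    constants below. *)
Lemma normc_cint_le f : cintegrable f -> normc (cint f) <= 2 * \int[mu]_x normc (f x).
Proof.
move=> fi; have [fR fI] := fi; apply: le_trans (normc_le_Re_Im _) _.
rewrite mulr_natl mulr2n /=.
by apply: lerD; (apply: le_trans (le_normr_Rintegral _ _) _ => //);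
  apply: le_Rintegral => //; try (by apply: rintegrable_abs); try (by apply: rintegrable_normc);
  move=> x _; [exact: Re_le_normc|exact: Im_le_normc].
Qed.

End complex_integral.

(** * Fubini and tensor products for real and complex integrals *)

Section product_integral.
Context d1 d2 (T1 : measurableType d1) (T2 : measurableType d2) (R : realType).
Variable m1 : {sigma_finite_measure set T1 -> \bar R}.
Variable m2 : {sigma_finite_measure set T2 -> \bar R}.

(** [fine] replaces an infinite inner integral by 0. This does not increase absolute values, and
    happens only on a null set. *)
Lemma rintegrable_inner1 (f : T1 * T2 -> R) : rintegrable (m1 \x m2)%E f ->
  rintegrable m1 (fun x => \int[m2]_y f (x, y)) /\
  \int[m1]_x \int[m2]_y f (x, y) = \int[(m1 \x m2)%E]_z f z.
Proof.
move=> fi; have iF := integrable_fubini_F fi.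
have mF : measurable_fun setT (fun x => \int[m2]_y f (x, y)).
  exact: (measurableT_comp (fine_measurable measurableT) (measurable_int _ iF)).
split.
  apply: (le_integrable measurableT _ _ iF); first exact/measurable_EFinP.
  move=> x _; rewrite /= /Rintegral /fubini_F /=.
  by case: (integral _ _ _) => [r| |] //=; rewrite ?normr0 ?leey.
rewrite [RHS]/Rintegral -(integral12_prod_meas1 fi) [LHS]/Rintegral; congr fine.
apply: ae_eq_integral => //.
- exact/measurable_EFinP.
- exact: measurable_int iF.
move: (ae_integrable1 fi); apply: filterS => x /(integrable_fin_num measurableT).
by move=> h _; rewrite /= /Rintegral fineK.
Qed.

Lemma Rintegral_inner2 (f : T1 * T2 -> R) : rintegrable (m1 \x m2)%E f ->
  \int[m2]_y \int[m1]_x f (x, y) = \int[(m1 \x m2)%E]_z f z.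
Proof.
move=> fi; have mG := measurable_fubini_G fi.
rewrite [RHS]/Rintegral -(integral21_prod_meas1 fi) [LHS]/Rintegral; congr fine.
apply: ae_eq_integral => //.
  by apply/measurable_EFinP; exact: (measurableT_comp (fine_measurable measurableT) mG).
move: (ae_integrable2 fi); apply: filterS => x /(integrable_fin_num measurableT).
by move=> h _; rewrite /= /Rintegral fineK.
Qed.

Lemma cFubini (f : T1 * T2 -> R[i]) : cintegrable (m1 \x m2)%E f ->
  cint m1 (fun x => cint m2 (fun y => f (x, y))) =
  cint m2 (fun y => cint m1 (fun x => f (x, y))).
Proof.
move=> [fR fI]; congr Complex => /=.
  by rewrite (rintegrable_inner1 fR).2 (Rintegral_inner2 fR).
by rewrite (rintegrable_inner1 fI).2 (Rintegral_inner2 fI).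
Qed.

Lemma rintegrable_tensor (f : T1 -> R) (g : T2 -> R) :
  rintegrable m1 f -> rintegrable m2 g ->
  rintegrable (m1 \x m2)%E (fun z => f z.1 * g z.2) /\
  \int[(m1 \x m2)%E]_z (f z.1 * g z.2) = (\int[m1]_x f x) * \int[m2]_y g y.
Proof.
move=> fi gi.
have mf : measurable_fun setT f by apply/measurable_EFinP/(measurable_int _ fi).
have mg : measurable_fun setT g by apply/measurable_EFinP/(measurable_int _ gi).
have mfg : measurable_fun setT (fun z : T1 * T2 => f z.1 * g z.2).
  apply: measurable_funM.
    exact: (measurableT_comp mf measurable_fst).
  exact: (measurableT_comp mg measurable_snd).
have ifg : rintegrable (m1 \x m2)%E (fun z => f z.1 * g z.2).
  apply/integrable12ltyP; first exact/measurable_EFinP.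
  have -> : (\int[m1]_x \int[m2]_y `|(EFin \o (fun z : T1 * T2 => (f z.1 * g z.2)%R)) (x, y)|
     = \int[m1]_x (`|f x|%:E * \int[m2]_y `|(EFin \o g) y|))%E.
    apply: eq_integral => x _; rewrite -ge0_integralZl//; last first.
      by apply: measurableT_comp => //; exact/measurable_EFinP.
    by apply: eq_integral => y _; rewrite /= normrM EFinM.
  have /integrableP[_ gfin] := gi; have /integrableP[_ ffin] := fi.
  rewrite ge0_integralZr//.
  - by rewrite lte_mul_pinfty//; [exact: integral_ge0|rewrite ge0_fin_numE//; exact: integral_ge0].
  - by apply/measurable_EFinP; exact: measurableT_comp.
  - exact: integral_ge0.
split=> //; rewrite -(rintegrable_inner1 ifg).2 -RintegralZr//.
by apply: eq_Rintegral => x _; rewrite /= RintegralZl.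
Qed.

Lemma cint_tensor (f : T1 -> R[i]) (g : T2 -> R[i]) :
  cintegrable m1 f -> cintegrable m2 g ->
  cintegrable (m1 \x m2)%E (fun z => f z.1 * g z.2) /\
  cint (m1 \x m2)%E (fun z => f z.1 * g z.2) = cint m1 f * cint m2 g.
Proof.
move=> [fR fI] [gR gI].
have [RR RRE] := rintegrable_tensor fR gR.
have [II IIE] := rintegrable_tensor fI gI.
have [RI RIE] := rintegrable_tensor fR gI.
have [IR IRE] := rintegrable_tensor fI gR.
split.
  split; [under eq_fun do rewrite RecM|under eq_fun do rewrite ImcM].
    exact: rintegrableB.
  exact: rintegrableD.
rewrite /cint.
under eq_Rintegral do rewrite RecM.
under [X in (_ +i* X)%C]eq_Rintegral do rewrite ImcM.
by rewrite RintegralB// RintegralD// RRE IIE RIE IRE; simpc.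
Qed.

End product_integral.

(** * Integration of products of one-variable functions over R^n *)

Section rV_integral.
Context {R : realType}.

Lemma rintegrable_rV_cons n (f : 'rV[R]_n.+1 -> R) : measurable_fun setT f ->
  rintegrable ((@lebesgue_measure R) \x (lebesgue_rV n))%E (f \o @rV_cons R n) ->
  rintegrable (lebesgue_rV n.+1) f /\
  \int[lebesgue_rV n.+1]_x f x =
  \int[((@lebesgue_measure R) \x (lebesgue_rV n))%E]_z f (rV_cons z).
Proof.
move=> mf fi.
have mc := @measurable_rV_cons R n.
have mfE : measurable_fun setT (EFin \o f) by apply/measurable_EFinP.
split.
  have := @integrable_pushforward _ _ _ _ _ _ mc ((@lebesgue_measure R) \x (lebesgue_rV n))%E setT (EFin \o f) mfE.
  rewrite preimage_setT => /(_ fi measurableT).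
  exact.
rewrite /Rintegral; congr fine.
have := @integral_pushforward _ _ _ _ _ _ mc ((@lebesgue_measure R) \x (lebesgue_rV n))%E setT (EFin \o f) mfE.
by rewrite preimage_setT => /(_ fi measurableT).
Qed.

Lemma cint_rV_prod n (f : 'I_n -> R -> R[i]) :
  (forall j, cintegrable (@lebesgue_measure R) (f j)) ->
  cintegrable (lebesgue_rV n) (fun x => \prod_j f j (x 0 j)) /\
  cint (lebesgue_rV n) (fun x => \prod_j f j (x 0 j)) =
    \prod_j cint (@lebesgue_measure R) (f j).
Proof.
elim: n f => [|n IH] f fi.
  have E : (fun x : 'rV[R]_0 => \prod_(j < 0) f j (x 0 j)) = cst 1.
    by apply/funext => x; rewrite big_ord0.
  rewrite E big_ord0; split.
    by split; exact: finite_measure_integrable_cst measurableT.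
  (* The measure on R^0 is a unit point mass, so the empty product integrates to 1. *)
  have H1 : lebesgue_rV 0 [set: 'rV[R]_0] = 1%E by exact: diracT.
  have H (r : R) : \int[lebesgue_rV 0]_x r = r.
    rewrite [LHS](@Rintegral_cst _ _ _ (lebesgue_rV 0) setT measurableT r) -[RHS]mulr1.
    by apply: congr1; exact: (congr1 fine H1).
  transitivity (Complex (1 : R) 0) => //; rewrite /cint; congr Complex; [exact: (H 1)|exact: (H 0)].
have [iT eT] := IH (fun j => f (lift ord0 j)) (fun j => fi _).
have [iP eP] := cint_tensor (fi ord0) iT.
have mfj j : cmeasurable (fun x : 'rV[R]_n.+1 => f j (x 0 j)).
  have [mR mI] := cintegrable_measurable (fi j).
  by split; [exact: (measurableT_comp mR (measurable_rV_coord j))|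
             exact: (measurableT_comp mI (measurable_rV_coord j))].
have [mR mI] := cmeasurable_prod (index_enum 'I_n.+1) mfj.
have E : (fun z : measurableTypeR R * 'rV[R]_n => f ord0 z.1 * \prod_j f (lift ord0 j) (z.2 0 j)) =
    (fun z => \prod_j f j (rV_cons z 0 j)).
  apply/funext => z; rewrite big_ord_recl rV_cons0; congr (_ * _).
  by apply: eq_bigr => j _; rewrite rV_consS.
rewrite E in iP eP.
have [iR eR] := rintegrable_rV_cons mR iP.1.
have [iI eI] := rintegrable_rV_cons mI iP.2.
split; first by split.
by rewrite big_ord_recl -eT -eP; congr Complex.
Qed.

End rV_integral.

Section measurable_inner.
Context d1 d2 (T1 : measurableType d1) (T2 : measurableType d2) (R : realType).
Variable m2 : {sigma_finite_measure set T2 -> \bar R}.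

(** Only measurability is assumed, so Tonelli is applied to the positive and negative parts
    separately. *)
Lemma measurable_Rintegral_inner (f : T1 * T2 -> R) : measurable_fun setT f ->
  measurable_fun setT (fun x => \int[m2]_y f (x, y)).
Proof.
move=> mf; apply: (measurableT_comp (fine_measurable measurableT)).
have mfE : measurable_fun setT (EFin \o f) by exact/measurable_EFinP.
rewrite (_ : (fun x => _) = (fun x => (\int[m2]_y (EFin \o f)^\+ (x, y)) -
    (\int[m2]_y (EFin \o f)^\- (x, y)))%E); last first.
  apply/funext => x; rewrite integralE.
  by congr (_ - _)%E; apply: eq_integral => y _; rewrite ?funeposE ?funenegE.
apply: emeasurable_funB.
  by apply: measurable_fun_fubini_tonelli_F => //; exact: measurable_funepos.
by apply: measurable_fun_fubini_tonelli_F => //; exact: measurable_funeneg.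
Qed.

End measurable_inner.

(** * Duality for Fourier multipliers *)

Section pairing.
Context {R : realType} {n : nat}.
Implicit Types (sigma u v : 'rV[R]_n -> R[i]).
Notation mu := (lebesgue_rV n).

Lemma measurable_dotrV :
  measurable_fun setT (fun z : 'rV[R]_n * 'rV[R]_n => dotrV z.2 z.1).
Proof.
apply: measurable_sum => j; apply: measurable_funM.
  exact: (measurableT_comp (measurable_rV_coord j) measurable_snd).
exact: (measurableT_comp (measurable_rV_coord j) measurable_fst).
Qed.

Lemma cmeasurable_cexp_i d (T : measurableType d) (h : T -> R) :
  measurable_fun setT h -> cmeasurable (fun x => cexp_i (h x)).
Proof.
move=> mh; split.
  exact: (measurableT_comp (continuous_measurable_fun (@continuous_cos R)) mh).
exact: (measurableT_comp (continuous_measurable_fun (@continuous_sin R)) mh).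
Qed.

Lemma cmeasurable_comp d d' (S : measurableType d) (T : measurableType d')
    (f : T -> R[i]) (g : S -> T) :
  cmeasurable f -> measurable_fun setT g -> cmeasurable (f \o g).
Proof.
by move=> [fR fI] mg; split; [exact: (measurableT_comp fR mg)|exact: (measurableT_comp fI mg)].
Qed.

Lemma cmeasurable_multiplier sigma u : cmeasurable sigma -> cmeasurable (fourier u) ->
  cmeasurable (multiplier sigma u).
Proof.
move=> ms mu'; apply: cmeasurableM; first exact: cmeasurable_cst.
have [KR KI] : cmeasurable (fun z : 'rV[R]_n * 'rV[R]_n =>
    cexp_i (dotrV z.2 z.1) * sigma z.2 * fourier u z.2).
  apply: cmeasurableM.
    apply: cmeasurableM; first exact: cmeasurable_cexp_i measurable_dotrV.
    exact: (cmeasurable_comp ms measurable_snd).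
  exact: (cmeasurable_comp mu' measurable_snd).
split.
  exact: (measurable_Rintegral_inner (lebesgue_rV n) KR).
exact: (measurable_Rintegral_inner (lebesgue_rV n) KI).
Qed.

(** Fubini for the kernel [K]: the product of [v] and the transform of [u] is integrable, and the
    remaining factor is bounded by [M]. The pairing is bilinear, without conjugation, so [v] meets
    the exponential of opposite sign. *)
Lemma multiplier_pairing sigma u v M :
  cmeasurable sigma -> (forall xi, normc (sigma xi) <= M) ->
  cintegrable mu (fourier u) -> cintegrable mu v ->
  cintegrable mu (fun x => multiplier sigma u x * v x) /\
  cint mu (fun x => multiplier sigma u x * v x) = ((2 * pi) ^- n)%:C%C *
    cint mu (fun xi => sigma xi * (fourier u xi *
      cint mu (fun x => cexp_i (dotrV xi x) * v x))).
Proof.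
move=> ms sM iu iv.
pose K (z : 'rV[R]_n * 'rV[R]_n) :=
  (cexp_i (dotrV z.2 z.1) * sigma z.2) * (v z.1 * fourier u z.2).
have iK : cintegrable (mu \x mu)%E K.
  apply: (@cintegrableM_bounded _ _ _ _ _ _ M).
  - exact: (cint_tensor iv iu).1.
  - apply: cmeasurableM; first exact: cmeasurable_cexp_i measurable_dotrV.
    exact: (cmeasurable_comp ms measurable_snd).
  - by move=> z; rewrite normcM normc_cexp_i mul1r.
have iu' x : cintegrable mu (fun xi => cexp_i (dotrV xi x) * sigma xi * fourier u xi).
  apply: (@cintegrableM_bounded _ _ _ _ _ _ M) => //.
    apply: cmeasurableM => //; apply: cmeasurable_cexp_i.
    apply: measurable_sum => j; apply: measurable_funM; last exact: measurable_cst.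
    exact: measurable_rV_coord.
  by move=> z; rewrite normcM normc_cexp_i mul1r.
have E x : multiplier sigma u x * v x =
    ((2 * pi) ^- n)%:C%C * cint mu (fun xi => K (x, xi)).
  rewrite /multiplier -mulrA; congr (_ * _).
  rewrite mulrC -[cintegral _]/(cint mu _) -cintZ//.
  by congr cint; apply/funext => xi; rewrite /K/=; ring.
have iKx : cintegrable mu (fun x => cint mu (fun xi => K (x, xi))).
  by split; [exact: (rintegrable_inner1 iK.1).1|exact: (rintegrable_inner1 iK.2).1].
split; first by under eq_fun do rewrite E; exact: cintegrableZ.
under eq_fun do rewrite E.
rewrite cintZ// cFubini//; congr (_ * cint _ _); apply/funext => xi.
rewrite mulrA -cintZ; first by congr cint; apply/funext => x; rewrite /K/=; ring.
apply: (@cintegrableM_bounded _ _ _ _ _ _ 1) => //; last by move=> x; rewrite normc_cexp_i.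
apply: cmeasurable_cexp_i.
apply: measurable_sum => j; apply: measurable_funM; first exact: measurable_cst.
exact: measurable_rV_coord.
Qed.

Lemma cint_hoelder p q (f g : 'rV[R]_n -> R[i]) : 0 < p -> 0 < q -> p^-1 + q^-1 = 1 ->
  cmeasurable f -> cmeasurable g -> cintegrable mu (fun x => f x * g x) ->
  ((normc (cint mu (fun x => f x * g x)))%:E <= 2%:E * (cLnorm p f * cLnorm q g))%E.
Proof.
move=> p0 q0 pq mf mg ifg.
have H := hoelder mu (measurable_normc mf) (measurable_normc mg) p0 q0 pq.
apply: le_trans (lee_wpmul2l _ H) => //.
rewrite Lnorm1.
apply: (@le_trans _ _ (2 * \int[mu]_x normc (f x * g x))%:E).
  by rewrite lee_fin normc_cint_le.
have /integrable_fin_num h := rintegrable_normc ifg.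
rewrite EFinM lee_wpmul2l// /Rintegral fineK//; last exact: h.
rewrite le_eqVlt; apply/orP; left; apply/eqP; apply: eq_integral => x _.
by rewrite /= normcM ger0_norm// mulr_ge0 ?normc_ge0.
Qed.

(** Read as a lower bound for [A]: a pairing that is large compared with [du * dv] forces a large
    operator norm. *)
Lemma multiplier_pairing_le p q sigma u v M A du dv :
  0 < p -> 0 < q -> p^-1 + q^-1 = 1 ->
  cmeasurable sigma -> (forall xi, normc (sigma xi) <= M) ->
  cintegrable mu (fourier u) -> cintegrable mu v ->
  0 <= A -> 0 <= du -> 0 <= dv ->
  (cLnorm p u <= du%:E)%E -> (cLnorm q v <= dv%:E)%E ->
  (cLnorm p (multiplier sigma u) <= A%:E * cLnorm p u)%E ->
  normc (cint mu (fun xi => sigma xi * (fourier u xi *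
      cint mu (fun x => cexp_i (dotrV xi x) * v x)))) <=
  2 * (2 * pi) ^+ n * A * (du * dv).
Proof.
move=> p0 q0 pq ms sM iu iv A0 du0 dv0 udu vdv hA.
have [ip pE] := multiplier_pairing ms sM iu iv.
have mm := cmeasurable_multiplier ms (cintegrable_measurable iu).
have := cint_hoelder p0 q0 pq mm (cintegrable_measurable iv) ip.
have pi0 : 0 < (2 * pi) ^+ n :> R by rewrite exprn_gt0// mulr_gt0// pi_gt0.
rewrite pE normcM normc_real ger0_norm ?invr_ge0 ?(ltW pi0)//.
move: (normc _) => z H.
have {}H : (((2 * pi) ^- n * z)%:E <= (2 * (A * du * dv))%:E)%E.
  apply: le_trans H _; rewrite EFinM lee_wpmul2l// EFinM.
  apply: lee_pmul => //; try exact: Lnorm_ge0.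
  by apply: le_trans hA _; rewrite EFinM lee_wpmul2l.
rewrite lee_fin mulrC ler_pdivrMr// in H.
by apply: le_trans H _; rewrite le_eqVlt; apply/orP; left; apply/eqP; ring.
Qed.

End pairing.

(** * Affine change of variables on the line *)

Section affine_substitution.
Context {R : realType}.
Notation leb := (@lebesgue_measure R).
Variables (l c : R).
Hypothesis l0 : 0 < l.

Let phi : measurableTypeR R -> measurableTypeR R := fun x => l * x + c.

Let mphi : measurable_fun setT phi.
Proof. by apply: measurable_funD => //; apply: measurable_funM. Qed.

(** By uniqueness of Lebesgue measure it suffices to compare the two sides on half-open
    intervals. *)
Lemma lebesgue_measure_affine (A : set (measurableTypeR R)) : measurable A ->
  leb A = (l%:E * pushforward leb phi A)%E.
Proof.
move=> mA; have l0' : 0 <= l by exact: ltW.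
rewrite (@lebesgue_measure_unique R (mscale (NngNum l0') (pushforward leb phi)) _ A mA)//.
move=> _ [[a b]] _ <-.
transitivity (l%:E * leb (phi @^-1` [set` `]a, b]]))%E => //.
rewrite (_ : _ @^-1` _ = [set` `](a - c) / l, (b - c) / l]]); last first.
  apply/seteqP; split=> x /=; rewrite !in_itv/= ltr_pdivrMr// ler_pdivlMr//;
    by rewrite ltrBlDr lerBrDr [x * l]mulrC.
rewrite !lebesgue_measure_itv/= !lte_fin ltr_pM2r ?invr_gt0// ltrD2r.
case: ifPn => _; last by rewrite mule0.
by rewrite -!EFinB -EFinM; congr EFin; field; rewrite gt_eqF.
Qed.

Lemma ge0_integral_affine (f : R -> \bar R) : measurable_fun setT f ->
  (forall x, 0 <= f x)%E ->
  (\int[leb]_x f x = l%:E * \int[leb]_x f (l * x + c)%R)%E.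
Proof.
move=> mf f0; have l0' : 0 <= l by exact: ltW.
rewrite (@eq_measure_integral _ _ _ _ (mscale (NngNum l0') (pushforward leb phi))); last first.
  by move=> A mA _; rewrite /mscale/= lebesgue_measure_affine.
by rewrite ge0_integral_mscale// ge0_integral_pushforward.
Qed.

Lemma rintegrable_affine (f : R -> R) : rintegrable leb f ->
  rintegrable leb (fun x => f (l * x + c)) /\
  \int[leb]_x f (l * x + c) = l^-1 * \int[leb]_x f x.
Proof.
move=> fi; have /integrableP[mf fy] := fi.
have i1 : rintegrable leb (fun x => f (l * x + c)).
  apply/integrableP; split.
    exact: (measurableT_comp mf mphi).
  move: fy; rewrite (ge0_integral_affine (f := fun x => `|(f x)%:E|%E))//; last exact: measurableT_comp.
  by case: (integral _ _ _) => [r| |] //; rewrite ?ltry// gt0_muley ?lte_fin.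
split => //.
have E : (\int[leb]_x (f x)%:E = l%:E * \int[leb]_x (f (l * x + c))%:E)%E.
  rewrite integralE [in RHS]integralE muleBr//; last first.
    apply: fin_num_adde_defl; rewrite fin_numN; apply: integrable_fin_num => //.
    exact: (integrable_funeneg measurableT i1).
  rewrite (ge0_integral_affine (f := funepos (EFin \o f)))//; last exact: measurable_funepos.
  rewrite (ge0_integral_affine (f := funeneg (EFin \o f)))//; last exact: measurable_funeneg.
  by congr (_ * _ - _ * _)%E; apply: eq_integral => x _; rewrite ?funeposE ?funenegE.
rewrite /Rintegral E fineM//; last exact: (integrable_fin_num measurableT i1).
by rewrite /= mulKf// gt_eqF.
Qed.

Lemma cint_affine (f : R -> R[i]) : cintegrable leb f ->
  cintegrable leb (fun x => f (l * x + c)) /\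
  cint leb (fun x => f (l * x + c)) = (l^-1)%:C%C * cint leb f.
Proof.
move=> [fR fI]; have [iR eR] := rintegrable_affine fR.
have [iI eI] := rintegrable_affine fI; split => //.
by rewrite /cint eR eI; simpc.
Qed.

End affine_substitution.

(** * The Fourier transform of the bump *)

Section bump_integral.
Context {R : realType}.
Notation leb := (@lebesgue_measure R).
Notation bump := (@smooth_bump R).

Lemma rintegrable_bump : rintegrable leb bump.
Proof.
have mb : measurable_fun setT bump by exact: (continuous_measurable_fun (@continuous_bump R)).
apply/integrableP; split; first exact/measurable_EFinP.
apply: (@le_lt_trans _ _ (\int[leb]_(x in `[0%R, 1%R]) 1)%E); last first.
  by rewrite integral_cst//= mul1e lebesgue_measure_itv/= lte_fin ltr01 oppr0 adde0 ltry.
rewrite [leRHS]integral_mkcond; apply: ge0_le_integral => //.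
- by apply: measurableT_comp => //; exact/measurable_EFinP.
- by apply/(measurable_restrictT _ _).1 => //; exact: measurable_cst.
move=> x _ /=; rewrite patchE ger0_norm ?bump_ge0//; case: ifPn => [_|].
  by rewrite lee_fin bump_le1.
rewrite notin_setE/= => x01; rewrite bump_eq0//; apply/negP => H; apply: x01.
by rewrite in_itv/=; move: H; rewrite in_itv/= => /andP[/ltW -> /ltW ->].
Qed.

Lemma Rintegral_bump_itv (h : R -> R) :
  \int[leb]_t (bump t * h t) = \int[leb]_(t in `[0, 1]) (bump t * h t).
Proof.
rewrite [RHS]Rintegral_mkcond; apply: eq_Rintegral => t _; rewrite patchE.
case: ifPn => //; rewrite notin_setE/= => t01; rewrite bump_eq0 ?mul0r//.
apply/negP => H; apply: t01; rewrite in_itv/=.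
by move: H; rewrite in_itv/= => /andP[/ltW -> /ltW ->].
Qed.

Lemma Rintegral_ge_itv (f : R -> R) (a b d : R) : a <= b -> 0 <= d ->
  rintegrable leb f -> (forall x, 0 <= f x) ->
  (forall x, a <= x <= b -> d <= f x) -> d * (b - a) <= \int[leb]_x f x.
Proof.
move=> ab d0 fi f0 fd; have /integrableP[mf _] := fi.
rewrite -lee_fin /Rintegral fineK; last exact: (integrable_fin_num measurableT fi).
apply: (@le_trans _ _ (\int[leb]_(x in `[a, b]) (f x)%:E)%E); last first.
  by apply: ge0_subset_integral => // x _; rewrite lee_fin.
have -> : (d * (b - a))%:E = (\int[leb]_(x in `[a, b]) d%:E)%E.
  rewrite integral_cst//= lebesgue_measure_itv/= lte_fin.
  case: ltP => [_|ba]; first by rewrite -EFinB -EFinM.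
  have -> : a = b by apply/eqP; rewrite eq_le ab ba.
  by rewrite subrr mulr0 mule0.
apply: ge0_le_integral => //; by apply: measurable_funTS.
Qed.

Lemma Rintegration_by_parts01 (F G f g : R -> R) :
  (forall t : R, is_derive t 1 F (f t)) -> (forall t : R, is_derive t 1 G (g t)) ->
  continuous f -> continuous g ->
  \int[leb]_(x in `[0, 1]) (F x * g x) =
    F 1 * G 1 - F 0 * G 0 - \int[leb]_(x in `[0, 1]) (f x * G x).
Proof.
move=> dF dG cf cg.
have c H h : (forall t : R, is_derive t 1 H (h t)) -> continuous (H : R -> R).
  move=> dH t; apply: differentiable_continuous; apply/derivable1_diffP.
  by have [] := dH t.
have lr H h : (forall t : R, is_derive t 1 H (h t)) -> derivable_oo_LRcontinuous (H : R -> R) 0 1.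
  move=> dH; have cH := c _ _ dH; split.
  - by move=> t _; have [] := dH t.
  - exact: (cvg_at_right_filter (cH 0)).
  - exact: (cvg_at_left_filter (cH 1)).
apply: Rintegration_by_parts => //.
- exact: continuous_subspaceT.
- exact: lr.
- by move=> t _; rewrite derive1E; exact: derive_val.
- exact: continuous_subspaceT.
- exact: lr.
- by move=> t _; rewrite derive1E; exact: derive_val.
Qed.

(** [b1] vanishes at both endpoints because the nonnegative bump attains its minimum 0 there. Two
    integrations by parts over [[0, 1]] therefore have no boundary terms. *)
Lemma bump_derivatives : exists b1 b2 : R -> R, exists M : R,
  [/\ forall t : R, is_derive t 1 bump (b1 t),
      forall t : R, is_derive t 1 b1 (b2 t),
      continuous b1, continuous b2 &
      [/\ b1 0 = 0, b1 1 = 0 & forall t, `|b2 t| <= M]].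
Proof.
have [_ _ /(_ tt) [b1 [d1 [_ c1 /(_ tt) [b2 [d2 [[M hM] c2 _]]]]]]] := tame_bump (R := R) 2.
have min0 c : bump c = 0 -> is_derive c 1 bump 0.
  move=> bc; apply: (@derive1_at_min R bump (c - 1) (c + 1) c).
  - lra.
  - by move=> t _; have [] := d1 tt t.
  - by rewrite in_itv/=; apply/andP; split; lra.
  - by move=> t _; rewrite bc bump_ge0.
have z c : bump c = 0 -> b1 tt c = 0.
  by move=> /min0 H; have [_ <-] := d1 tt c; exact: derive_val.
exists (b1 tt), (b2 tt), M; split; [exact: (d1 tt)|exact: (d2 tt)|..].
- exact: (c1 tt).
- exact: (c2 tt).
split.
- by apply: z; rewrite bump_eq0// in_itv/= ltxx.
- by apply: z; rewrite bump_eq0// in_itv/= ltxx andbF.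
- by move=> t; have := hM tt t; rewrite !mul1r.
Qed.

End bump_integral.

Section bump_hat.
Context {R : realType}.
Notation leb := (@lebesgue_measure R).
Notation bump := (@smooth_bump R).

Definition bump_hat (tau : R) : R[i] :=
  cint leb (fun t => cexp_i (- (t * tau)) * (bump t)%:C%C).

Lemma measurable_bump : measurable_fun setT bump.
Proof. exact: (continuous_measurable_fun (@continuous_bump R)). Qed.

Lemma cintegrable_bump : cintegrable leb (fun t => (bump t)%:C%C).
Proof.
apply: (cintegrable_le _ rintegrable_bump).
  exact: cmeasurable_real measurable_bump.
by move=> t; rewrite normc_real ger0_norm ?bump_ge0.
Qed.

Lemma cintegrable_bump_hat_kernel tau :
  cintegrable leb (fun t => cexp_i (- (t * tau)) * (bump t)%:C%C).
Proof.
apply: (@cintegrableM_bounded _ _ _ _ _ _ 1) => //; first exact: cintegrable_bump.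
  by apply: cmeasurable_cexp_i; apply: measurable_funN; exact: measurable_funM.
by move=> t; rewrite normc_cexp_i.
Qed.

Lemma Re_bump_hat tau : complex.Re (bump_hat tau) = \int[leb]_t (bump t * cos (tau * t)).
Proof.
by apply: eq_Rintegral => t _ /=; rewrite mulr0 subr0 cosN mulrC [t * _]mulrC.
Qed.

Lemma Im_bump_hat tau : complex.Im (bump_hat tau) = - \int[leb]_t (bump t * sin (tau * t)).
Proof.
rewrite -mulN1r -RintegralZl//.
  by apply: eq_Rintegral => t _ /=; rewrite mulr0 add0r sinN mulNr mulN1r mulrC [t * _]mulrC.
apply: (rintegrable_le _ rintegrable_bump).
  apply: measurable_funM; first exact: measurable_bump.
  apply: (measurableT_comp (continuous_measurable_fun (@continuous_sin R))).
  exact: measurable_funM.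
move=> t; rewrite normrM ger0_norm ?bump_ge0// ler_piMr ?bump_ge0//.
exact: sin_max.
Qed.

Lemma cmeasurable_bump_hat : cmeasurable bump_hat.
Proof.
have [KR KI] : cmeasurable (fun z : measurableTypeR R * measurableTypeR R =>
    cexp_i (- (z.2 * z.1)) * (bump z.2)%:C%C).
  apply: cmeasurableM.
    by apply: cmeasurable_cexp_i; apply: measurable_funN; apply: measurable_funM.
  apply: cmeasurable_real; exact: (measurableT_comp measurable_bump measurable_snd).
split.
  exact: (measurable_Rintegral_inner leb KR).
exact: (measurable_Rintegral_inner leb KI).
Qed.

Lemma bump_hatN tau : bump_hat (- tau) = ((bump_hat tau)^*)%C.
Proof.
apply/eqP; rewrite eq_complex Re_bump_hat Im_bump_hat; case E : (bump_hat tau) => [a b] /=.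
have <- : complex.Re (bump_hat tau) = a by rewrite E.
have <- : complex.Im (bump_hat tau) = b by rewrite E.
rewrite Re_bump_hat Im_bump_hat opprK; apply/andP; split; apply/eqP.
  by apply: eq_Rintegral => t _; rewrite mulNr cosN.
rewrite -[LHS]mulN1r -RintegralZl//.
  by apply: eq_Rintegral => t _; rewrite [- tau * t]mulNr sinN; ring.
apply: (rintegrable_le _ rintegrable_bump).
  apply: measurable_funM; first exact: measurable_bump.
  apply: (measurableT_comp (continuous_measurable_fun (@continuous_sin R))).
  exact: measurable_funM.
move=> t; rewrite normrM ger0_norm ?bump_ge0// ler_piMr ?bump_ge0//.
exact: sin_max.
Qed.

Lemma mulr_conjc (z : R[i]) : z * (z^*)%C = (normc z ^+ 2)%:C%C.
Proof. by rewrite normc_sqr; case: z => a b; simpc; rewrite !expr2 [b * a]mulrC addNr. Qed.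

Lemma rs_sumN b m (t : R) : rs_sum b m 0 (- t) = ((rs_sum b m 0 t)^*)%C.
Proof.
rewrite /rs_sum rmorph_sum; apply: eq_bigr => j _.
rewrite [RHS]rmorphM mulrN; congr (_ * _).
  by rewrite /= oppr0.
by rewrite /cexp_i cosN sinN.
Qed.

Lemma rintegrable_bumpM (h : R -> R) : continuous h -> (forall t, `|h t| <= 1) ->
  rintegrable leb (fun t => bump t * h t).
Proof.
move=> ch h1; apply: (rintegrable_le _ rintegrable_bump).
  by apply: measurable_funM; [exact: measurable_bump|exact: continuous_measurable_fun].
by move=> t; rewrite normrM ger0_norm ?bump_ge0// ler_piMr ?bump_ge0.
Qed.

(** The trivial bound [N] handles the 1 in [1 + tau ^+ 2]; two integrations by parts bound
    [tau ^+ 2] times the real and the imaginary part by [M] each. Quadratic decay makes the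
    transform integrable. *)
Lemma bump_hat_decay : exists C : R, 0 <= C /\
  forall tau, normc (bump_hat tau) <= C * (1 + tau ^+ 2)^-1.
Proof.
have [b1 [b2 [M [d1 d2 c1 c2 [z0 z1 hM]]]]] := @bump_derivatives R.
have M0 : 0 <= M by apply: le_trans (hM 0).
have B0 : bump 0 = 0 by rewrite bump_eq0// in_itv/= ltxx.
have B1 : bump 1 = 0 by rewrite bump_eq0// in_itv/= ltxx andbF.
(* Both derivatives are moved from [h2] onto the bump. For [h] a cosine or sine of [tau * t], [h2]
   is [- tau ^+ 2] times [h]. *)
have parts (h h1 h2 : R -> R) : (forall t : R, is_derive t 1 h (h1 t)) ->
    (forall t : R, is_derive t 1 h1 (h2 t)) -> continuous h1 -> continuous h2 ->
    (forall t, `|h t| <= 1) ->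
    `| \int[leb]_t (bump t * h2 t)| <= M.
  move=> dh dh1 ch1 ch2 h1le; rewrite Rintegral_bump_itv.
  rewrite (Rintegration_by_parts01 d1 dh1 c1 ch2) B0 B1 !mul0r subrr add0r normrN.
  rewrite (Rintegration_by_parts01 d2 dh c2 ch1) z0 z1 !mul0r subrr add0r normrN.
  have ch : continuous h.
    move=> t; apply: differentiable_continuous; apply/derivable1_diffP.
    by have [] := dh t.
  have ib : leb.-integrable `[0, 1] (fun t => (b2 t * h t)%:E).
    apply: continuous_compact_integrable; first exact: segment_compact.
    by apply: continuous_subspaceT => t; apply: continuousM; [exact: c2|exact: ch].
  apply: le_trans (le_normr_Rintegral _ ib) _ => //.
  apply: (@le_trans _ _ (\int[leb]_(t in `[0, 1]) M)).
    apply: le_Rintegral => //.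
    - exact: integrable_abse ib.
    - apply: continuous_compact_integrable; first exact: segment_compact.
      by apply: continuous_subspaceT => t; exact: cst_continuous.
    by move=> t _; rewrite normrM -[leRHS]mulr1 ler_pM.
  rewrite Rintegral_cst//= lebesgue_measure_itv/= lte_fin ltr01 oppr0 adde0 /=.
  by rewrite mulr1.
have dlin (tau t : R) : is_derive t 1 (fun t => tau * t) tau.
  by rewrite -[X in is_derive _ _ _ X]mulr1; apply: is_derive_mulrf.
have dsin (tau t : R) : is_derive t 1 (fun t => sin (tau * t)) (tau * cos (tau * t)).
  by rewrite mulrC; apply: (@is_derive1_comp _ sin (fun t => tau * t)).
have dcos (tau t : R) : is_derive t 1 (fun t => cos (tau * t)) (- tau * sin (tau * t)).
  by rewrite mulNr mulrC -mulNr; apply: (@is_derive1_comp _ cos (fun t => tau * t)).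
have cont (f f' : R -> R) : (forall t : R, is_derive t 1 f (f' t)) -> continuous f.
  move=> df t; apply: differentiable_continuous; apply/derivable1_diffP.
  by have [] := df t.
have contM (f : R -> R) (a : R) : continuous f -> continuous (fun t => a * f t).
  by move=> cf t; apply: continuousM; [exact: cst_continuous|exact: cf].
have hC tau : tau ^+ 2 * `|complex.Re (bump_hat tau)| <= M.
  have := parts _ _ _ (dcos tau) (fun t => is_derive_mulrf (- tau) (dsin tau t))
   (contM _ _ (cont _ _ (dsin tau))) (contM _ _ (contM _ _ (cont _ _ (dcos tau))))
   (fun t => cos_max _).
  rewrite Re_bump_hat (_ : \int[leb]_t (bump t * (- tau * (tau * cos (tau * t)))) =
      - tau ^+ 2 * \int[leb]_t (bump t * cos (tau * t))).
    by rewrite normrM normrN [`|tau ^+ 2|]ger0_norm ?sqr_ge0.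
  rewrite -RintegralZl//; last exact: (rintegrable_bumpM (cont _ _ (dcos tau)) (fun t => cos_max _)).
  by apply: eq_Rintegral => t _; ring.
have hS tau : tau ^+ 2 * `|complex.Im (bump_hat tau)| <= M.
  have := parts _ _ _ (dsin tau) (fun t => is_derive_mulrf tau (dcos tau t))
   (contM _ _ (cont _ _ (dcos tau))) (contM _ _ (contM _ _ (cont _ _ (dsin tau))))
   (fun t => sin_max _).
  rewrite Im_bump_hat normrN (_ : \int[leb]_t (bump t * (tau * (- tau * sin (tau * t)))) =
      - tau ^+ 2 * \int[leb]_t (bump t * sin (tau * t))).
    by rewrite normrM normrN [`|tau ^+ 2|]ger0_norm ?sqr_ge0.
  rewrite -RintegralZl//; last exact: (rintegrable_bumpM (cont _ _ (dsin tau)) (fun t => sin_max _)).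
  by apply: eq_Rintegral => t _; ring.
pose N := 2 * \int[leb]_t normc ((bump t)%:C%C : R[i]).
have N0 : 0 <= N by rewrite mulr_ge0// Rintegral_ge0// => t _; exact: normc_ge0.
have hN tau : normc (bump_hat tau) <= N.
  apply: le_trans (normc_cint_le (cintegrable_bump_hat_kernel tau)) _.
  rewrite ler_wpM2l// le_eqVlt; apply/orP; left; apply/eqP.
  by apply: eq_Rintegral => t _; rewrite normcM normc_cexp_i mul1r.
exists (N + (M + M)); split; first by rewrite !addr_ge0.
move=> tau; rewrite ler_pdivlMr; last by rewrite ltr_pwDl// sqr_ge0.
rewrite mulrDr mulr1; apply: lerD => //.
rewrite mulrC; apply: le_trans (ler_wpM2l (sqr_ge0 _) (normc_le_Re_Im _)) _.
by rewrite mulrDr; apply: lerD.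
Qed.

Lemma rintegrable_oneDsqrV : rintegrable leb (fun x => (1 + x ^+ 2)^-1).
Proof.
have c : continuous (fun x : R => (1 + x ^+ 2)^-1) := @continuous_oneDsqrV R.
have ge0 (x : R) : 0 <= (1 + x ^+ 2)^-1 by rewrite invr_ge0 addr_ge0// sqr_ge0.
apply/integrableP; split.
  by apply/measurable_EFinP; exact: continuous_measurable_fun.
under eq_integral do rewrite /= ger0_norm//.
rewrite ge0_symfun_integralT//; last by move=> x; rewrite /= sqrrN.
rewrite lte_mul_pinfty//.
have := @integral0y_oneDsqr R; rewrite set_itvcy => ->.
by rewrite ltry.
Qed.

Lemma cintegrable_bump_hat : cintegrable leb bump_hat.
Proof.
have [C [C0 hC]] := bump_hat_decay.
apply: (cintegrable_le _ (rintegrableZ C rintegrable_oneDsqrV)) => //; exact: cmeasurable_bump_hat.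
Qed.

(** On this interval 1/t and 1/(1-t) are both at most 4, which gives the exponent 8. *)
Lemma bump_ge_mid (t : R) : 4^-1 <= t <= 3 / 4 -> expR (- 8) <= bump t.
Proof.
move=> /andP[t1 t3].
have t0 : 0 < t by apply: lt_le_trans t1.
have t0' : 0 < 1 - t by lra.
rewrite /smooth_bump /flat t0 t0' !expr0 !mul1r -expRD ler_expR.
have h (x : R) : 4^-1 <= x -> x^-1 <= 4.
  by move=> hx; rewrite -[4]invrK lef_pV2// posrE// (lt_le_trans _ hx).
have := h _ t1; have := h (1 - t) ltac:(lra); lra.
Qed.

Lemma integral_bump_gt0 : 0 < \int[leb]_t bump t.
Proof.
have := @Rintegral_ge_itv R bump 4^-1 (3 / 4) (expR (- 8)) ltac:(lra) (expR_ge0 _)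
  rintegrable_bump (@bump_ge0 R) bump_ge_mid.
apply: lt_le_trans; rewrite mulr_gt0 ?expR_gt0//; lra.
Qed.

(** For [tau] in [[0, 1]] the argument [tau * t] stays in [[0, 1]] on the support of the bump, so
    the cosine is at least [cos 1] and nothing cancels in the real part. *)
Lemma bump_hat_lower tau : 0 <= tau <= 1 ->
  cos 1 * \int[leb]_t bump t <= normc (bump_hat tau).
Proof.
move=> /andP[tau0 tau1]; apply: le_trans (le_trans (ler_norm _) (Re_le_normc _)).
rewrite Re_bump_hat -RintegralZl//; last exact: rintegrable_bump.
apply: le_Rintegral => //.
- exact: rintegrableZ rintegrable_bump.
- apply: rintegrable_bumpM => [t|t]; last exact: cos_max.
  apply: continuous_comp; last exact: continuous_cos.
  by apply: continuousM; [exact: cst_continuous|exact: cvg_id].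
move=> t _; rewrite mulrC.
have [t01|t01] := boolP (t \in `]0, 1[); last by rewrite bump_eq0// !mul0r.
rewrite ler_wpM2l ?bump_ge0//.
move: t01; rewrite in_itv/= => /andP[t0 t1].
have t0' := ltW t0.
have tt1 : tau * t <= 1 by rewrite mulr_ile1// ltW.
have pi1 : 1 <= pi :> R by apply: le_trans (pi_ge2 R); rewrite ler1n.
rewrite leNgt ltr_cos ?in_itv/= ?ler01 ?pi1 ?mulr_ge0//; last exact: le_trans pi1.
by rewrite -leNgt.
Qed.

End bump_hat.

(** * Rudin-Shapiro sums of bumps *)

Section rs_bumps.
Context {R : realType}.
Notation leb := (@lebesgue_measure R).
Notation bump := (@smooth_bump R).
Notation bump_hat := (@bump_hat R).

(* [s] is [1] or [-1]: the reflected sums are needed because the pairing involves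
   one Fourier transform and one inverse Fourier transform. *)
Definition rs_bumps (s l : R) (bm : bool * nat) (t : R) : R :=
  \sum_(k < 2 ^ bm.2) rs bm.1 bm.2 k * bump (l * t - s * k%:R).

Definition ft (f : R -> R) (eta : R) : R[i] :=
  cint leb (fun t => cexp_i (- (t * eta)) * (f t)%:C%C).

Lemma ft_shifted_bump (l c : R) eta : 0 < l ->
  cintegrable leb (fun t => cexp_i (- (t * eta)) * (bump (l * t - c))%:C%C) /\
  cint leb (fun t => cexp_i (- (t * eta)) * (bump (l * t - c))%:C%C) =
  (l^-1)%:C%C * (cexp_i (- (c * (eta / l))) * bump_hat (eta / l)).
Proof.
move=> l0; have i1 := cintegrable_bump_hat_kernel (eta / l).
have i2 := cintegrableZ (cexp_i (- (c * (eta / l)))) i1.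
have [i3 e3] := cint_affine (- c) l0 i2.
have E : (fun t => cexp_i (- (t * eta)) * (bump (l * t - c))%:C%C) =
    (fun x => cexp_i (- (c * (eta / l))) * (cexp_i (- ((l * x + - c) * (eta / l))) *
       (bump (l * x + - c))%:C%C)).
  apply/funext => t; rewrite mulrA -cexp_iD; congr (cexp_i _ * _).
  by field; rewrite gt_eqF.
by rewrite E; split => //; rewrite e3 cintZ.
Qed.

(** Translation by [k] becomes an exponential of frequency [k], so the signs of the translates
    reassemble into a Rudin-Shapiro polynomial in the dual variable. *)
Lemma ft_rs_bumps s l bm eta : 0 < l ->
  cintegrable leb (fun t => cexp_i (- (t * eta)) * (rs_bumps s l bm t)%:C%C) /\
  ft (rs_bumps s l bm) eta =
  (l^-1)%:C%C * (bump_hat (eta / l) * rs_sum bm.1 bm.2 0 (- (s * (eta / l)))).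
Proof.
move=> l0; rewrite /ft.
have E : (fun t => cexp_i (- (t * eta)) * (rs_bumps s l bm t)%:C%C) =
    (fun t => \sum_(k < 2 ^ bm.2) (rs bm.1 bm.2 k)%:C%C *
      (cexp_i (- (t * eta)) * (bump (l * t - s * k%:R))%:C%C)).
  apply/funext => t; rewrite /rs_bumps rmorph_sum/= mulr_sumr; apply: eq_bigr => k _.
  by rewrite rmorphM/=; ring.
have ik (k : 'I_(2 ^ bm.2)) := ft_shifted_bump (s * k%:R) eta l0.
have ik1 (k : 'I_(2 ^ bm.2)) : cintegrable leb (fun t => (rs bm.1 bm.2 k)%:C%C *
      (cexp_i (- (t * eta)) * (bump (l * t - s * k%:R))%:C%C)).
  by apply: cintegrableZ; exact: (ik k).1.
rewrite E; split; first exact: cintegrable_sum.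
rewrite cint_sum// /rs_sum !mulr_sumr; apply: eq_bigr => k _.
rewrite cintZ; last exact: (ik k).1.
rewrite (ik k).2 expr0 mulr1.
have -> : s * k%:R * (eta / l) = k%:R * (s * (eta / l)) by ring.
by rewrite mulrN; ring.
Qed.

Lemma rs_bumps_neq0 s l bm t : 0 < l -> `|s| = 1 -> rs_bumps s l bm t != 0 ->
  `|t| <= 2 ^+ bm.2 / l.
Proof.
move=> l0 s1 H.
have [k hk] : exists k : 'I_(2 ^ bm.2), l * t - s * k%:R \in `]0, 1[.
  apply: contra_notP (elimN eqP H) => nk.
  rewrite /rs_bumps big1// => k _; rewrite bump_eq0 ?mulr0//.
  by apply/negP => hk; apply: nk; exists k.
rewrite ler_pdivlMr// mulrC -[X in X * _]gtr0_norm// -normrM.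
have kN : (k%:R : R) + 1 <= 2 ^+ bm.2 by rewrite natr1 -natrX ler_nat.
have k0 : 0 <= (k%:R : R) by [].
move: hk; rewrite in_itv/= => /andP[h0 h1].
move: s1; case: (ger0P s) => _ s1; [rewrite s1 in h0 h1|have s1' : s = -1 by lra].
  by rewrite ler_norml; apply/andP; split; lra.
by rewrite s1' in h0 h1; rewrite ler_norml; apply/andP; split; lra.
Qed.

(** At each point at most one translate is nonzero, since two translates with distinct [k] are at
    least one unit apart. *)
Lemma rs_bumps_le1 s l bm t : `|s| = 1 -> `|rs_bumps s l bm t| <= 1.
Proof.
move=> s1.
have [[k hk]|nk] := pselect (exists k : 'I_(2 ^ bm.2), l * t - s * k%:R \in `]0, 1[).
  rewrite /rs_bumps (bigD1 k)//= big1 ?addr0.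
    by rewrite normrM normr_rs mul1r ger0_norm ?bump_ge0// bump_le1.
  move=> j jk; rewrite bump_eq0 ?mulr0//; apply/negP => hj.
  move/negP : jk; apply; rewrite -val_eqE/=.
  have : `|s * k%:R - s * j%:R| < 1.
    move: hj hk; rewrite !in_itv/= => /andP[j0 j1] /andP[k0 k1].
    by rewrite ltr_norml; apply/andP; split; lra.
  rewrite -mulrBr normrM s1 mul1r ltr_norml => /andP[h1 h2].
  apply/eqP/anti_leq/andP; split; rewrite -ltnS -(ltr_nat R) -natr1; lra.
rewrite /rs_bumps big1 ?normr0// => k _; rewrite bump_eq0 ?mulr0//.
by apply/negP => hk; apply: nk; exists k.
Qed.

(** Supported in [[0, l]]. The polynomial in [t / l] has frequencies up to [2 ^ m / l], and division
    by the root of [2 ^ m] bounds the factor by [Num.sqrt 2] for every [m]. *)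
Definition symbol_factor (l : R) (bm : bool * nat) (t : R) : R[i] :=
  ((bump (t / l) * (Num.sqrt (2 ^+ bm.2))^-1)%:C)%C * rs_sum bm.1 bm.2 0 (t / l).

(* The value, up to scaling, of the one-dimensional pairing of the multiplier with
   the two test functions. *)
Definition bump_energy (bm : bool * nat) : R :=
  \int[leb]_t (bump t * normc (bump_hat t) ^+ 2 * normc (rs_sum bm.1 bm.2 0 t) ^+ 2).

Lemma measurable_rs_sum b m k : cmeasurable (@rs_sum R b m k).
Proof.
split; apply: continuous_measurable_fun => t; apply: differentiable_continuous;
  apply/derivable1_diffP.
  by have [] := is_derive_Re_rs_sum b m k t.
by have [] := is_derive_Im_rs_sum b m k t.
Qed.

Lemma normc_rs_sum_le b m (t : R) : normc (rs_sum b m 0 t) <= Num.sqrt 2 * Num.sqrt (2 ^+ m).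
Proof.
have := rs_sum_bound m 0 t; rewrite expr0 mulr1; apply: le_trans.
by case: b; [exact: normc_le_nrm2l|exact: normc_le_nrm2r].
Qed.

Let energy_ge0 (t x y : R) : 0 <= bump t * x ^+ 2 * y ^+ 2.
Proof. by rewrite mulr_ge0 ?sqr_ge0// mulr_ge0 ?sqr_ge0// bump_ge0. Qed.

Lemma rintegrable_bump_energy bm :
  rintegrable leb (fun t => bump t * normc (bump_hat t) ^+ 2 *
    normc (rs_sum bm.1 bm.2 0 t) ^+ 2).
Proof.
have [C [C0 hC]] := @bump_hat_decay R.
pose M : R := Num.sqrt 2 * Num.sqrt (2 ^+ bm.2).
apply: (rintegrable_le _ (rintegrableZ (C ^+ 2 * M ^+ 2) (@rintegrable_bump R))).
  apply: measurable_funM; first apply: measurable_funM.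
  - exact: measurable_bump.
  - by apply: measurable_funX; apply: measurable_normc; exact: cmeasurable_bump_hat.
  - by apply: measurable_funX; apply: measurable_normc; exact: measurable_rs_sum.
move=> t; rewrite ger0_norm//.
rewrite [leRHS]mulrC [leRHS]mulrA; apply: ler_pM; [exact: mulr_ge0 (bump_ge0 _) (sqr_ge0 _)|exact: sqr_ge0|..].
  rewrite ler_wpM2l ?bump_ge0// ler_pXn2r ?nnegrE ?normc_ge0//.
  apply: le_trans (hC t) _; rewrite ler_piMr// invf_le1 ?lerDl ?sqr_ge0//.
  by rewrite ltr_pwDl// sqr_ge0.
by rewrite ler_pXn2r ?nnegrE ?normc_ge0 ?mulr_ge0 ?sqrtr_ge0// normc_rs_sum_le.
Qed.

(** For the sum of both words [rs_sum_energy] makes the last factor the constant [2 * 2 ^+ m]; the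
    other factors are bounded below on [[1/4, 3/4]], whose length 1/2 cancels the 2. One of the
    words has at least half of the sum, whence the [2^-1] in [kappa]. Which word this is may depend
    on [m]. *)
Lemma bump_energy_lower : exists kappa : R, 0 < kappa /\
  forall m, exists b, kappa * 2 ^+ m <= bump_energy (b, m).
Proof.
exists (expR (-8) * (cos 1 * \int[leb]_t bump t) ^+ 2 * 2^-1); split.
  by rewrite !mulr_gt0 ?expR_gt0 ?exprn_gt0 ?mulr_gt0 ?cos1_gt0 ?integral_bump_gt0.
move=> m; set d := _ * _ ^+ 2.
have d0 : 0 <= d.
  by rewrite mulr_ge0 ?expR_ge0 ?sqr_ge0.
have S : d * 2^-1 * 2 * 2 ^+ m <= bump_energy (true, m) + bump_energy (false, m).
  rewrite -RintegralD//=; [|exact: (rintegrable_bump_energy (_, _))..].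
  have -> : d * 2^-1 * 2 * 2 ^+ m = (d * (2 * 2 ^+ m)) * (3 / 4 - 4^-1).
    by field.
  apply: Rintegral_ge_itv => //.
  - lra.
  - by apply: mulr_ge0 => //; apply: mulr_ge0 => //; exact: exprn_ge0.
  - exact: (rintegrableD (rintegrable_bump_energy (true, m)) (rintegrable_bump_energy (false, m))).
  - by move=> t; rewrite addr_ge0.
  move=> t ht; rewrite -mulrDr rs_sum_energy ler_wpM2r ?mulr_ge0 ?exprn_ge0//.
  rewrite ler_pM ?expR_ge0 ?sqr_ge0 ?bump_ge_mid//.
  rewrite ler_pXn2r ?nnegrE ?normc_ge0// ?mulr_ge0 ?(ltW (cos1_gt0 R)) ?(ltW integral_bump_gt0)//.
  by apply: bump_hat_lower; apply/andP; move/andP: ht => [? ?]; split; lra.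
have [h|h] := leP (d * 2^-1 * 2 ^+ m) (bump_energy (true, m)); first by exists true.
by exists false; move: h S; lra.
Qed.

(** Bump and signs are real, so reversing the argument conjugates both [bump_hat] and [rs_sum]. The
    integrand becomes the nonnegative energy density and no cancellation is possible. *)
Lemma cint_symbol_factor l bm (g : R -> R[i]) : 0 < l ->
  (forall eta, g eta = (l^-1)%:C%C * (l^-1)%:C%C *
    (bump_hat (eta / l) * bump_hat (- (eta / l)) * rs_sum bm.1 bm.2 0 (- (eta / l)))) ->
  cintegrable leb (fun eta => symbol_factor l bm eta * g eta) /\
  cint leb (fun eta => symbol_factor l bm eta * g eta) =
    (l^-1 * (Num.sqrt (2 ^+ bm.2))^-1 * bump_energy bm)%:C%C.
Proof.
move=> l0 hg; have l0' : 0 < l^-1 by rewrite invr_gt0.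
pose f (t : R) : R[i] := (bump t)%:C%C * (bump_hat t * ((bump_hat t)^*)%C) *
  (rs_sum bm.1 bm.2 0 t * ((rs_sum bm.1 bm.2 0 t)^*)%C).
have fE : f = fun t => (bump t * normc (bump_hat t) ^+ 2 *
    normc (rs_sum bm.1 bm.2 0 t) ^+ 2)%:C%C.
  by apply/funext => t; rewrite /f !mulr_conjc -!rmorphM.
have fi : cintegrable leb f.
  rewrite fE.
  by split; [exact: rintegrable_bump_energy|exact: integrable0].
have [i e] := cint_affine 0 l0' fi.
have E : (fun eta => symbol_factor l bm eta * g eta) =
    (fun eta => (l^-1 * l^-1 * (Num.sqrt (2 ^+ bm.2))^-1)%:C%C * f (l^-1 * eta + 0)).
  apply/funext => eta; rewrite hg addr0 [l^-1 * eta]mulrC /symbol_factor /f.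
  by rewrite bump_hatN rs_sumN !rmorphM; ring.
rewrite E; split; first exact: cintegrableZ.
rewrite cintZ// e invrK.
have -> : cint leb f = (bump_energy bm)%:C%C.
  rewrite fE.
  by rewrite /cint /= Rintegral_cst// mul0r.
by rewrite -!rmorphM/=; congr (_%:C)%C; field; rewrite gt_eqF ?sqrtr_gt0 ?exprn_gt0// gt_eqF.
Qed.

End rs_bumps.

Lemma eq_tame {R : realType} {V : normedModType R} {J : Type} (e : J -> V)
    Th (r r' : Th -> J -> R) (w w' : Th -> R) k (F G : Th -> V -> R) :
  (forall th j, r th j = r' th j) -> (forall th, w th = w' th) ->
  (forall th x, F th x = G th x) -> tame e r w k F -> tame e r' w' k G.
Proof.
move=> rE wE FE.
have -> : r' = r by apply/funext => th; apply/funext => j.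
have -> : w' = w by apply/funext.
by have -> : G = F by apply/funext => th; apply/funext => x.
Qed.

(** * Tensor products *)

Section ctame.
Context {R : realType} {V : normedModType R} {J : Type} (e : J -> V) {Th : Type}.
Variable r : Th -> J -> R.

Definition ctame k (F : Th -> V -> R[i]) : Prop :=
  tame e r (fun=> 1) k (fun th x => complex.Re (F th x)) /\
  tame e r (fun=> 1) k (fun th x => complex.Im (F th x)).

Lemma tameM1 k (F G : Th -> V -> R) :
  tame e r (fun=> 1) k F -> tame e r (fun=> 1) k G ->
  tame e r (fun=> 1) k (fun th x => F th x * G th x).
Proof.
move=> tF tG; have := tameM tF tG.
by rewrite (_ : (fun _ => 1 * 1) = fun=> 1)//; apply/funext => ?; rewrite mulr1.
Qed.

Lemma ctameM k (F G : Th -> V -> R[i]) : ctame k F -> ctame k G ->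
  ctame k (fun th x => F th x * G th x).
Proof.
move=> [FR FI] [GR GI]; split.
  apply: (eq_tame (F := fun th x => complex.Re (F th x) * complex.Re (G th x) +
    -1 * (complex.Im (F th x) * complex.Im (G th x)))) => //.
    by move=> th x; rewrite RecM mulN1r.
  apply: tameD; first exact: tameM1.
  apply: tameM1; last exact: tameM1.
  by apply: (@tame_cst _ _ _ _ _ _ _ _ (fun=> -1) 1) => _; rewrite mul1r normrN normr1.
apply: (eq_tame (F := fun th x => complex.Re (F th x) * complex.Im (G th x) +
    complex.Im (F th x) * complex.Re (G th x))) => //.
  by move=> th x; rewrite ImcM.
by apply: tameD; exact: tameM1.
Qed.

Lemma ctame_real k (F : Th -> V -> R) : tame e r (fun=> 1) k F ->
  ctame k (fun th x => (F th x)%:C%C).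
Proof.
move=> tF; split => //=.
by apply: (@tame_cst _ _ _ _ _ _ _ _ (fun=> 0) 0) => _; rewrite mulr0 normr0.
Qed.

Lemma ctame_prod k I (s : seq I) (F : I -> Th -> V -> R[i]) :
  (forall i, ctame k (F i)) -> ctame k (fun th x => \prod_(i <- s) F i th x).
Proof.
move=> tF; elim: s => [|i s IH].
  have -> : (fun (th : Th) (x : V) => \prod_(i <- [::]) F i th x) =
      fun _ _ => (1 : R)%:C%C.
    by apply/funext => th; apply/funext => x; rewrite big_nil.
  apply: ctame_real.
  by apply: (@tame_cst _ _ _ _ _ _ _ _ (fun=> 1) 1) => _; rewrite mul1r normr1.
have -> : (fun th x => \prod_(i <- i :: s) F i th x) =
    fun th x => F i th x * \prod_(i <- s) F i th x.
  by apply/funext => th; apply/funext => x; rewrite big_cons.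
exact: ctameM.
Qed.

End ctame.

Section tame_symbol_factor.
Context {R : realType} {Th : Type}.
Variables (l psi : Th -> R) (bm : Th -> bool * nat) (K : R).
Hypothesis l0 : forall th, 0 < l th.
Hypothesis psi0 : forall th, 0 < psi th.
Hypothesis psiK : forall th, psi th <= K * (l th / 2 ^+ (bm th).2).

(** One derivative of the polynomial in [t / l] costs [2 ^ m / l], so the natural rate is
    [l / 2 ^ m]; [psiK] says that [psi] is at most a constant times this rate. *)
Lemma ctame_symbol_factor k :
  ctame e1 (fun th _ => psi th) k (fun th => symbol_factor (l th) (bm th)).
Proof.
pose N th : R := 2 ^+ (bm th).2.
have N0 th : 0 < N th by rewrite exprn_gt0.
have N1 th : 1 <= N th by rewrite exprn_ege1// ler1n.
(* In the variable [t / l] the polynomial has rate [1 / N]. The rate 1 of the bump is weakened to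
   the same value, which is allowed since [N >= 1]. *)
pose r0 (th : Th) (_ : unit) : R := (N th)^-1.
have tb : tame e1 r0 (fun=> 1) k (fun _ => @smooth_bump R).
  apply: (eq_tame (r := fun th j => r0 th j * 1) (w := fun=> 1 * 1)) => //.
  - by move=> th j; rewrite mulr1.
  - by move=> th; rewrite mulr1.
  apply: (@tame_scale R R unit e1 Th (fun _ _ => 1) (fun=> 1) k (fun=> @smooth_bump R)
    r0 (fun=> 1) 1 1).
  - by move=> th j; rewrite ger0_norm ?invr_ge0 ?(ltW (N0 _))// invf_le1.
  - by move=> _; rewrite normr1.
  - exact: (tame_reindex (fun _ : Th => tt) (tame_bump k)).
have tS (part : R[i] -> R) : tame e1 (fun (bm : bool * nat) (_ : unit) => (2 ^+ bm.2)^-1)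
     (fun bm : bool * nat => (Num.sqrt (2 ^+ bm.2))^-1 * (2 ^+ bm.2)^-1 ^+ 0) k
     (fun bm t => part (rs_sum bm.1 bm.2 0 t)) ->
   tame e1 (fun th _ => psi th) (fun=> 1) k
     (fun th t => (smooth_bump (t / l th) * (Num.sqrt (2 ^+ (bm th).2))^-1) *
        part (rs_sum (bm th).1 (bm th).2 0 (t / l th))).
  move=> /(tame_reindex bm) H.
  have {}H : tame e1 r0 (fun=> 1) k (fun th t => (Num.sqrt (2 ^+ (bm th).2))^-1 *
      part (rs_sum (bm th).1 (bm th).2 0 t)).
    apply: tame_mulr; apply: eq_tame H => // th.
    by rewrite /= expr0 mulr1 mul1r.
  have {}H := tameM1 tb H.
  have {}H := @tame_affine R Th r0 (fun th _ => l th / N th) (fun=> 1) k _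
    (fun th => (l th)^-1) (fun=> 0) _ H.
  have {}H := H ltac:(by move=> th; rewrite /r0; field; rewrite !gt_eqF).
  have {}H := @tame_scale R R unit e1 Th _ _ k _ (fun th _ => psi th * N th / l th)
    (fun=> 1) K 1 _ _ H.
  apply: eq_tame (H _ _).
  - by move=> th j /=; field; rewrite !gt_eqF.
  - by move=> th; rewrite mulr1.
  - by move=> th t; rewrite addr0 mulrA [_^-1 * t]mulrC.
  - move=> th j; rewrite ger0_norm; last by apply: divr_ge0; [apply: mulr_ge0; exact: ltW|exact: ltW].
    by have := psiK th; rewrite mulrA ler_pdivlMr// ler_pdivrMr.
  - by move=> _; rewrite normr1.
have [tR tI] := @tame_rs_sum R k 0.
split.
  have := tS _ tR; congr tame.
  by apply/funext => th; apply/funext => t; rewrite /symbol_factor RecM/= mul0r subr0.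
have := tS _ tI; congr tame.
by apply/funext => th; apply/funext => t; rewrite /symbol_factor ImcM/= mul0r addr0.
Qed.

End tame_symbol_factor.

Section smooth_families.
Context {R : realType} {n : nat}.
Notation dir := (fun i => delta_mx 0 i : 'rV[R]_n).

Lemma ctame_coord Th (r : Th -> 'I_n -> R) k (F : 'I_n -> Th -> R -> R[i]) :
  (forall j, ctame e1 (fun th _ => r th j) k (F j)) ->
  ctame dir r k (fun th x => \prod_j F j th (x 0 j)).
Proof.
move=> tF; apply: ctame_prod => j; have [tR tI] := tF j; split.
  exact: (tame_comp_coord (r := fun th _ => r th j) (j := j) (fun _ => erefl) tR).
exact: (tame_comp_coord (r := fun th _ => r th j) (j := j) (fun _ => erefl) tI).
Qed.

Lemma big_mderiv_word (h : 'I_n -> R) (alpha : 'I_n -> nat) :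
  \prod_(j <- mderiv_word alpha) h j = \prod_j h j ^+ alpha j.
Proof.
rewrite /mderiv_word big_flatten/= big_map big_enum/=; apply: eq_bigr => j _.
by rewrite big_nseq -Monoid.iteropE.
Qed.

Lemma ctame_smooth Th (r : Th -> 'I_n -> R) (F : Th -> 'rV[R]_n -> R[i]) :
  (forall k, ctame dir r k F) -> forall th, smooth (F th).
Proof.
move=> tF th; split.
  by have [H _] := tame_pderivs (fun k => (tF k).1); exact: H.
by have [H _] := tame_pderivs (fun k => (tF k).2); exact: H.
Qed.

Lemma ctame_mderiv Th (r : Th -> 'I_n -> R) (F : Th -> 'rV[R]_n -> R[i]) :
  (forall th j, 0 < r th j) -> (forall k, ctame dir r k F) ->
  forall s, exists M, 0 <= M /\ forall th x,
    `|pderivs s (fun y => complex.Re (F th y)) x| <= M * \prod_(j <- s) (r th j)^-1 /\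
    `|pderivs s (fun y => complex.Im (F th y)) x| <= M * \prod_(j <- s) (r th j)^-1.
Proof.
move=> r0 tF s.
have [_ /(_ s) [MR [MR0 hR]]] := tame_pderivs (fun k => (tF k).1).
have [_ /(_ s) [MI [MI0 hI]]] := tame_pderivs (fun k => (tF k).2).
have p0 th : 0 < \prod_(j <- s) r th j by exact: prodr_gt0.
exists (MR + MI); split; first exact: addr_ge0.
move=> th x; rewrite prodfV; split; rewrite ler_pdivlMr// mulrC -[X in X * _]gtr0_norm// -normrM.
  by have := hR th x; rewrite mul1r => /le_trans; apply; rewrite lerDl.
by have := hI th x; rewrite mul1r => /le_trans; apply; rewrite lerDr.
Qed.

Lemma near_notin_interval_rV (l : 'I_n -> R) (x : 'rV[R]_n) : ~ interval_rV l x ->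
  \near x, ~ interval_rV l x.
Proof.
move=> /existsNP[j /negP]; rewrite -ltNge => lx.
have c : continuous (fun y : 'rV[R]_n => `|y 0 j|).
  by move=> y; apply: continuous_comp; [exact: coord_continuous|exact: norm_continuous].
have := c x => /cvgr_gt /(_ _ lx); apply: filterS => y ly /(_ j).
by rewrite leNgt ly.
Qed.

(** The complement of the closed box is open, so every derivative there sees only the value 0. *)
Lemma pderivs_eq0 (l : 'I_n -> R) (g : 'rV[R]_n -> R) :
  (forall x, ~ interval_rV l x -> g x = 0) ->
  forall s x, ~ interval_rV l x -> pderivs s g x = 0.
Proof.
move=> g0; elim=> [|j s IH] x lx; first exact: g0.
rewrite /= /pderiv -(near_eq_derive (f := (cst 0 : 'rV[R]_n -> R))).
  exact: derive_cst.
by move: (near_notin_interval_rV lx); apply: filterS => y /IH ->.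
Qed.

End smooth_families.

Section tensor_functions.
Context {R : realType} {n : nat}.
Notation dir := (fun i => delta_mx 0 i : 'rV[R]_n).

Definition test_fun (s : R) (l : 'I_n -> R) (bm : 'I_n -> bool * nat) (x : 'rV[R]_n) : R[i] :=
  \prod_j (rs_bumps s (l j) (bm j) (x 0 j))%:C%C.

Definition tensor_symbol (l : 'I_n -> R) (bm : 'I_n -> bool * nat) (x : 'rV[R]_n) : R[i] :=
  \prod_j symbol_factor (l j) (bm j) (x 0 j).

Lemma ctame_tensor_symbol Th (l psi : Th -> 'I_n -> R) (bm : Th -> 'I_n -> bool * nat) K :
  (forall th j, 0 < l th j) -> (forall th j, 0 < psi th j) ->
  (forall th j, psi th j <= K * (l th j / 2 ^+ (bm th j).2)) ->
  forall k, ctame dir psi k (fun th => tensor_symbol (l th) (bm th)).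
Proof.
move=> l0 psi0 psiK k.
apply: (ctame_coord (F := fun j th => symbol_factor (l th j) (bm th j))) => j.
exact: (@ctame_symbol_factor _ _ (l ^~ j) (psi ^~ j) (bm ^~ j) K).
Qed.

Lemma tensor_symbol_eq0 l bm x : (forall j, 0 < l j) -> ~ interval_rV l x ->
  tensor_symbol l bm x = 0.
Proof.
move=> l0 /existsNP[j /negP]; rewrite -ltNge => lx.
rewrite /tensor_symbol (bigD1 j)//= /symbol_factor bump_eq0 ?mul0r//.
rewrite in_itv/=; apply/negP => /andP[x0 x1]; move: lx; rewrite ltNge => /negP; apply.
have x0' : 0 < x 0 j by move: x0; rewrite pmulr_lgt0// invr_gt0.
by move: x1; rewrite ltr_pdivrMr// mul1r gtr0_norm// => /ltW.
Qed.

Lemma test_fun_eq0 s l bm x : (forall j, 0 < l j) -> `|s| = 1 ->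
  ~ interval_rV (fun j => 2 ^+ (bm j).2 / l j) x -> test_fun s l bm x = 0.
Proof.
move=> l0 s1 /existsNP[j lx].
rewrite /test_fun (bigD1 j)//=.
have [->|/(rs_bumps_neq0 (l0 j) s1)//] := eqVneq (rs_bumps s (l j) (bm j) (x 0 j)) 0.
by rewrite mul0r.
Qed.

Lemma tame_rs_bumps s l bm k : s != 0 -> 0 < l ->
  tame e1 (fun (_ : unit) _ => l^-1) (fun=> 1) k (fun _ : unit => @rs_bumps R s l bm).
Proof.
move=> s0 l0; rewrite /rs_bumps.
elim: (index_enum _) => [|j w IH].
  apply: (eq_tame (F := fun _ _ => 0)) => //; first by move=> _ x; rewrite big_nil.
  by apply: (@tame_cst _ _ _ _ _ _ _ _ (fun=> 0) 0) => _; rewrite mulr0 normr0.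
apply: (eq_tame (F := fun _ t => rs bm.1 bm.2 j * smooth_bump (l * t + - (s * j%:R)) +
  \sum_(k <- w) rs bm.1 bm.2 k * smooth_bump (l * t - s * k%:R))) => //.
  by move=> _ t; rewrite big_cons.
apply: tameD IH; apply: tameM1.
  apply: (@tame_cst _ _ _ _ _ _ _ _ (fun=> rs bm.1 bm.2 j) 1) => _.
  by rewrite mul1r normr_rs.
apply: (@tame_affine R unit (fun _ _ => 1) (fun _ _ => l^-1) (fun=> 1) k
  (fun=> @smooth_bump R) (fun=> l) (fun=> _) _ (tame_bump k)) => _.
by rewrite mulVf// gt_eqF.
Qed.

Lemma ctame_test_fun s l bm k : s != 0 -> (forall j, 0 < l j) ->
  ctame dir (fun (_ : unit) j => (l j)^-1) k (fun _ : unit => test_fun s l bm).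
Proof.
move=> s0 l0.
apply: (ctame_coord (F := fun j _ t => (rs_bumps s (l j) (bm j) t)%:C%C)) => j.
by apply: ctame_real; exact: tame_rs_bumps.
Qed.

(** Compact support: on the box of half-widths [L j] the monomial is at most the product of the
    [L j ^+ beta j], and outside it all derivatives vanish. *)
Lemma schwartz_test_fun s l bm : `|s| = 1 -> (forall j, 0 < l j) ->
  schwartz (test_fun s l bm).
Proof.
move=> s1 l0; have s0 : s != 0 by rewrite -normr_gt0 s1.
have t k := ctame_test_fun bm k s0 l0.
split; first exact: (ctame_smooth t tt).
move=> alpha beta.
have r0 (th : unit) j : 0 < (l j)^-1 by rewrite invr_gt0.
have [M [M0 hM]] := ctame_mderiv r0 t (mderiv_word alpha).
set P := \prod_(j <- _) _ in hM.
pose L j := 2 ^+ (bm j).2 / l j.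
have L0 j : 0 <= L j by rewrite divr_ge0 ?exprn_ge0 ?ltW.
exists (\prod_j L j ^+ beta j * (M * P + M * P)) => x.
have [xL|xL] := pselect (interval_rV L x).
  apply: ler_pM => //; first exact: normc_ge0.
    rewrite normr_prod; apply: ler_prod => j _; rewrite normr_ge0 normrX/=.
    by apply: lerXn2r; rewrite ?nnegrE//; exact: xL.
  by apply: le_trans (normc_le_Re_Im _) _; have [h1 h2] := hM tt x; exact: lerD.
rewrite /mderiv !(pderivs_eq0 (l := L))//.
- rewrite normc0 mulr0 mulr_ge0//.
    by apply: prodr_ge0 => j _; rewrite exprn_ge0.
  by apply: addr_ge0; apply: le_trans (normr_ge0 _) _; have [h1 h2] := hM tt x; exact: h1.
- by move=> y yL; rewrite test_fun_eq0.
- by move=> y yL; rewrite test_fun_eq0.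
Qed.

End tensor_functions.

(** * Transforms, norms and pairings of tensor products *)

Section tensor_integrals.
Context {R : realType} {n : nat}.
Notation leb := (@lebesgue_measure R).
Notation mu := (@lebesgue_rV R n).

Lemma cexp_i_sum I (r : seq I) (F : I -> R) :
  cexp_i (\sum_(i <- r) F i) = \prod_(i <- r) cexp_i (F i).
Proof. by apply: (big_morph (@cexp_i R)); [exact: cexp_iD|exact: cexp_i0]. Qed.

Lemma cintegrable_rs_bumps s l bm : 0 < l ->
  cintegrable leb (fun t => (rs_bumps s l bm t)%:C%C : R[i]).
Proof.
move=> l0; have [+ _] := ft_rs_bumps s bm 0 l0.
by under eq_fun do rewrite mulr0 oppr0 cexp_i0 mul1r.
Qed.

Lemma cintegrable_test_fun s (l : 'I_n -> R) bm : (forall j, 0 < l j) ->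
  cintegrable mu (test_fun s l bm).
Proof.
move=> l0; have := @cint_rV_prod R n (fun j t => (rs_bumps s (l j) (bm j) t)%:C%C).
by move=> /(_ (fun j => cintegrable_rs_bumps s (bm j) (l0 j)))[].
Qed.

Lemma fourier_test_fun s (l : 'I_n -> R) bm xi : (forall j, 0 < l j) ->
  fourier (test_fun s l bm) xi = \prod_j ft (rs_bumps s (l j) (bm j)) (xi 0 j).
Proof.
move=> l0.
have H := @cint_rV_prod R n (fun j t => cexp_i (- (t * xi 0 j)) * (rs_bumps s (l j) (bm j) t)%:C%C).
have [j|_ <-] := H _; first by have [] := ft_rs_bumps s (bm j) (xi 0 j) (l0 j).
congr (cint _ _); apply/funext => x.
by rewrite /dotrV -sumrN cexp_i_sum /test_fun -big_split.
Qed.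

Lemma fourier_conj_test_fun s (l : 'I_n -> R) bm xi : (forall j, 0 < l j) ->
  cint mu (fun x => cexp_i (dotrV xi x) * test_fun s l bm x) =
  \prod_j ft (rs_bumps s (l j) (bm j)) (- xi 0 j).
Proof.
move=> l0; rewrite -(@eq_bigr _ _ _ _ _ _ (fun j => ft (rs_bumps s (l j) (bm j)) ((- xi) 0 j))).
  rewrite -fourier_test_fun//; congr (cint _ _); apply/funext => x.
  congr (cexp_i _ * _); rewrite /dotrV -sumrN; apply: eq_bigr => j _.
  by rewrite mxE mulrN opprK mulrC.
by move=> j _; rewrite mxE.
Qed.

Lemma cintegrable_ft_rs_bumps s l bm : 0 < l -> cintegrable leb (ft (rs_bumps s l bm)).
Proof.
move=> l0; have l0' : 0 < l^-1 by rewrite invr_gt0.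
have [ib _] := cint_affine 0 l0' (@cintegrable_bump_hat R).
have -> : ft (rs_bumps s l bm) = fun eta => ((l^-1)%:C%C * rs_sum bm.1 bm.2 0 (- (s * (eta / l)))) *
    bump_hat (l^-1 * eta + 0).
  apply/funext => eta; rewrite (ft_rs_bumps s bm eta l0).2 addr0 [l^-1 * eta]mulrC.
  by ring.
apply: (@cintegrableM_bounded _ _ _ _ _ _ (`|l^-1| * (Num.sqrt 2 * Num.sqrt (2 ^+ bm.2)))) => //.
  apply: cmeasurableM; first exact: cmeasurable_cst.
  apply: (cmeasurable_comp (measurable_rs_sum bm.1 bm.2 0)).
  by apply: measurable_funN; apply: measurable_funM => //; apply: measurable_funM.
move=> t; rewrite normcM normc_real ler_wpM2l//; exact: normc_rs_sum_le.
Qed.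

Lemma cintegrable_fourier_test_fun s (l : 'I_n -> R) bm : (forall j, 0 < l j) ->
  cintegrable mu (fourier (test_fun s l bm)).
Proof.
move=> l0; have -> : fourier (test_fun s l bm) =
    fun xi => \prod_j ft (rs_bumps s (l j) (bm j)) (xi 0 j).
  by apply/funext => xi; exact: fourier_test_fun.
by have [] := @cint_rV_prod R n (fun j => ft (rs_bumps s (l j) (bm j)))
  (fun j => cintegrable_ft_rs_bumps s (bm j) (l0 j)).
Qed.

Lemma lebesgue_interval_rV (L : 'I_n -> R) : (forall j, 0 <= L j) ->
  mu (interval_rV L) = (\prod_j (2 * L j))%:E /\ measurable (interval_rV L).
Proof.
move=> L0.
have E : interval_rV L = [set v : 'rV[R]_n | forall j, [set` `[- L j, L j]] (v 0 j)].
  by apply/seteqP; split=> v /= H j; have := H j; rewrite /= in_itv/= ler_norml.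
split.
  rewrite E (@lebesgue_rV_box R n (fun j => [set` `[- L j, L j]]))//.
  rewrite -prodEFin; apply: eq_bigr => j _.
  rewrite lebesgue_measure_itv/= lte_fin.
  case: ltP => h; first by rewrite -EFinB opprK; congr EFin; ring.
  have -> : L j = 0 by apply/eqP; rewrite eq_le L0 andbT; move: h; lra.
  by rewrite mulr0.
rewrite (_ : interval_rV L = \bigcap_(j in [set: 'I_n]) (rV_coord j @^-1` [set` `[- L j, L j]])).
  apply: fin_bigcap_measurable; first exact: finite_finset.
  move=> j _; rewrite -[X in measurable X]setTI; exact: measurable_rV_coord.
by rewrite E; apply/seteqP; split=> v /= H j; [move=> _; exact: H|exact: H].
Qed.

(** The modulus is at most the indicator of a box. The box is symmetric so as to contain the support
    for both signs [s], which accounts for the factor 2 in each side. *)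
Lemma cLnorm_test_fun p s (l : 'I_n -> R) bm : 0 < p -> `|s| = 1 -> (forall j, 0 < l j) ->
  (cLnorm p (test_fun s l bm) <=
    ((\prod_j (2 * (2 ^+ (bm j).2 / l j))) `^ p^-1)%:E)%E.
Proof.
move=> p0 s1 l0; pose L j := 2 ^+ (bm j).2 / l j.
have L0 j : 0 <= L j by rewrite divr_ge0 ?exprn_ge0 ?ltW.
have [mE mI] := lebesgue_interval_rV L0.
have mt := measurable_normc (cintegrable_measurable (cintegrable_test_fun s bm l0)).
have P0 : 0 <= \prod_j (2 * (2 ^+ (bm j).2 / l j)) :> R.
  by apply: prodr_ge0 => j _; rewrite mulr_ge0//; exact: L0.
rewrite /cLnorm unlock -poweR_EFin.
apply: gt0_ler_poweR.
- by rewrite invr_ge0 ltW.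
- by rewrite in_itv/= leey andbT; apply: integral_ge0 => x _; rewrite lee_fin powR_ge0.
- by rewrite in_itv/= leey andbT lee_fin.
have -> : ((\prod_j (2 * (2 ^+ (bm j).2 / l j)))%:E =
    \int[mu]_x (\1_(interval_rV L) x)%:E)%E.
  by rewrite integral_indic// setIT; exact/esym/mE.
apply: ge0_le_integral => //.
- by move=> x _; exact: poweR_ge0.
- apply: (measurableT_comp (measurable_poweR p)).
  by apply: measurableT_comp => //; apply/measurable_EFinP.
- exact/measurable_EFinP/measurable_indic.
move=> x _ /=; rewrite indicE.
have [xL|xL] := boolP (x \in interval_rV L).
  rewrite lee_fin; apply: (@le_trans _ _ (1 `^ p)); last by rewrite powR1.
  rewrite ge0_ler_powR ?nnegrE ?(ltW p0)//.
  rewrite ger0_norm ?normc_ge0// /test_fun normc_prod.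
  apply: prodr_ile1 => j _; rewrite normc_ge0 normc_real/=.
  exact: rs_bumps_le1.
move: xL; rewrite notin_setE => xL.
by rewrite test_fun_eq0// normc0 normr0 powR0 // gt_eqF.
Qed.

(** The choice [s = 1] for one function and [s = -1] for the other makes both polynomials appear at
    the same argument [- (eta / l j)]. The hypothesis then holds when one function carries the word
    [bm] and the other a word of length one. *)
Lemma pairing_value (l : 'I_n -> R) bm bu bv : (forall j, 0 < l j) ->
  (forall j t, rs_sum (bu j).1 (bu j).2 0 (- t) * rs_sum (bv j).1 (bv j).2 0 (- t) =
    rs_sum (bm j).1 (bm j).2 0 (- t) :> R[i]) ->
  cint mu (fun xi => tensor_symbol l bm xi * (fourier (test_fun 1 l bu) xi *
    cint mu (fun x => cexp_i (dotrV xi x) * test_fun (-1) l bv x))) =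
  (\prod_j ((l j)^-1 * (Num.sqrt (2 ^+ (bm j).2))^-1 * bump_energy (bm j)))%:C%C.
Proof.
move=> l0 H.
pose g j eta := ft (rs_bumps 1 (l j) (bu j)) eta * ft (rs_bumps (-1) (l j) (bv j)) (- eta).
have gE j eta : g j eta = ((l j)^-1)%:C%C * ((l j)^-1)%:C%C *
    (bump_hat (eta / l j) * bump_hat (- (eta / l j)) * rs_sum (bm j).1 (bm j).2 0 (- (eta / l j))).
  rewrite /g (ft_rs_bumps _ _ _ (l0 j)).2 (ft_rs_bumps _ _ _ (l0 j)).2 -H.
  by rewrite mul1r mulN1r mulNr opprK; ring.
have S j := cint_symbol_factor (bm := bm j) (l0 j) (gE j).
have [_ e] := @cint_rV_prod R n (fun j eta => symbol_factor (l j) (bm j) eta * g j eta)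
  (fun j => (S j).1).
rewrite rmorph_prod -(eq_bigr _ (fun j _ => (S j).2)) -e.
congr (cint _ _); apply/funext => xi.
by rewrite fourier_test_fun// fourier_conj_test_fun// /tensor_symbol -!big_split.
Qed.

End tensor_integrals.

(** * Geometrically weighted series *)

Section geometric_sums.
Context {R : realType}.
Implicit Types (a b : nat -> R).

Definition geo K a : Prop := forall m, `|a m| <= K * 2^-1 ^+ m.

Definition gsum a : R := limn (series a).

Lemma geo_cvg K a : geo K a -> cvgn (series a).
Proof.
move=> ga; have K0 : 0 <= K.
  by have := ga 0%N; rewrite expr0 mulr1; apply: le_trans.
apply: (@normed_cvg R R^o); apply: (series_le_cvg (v_ := geometric K 2^-1)) => //.
- by move=> m /=; exact: normr_ge0.
- by move=> m; apply: mulr_ge0 => //; exact: exprn_ge0.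
by apply: is_cvg_geometric_series; rewrite ger0_norm//; lra.
Qed.

Lemma geo_gsum_le K a : geo K a -> `|gsum a| <= 2 * K.
Proof.
move=> ga; have ca := geo_cvg ga.
have h2 : `|2^-1 : R| < 1 by rewrite ger0_norm//; lra.
have cK : cvgn (series (geometric K 2^-1)) by exact: is_cvg_geometric_series.
have KE : limn (series (geometric K 2^-1)) = 2 * K.
  have := cvg_geometric_series (a := K) h2; move=> /cvg_lim -> //; field; lra.
have leK : gsum a <= 2 * K.
  rewrite -KE; apply: lim_series_le => // m /=.
  exact: le_trans (ler_norm _) (ga m).
rewrite ler_norml leK andbT.
have caN : cvgn (series (- a)) by rewrite is_cvg_seriesN.
have : limn (series (- a)) <= 2 * K.
  rewrite -KE; apply: lim_series_le => // m /=.
  by apply: le_trans (ler_norm _) _; rewrite normrN; exact: ga.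
by rewrite lim_seriesN// lerNl.
Qed.

Lemma geoD K L a b : geo K a -> geo L b -> geo (K + L) (fun m => a m + b m).
Proof.
by move=> ga gb m; rewrite mulrDl (le_trans (ler_normD _ _))// lerD.
Qed.

Lemma geoZ K a r : geo K a -> geo (`|r| * K) (fun m => r * a m).
Proof. by move=> ga m; rewrite normrM -mulrA ler_wpM2l. Qed.

Lemma gsumD K L a b : geo K a -> geo L b ->
  gsum (fun m => a m + b m) = gsum a + gsum b.
Proof. by move=> /geo_cvg ca /geo_cvg cb; exact: lim_seriesD. Qed.

Lemma gsumZ K a r : geo K a -> gsum (fun m => r * a m) = r * gsum a.
Proof. by move=> /geo_cvg ca; exact: lim_seriesZ. Qed.

Lemma gsum_split K a k : geo K a ->
  gsum a = \sum_(m < k) a m + gsum (fun m => if (m < k)%N then 0 else a m).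
Proof.
move=> ga; set b := fun m => if (m < k)%N then a m else 0.
set t := fun m => _ : R.
have K0 : 0 <= K.
  by have := ga 0%N; rewrite expr0 mulr1; apply: le_trans.
have gb : geo K b.
  move=> m; rewrite /b; case: ifP => _ //.
  by rewrite normr0 mulr_ge0// exprn_ge0.
have gt : geo K t.
  move=> m; rewrite /t; case: ifP => _ //.
  by rewrite normr0 mulr_ge0// exprn_ge0.
have -> : gsum a = gsum b + gsum t.
  rewrite -(gsumD gb gt); congr gsum; apply/funext => m; rewrite /b /t.
  by case: ifP => _; rewrite ?addr0 ?add0r.
congr (_ + _); apply/cvg_lim => //.
apply: cvg_near_cst; exists k => // m /= km.
have t0 : \sum_(k <= i < m) b i = 0.
  rewrite big_nat_cond big1// => i /andP[/andP[ki _] _]; by rewrite /b ltnNge ki.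
rewrite /series/= (big_cat_nat (n := k))//= t0 addr0 big_mkord.
by apply: eq_bigr => i _; rewrite /b ltn_ord.
Qed.

Lemma gsum_bound_split K a k e : geo K a ->
  (forall m, (k <= m)%N -> `|a m| <= e * 2^-1 ^+ m) -> 0 <= e ->
  `|gsum a - \sum_(m < k) a m| <= 2 * e.
Proof.
move=> ga ae e0; rewrite (gsum_split k ga) addrC addKr; apply: geo_gsum_le => m.
case: ltnP => [_|km]; last exact: ae.
by rewrite normr0 mulr_ge0// exprn_ge0.
Qed.

Lemma geo_tail K a k : geo K a ->
  `|gsum a - \sum_(m < k) a m| <= 4 * (K * 2^-1 ^+ k).
Proof.
move=> ga; have K0 : 0 <= K.
  by have := ga 0%N; rewrite expr0 mulr1; apply: le_trans.
have cv := geo_cvg ga.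
have E : gsum (fun m => a (m + k)%N) = gsum a - \sum_(m < k) a m.
  have ck : geo (K * 2^-1 ^+ k) (fun m => a (m + k)%N).
    by move=> m; rewrite -mulrA [_ ^+ k * _]mulrC -exprD; exact: ga.
  have H : series a n @[n --> \oo] --> \sum_(m < k) a m + gsum (fun m => a (m + k)%N).
    rewrite -(cvg_shiftn k).
    rewrite (_ : (fun n => series a (n + k)%N) =
        (fun n => \sum_(m < k) a m + series (fun m => a (m + k)%N) n)).
      by apply: cvgD; [exact: cvg_cst|exact: geo_cvg ck].
    apply/funext => n; rewrite /series/= (big_cat_nat (n := k)) ?leq_addl//= big_mkord.
    by congr (_ + _); rewrite -{1}[k]add0n big_addn addnK.
  by rewrite /gsum [in RHS](cvg_lim _ H)// addrC addKr.
rewrite -E; apply: (@le_trans _ _ (2 * (K * 2^-1 ^+ k))).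
  apply: geo_gsum_le => m; rewrite -mulrA [_ ^+ k * _]mulrC -exprD; exact: ga.
by rewrite ler_wpM2r// ?mulr_ge0 ?exprn_ge0// ler_nat.
Qed.

End geometric_sums.

(** * Second-order Taylor estimate along a direction *)

Section line_taylor.
Context {R : realType} {V : normedModType R}.

Lemma is_derive_along (h : V -> R) (e x : V) (t d : R) :
  is_derive (t *: e + x) e h d -> is_derive t 1 (fun s : R => h (s *: e + x)) d.
Proof.
move=> [D1 D2].
suff E : (fun s : R => s^-1 *: (((fun s : R => h (s *: e + x)) \o shift t) (s *: 1) -
    h (t *: e + x))) = (fun s : R => s^-1 *: ((h \o shift (t *: e + x)) (s *: e) - h (t *: e + x))).
  by split; rewrite /derivable /derive E.
apply/funext => s; rewrite /shift/= [s *: 1]mulr1.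
by rewrite scalerDl addrA.
Qed.

Lemma derivative_bound_le (f f' : R -> R) (K t : R) :
  (forall s : R, is_derive s 1 f (f' s)) -> (forall s, `|s| <= `|t| -> `|f' s| <= K) ->
  `|f t - f 0| <= K * `|t|.
Proof.
move=> df fK.
have cf (a b : R) : {within `[a, b], continuous f}.
  apply: continuous_subspaceT => s; apply: differentiable_continuous.
  by apply/derivable1_diffP; have [] := df s.
have [t0|t0] := leP 0 t.
  have [c] := @MVT_segment R f f' 0 t t0 (fun s _ => df s) (cf 0 t).
  rewrite in_itv/= => /andP[c0 ct] ->; rewrite subr0 normrM ler_wpM2r//.
  by apply: fK; rewrite !ger0_norm.
have [c] := @MVT_segment R f f' t 0 (ltW t0) (fun s _ => df s) (cf t 0).
rewrite in_itv/= => /andP[c0 ct] H.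
rewrite -normrN opprB H sub0r normrM normrN ler_wpM2r//.
by apply: fK; rewrite !ler0_norm// ?lerN2// ltW.
Qed.

(** Two applications of the mean value inequality: the derivative of [p] is at most [M * |s|], hence
    at most [M * |t|] between 0 and [t]. *)
Lemma taylor_line (h h1 h2 : V -> R) (e x : V) M (t : R) :
  (forall y, is_derive y e h (h1 y)) -> (forall y, is_derive y e h1 (h2 y)) ->
  (forall y, `|h2 y| <= M) ->
  `|h (t *: e + x) - h x - t * h1 x| <= M * t ^+ 2.
Proof.
move=> dh dh1 hM.
pose p (s : R) := h (s *: e + x) - s * h1 x.
have dp (s : R) : is_derive s 1 p (h1 (s *: e + x) - h1 x).
  apply: (@is_derive_addf R R (fun s => h (s *: e + x)) (fun s => - (s * h1 x)) s 1).
    exact: is_derive_along.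
  have -> : (fun s : R => - (s * h1 x)) = fun s => - h1 x * s.
    by apply/funext => u; rewrite mulrC mulNr.
  by rewrite -[X in is_derive _ _ _ X]mulr1; apply: is_derive_mulrf.
have dh1' (s : R) : is_derive s 1 (fun s : R => h1 (s *: e + x)) (h2 (s *: e + x)).
  exact: is_derive_along.
have := @derivative_bound_le p _ (M * `|t|) t dp.
rewrite /p scale0r add0r mul0r subr0 -mulrA -expr2 real_normK ?num_real//.
have -> : h (t *: e + x) - t * h1 x - h x = h (t *: e + x) - h x - t * h1 x by ring.
apply=> s st.
have := @derivative_bound_le (fun s => h1 (s *: e + x)) _ M s dh1' (fun _ _ => hM _).
rewrite scale0r add0r => /le_trans; apply; rewrite ler_wpM2l//.
exact: le_trans (hM x).
Qed.

End line_taylor.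

(** * Termwise differentiation of weighted series *)

Section termwise.
Context {R : realType} {n : nat}.
Variables (c : nat -> R) (f : nat -> 'rV[R]_n -> R).
Hypothesis c2 : forall m, `|c m| <= 2^-1 ^+ m.

Lemma geo_coef M (a : nat -> R) : (forall m, `|a m| <= M) -> geo M (fun m => c m * a m).
Proof.
by move=> aM m; rewrite normrM mulrC; apply: ler_pM.
Qed.

(** The common bound on second derivatives makes the Taylor error at most [M2 * t ^+ 2] for all
    terms at once, so it can be summed before letting [t] tend to 0. *)
Lemma is_derive_gsum (h h1 h2 : nat -> 'rV[R]_n -> R) (e x : 'rV[R]_n) M M1 M2 :
  (forall m y, is_derive y e (h m) (h1 m y)) ->
  (forall m y, is_derive y e (h1 m) (h2 m y)) ->
  (forall m y, `|h m y| <= M) -> (forall m y, `|h1 m y| <= M1) ->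
  (forall m y, `|h2 m y| <= M2) ->
  is_derive x e (fun y => gsum (fun m => c m * h m y)) (gsum (fun m => c m * h1 m x)).
Proof.
move=> dh dh1 hM hM1 hM2.
have M20 : 0 <= M2 by apply: le_trans (hM2 0%N x).
set G := fun y => _; set G1 := gsum _.
have key (t : R) : `|G (t *: e + x) - G x - t * G1| <= 2 * (M2 * t ^+ 2).
  have g1 := geo_coef (fun m => hM m (t *: e + x)).
  have g2 := geoZ (-1) (geo_coef (fun m => hM m x)).
  have g3 := geoZ (- t) (geo_coef (fun m => hM1 m x)).
  have -> : G (t *: e + x) - G x - t * G1 = gsum (fun m => c m *
      (h m (t *: e + x) - h m x - t * h1 m x)).
    rewrite -[- G x]mulN1r -mulNr /G /G1 -(gsumZ _ (geo_coef (fun m => hM m x))).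
    rewrite -(gsumZ _ (geo_coef (fun m => hM1 m x))) -(gsumD g1 g2).
    rewrite -(gsumD (geoD g1 g2) g3); congr gsum; apply/funext => m; ring.
  apply: geo_gsum_le; apply: geo_coef => m.
  exact: taylor_line (dh m) (dh1 m) (hM2 m).
have H : (fun t : R => t^-1 *: ((G \o shift x) (t *: e) - G x)) @ 0^' --> G1.
  have N0 : 0 < 2 * M2 + 1 by rewrite ltr_wpDl// mulr_ge0.
  apply/cvgrPdist_le => eps eps0; near=> t.
  have t0 : t != 0 by near: t; exact: nbhs_dnbhs_neq.
  rewrite distrC /shift/= /GRing.scale/=.
  have -> : t^-1 * (G (t *: e + x) - G x) - G1 = t^-1 * (G (t *: e + x) - G x - t * G1).
    by field.
  rewrite normrM normfV ler_pdivrMl ?normr_gt0//.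
  apply: le_trans (key t) _.
  have te : `|t| <= eps / (2 * M2 + 1) by near: t; apply: dnbhs0_le; rewrite divr_gt0.
  have -> : 2 * (M2 * t ^+ 2) = `|t| * (2 * M2 * `|t|).
    by rewrite -[t ^+ 2]real_normK ?num_real//; ring.
  apply: ler_wpM2l => //.
  move: te; rewrite ler_pdivlMr// => /(le_trans _); apply.
  by rewrite mulrC ler_wpM2l// lerDl.
split; first by apply/cvg_ex; exists G1.
exact: cvg_lim.
Unshelve. all: by end_near. Qed.

Lemma continuous_gsum (V : normedModType R) (h : nat -> V -> R) M :
  (forall m, continuous (h m)) -> (forall m y, `|h m y| <= M) ->
  continuous (fun y => gsum (fun m => c m * h m y)).
Proof.
move=> ch hM x; have M0 : 0 <= M by apply: le_trans (hM 0%N x).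
apply/cvgrPdist_le => eps eps0.
have [k hk] : exists k, 4 * (M * 2^-1 ^+ k) <= eps / 3.
  have : (fun k => 4 * M * 2^-1 ^+ k) @ \oo --> 4 * M * 0.
    by apply: cvgM; [exact: cvg_cst|apply: cvg_expr; rewrite ger0_norm//; lra].
  rewrite mulr0 => /cvgr0_norm_le /(_ (eps / 3)) /(_ ltac:(lra)) [k _ /(_ k (leqnn k)) /=].
  by move=> /(le_trans (ler_norm _)) hk; exists k; rewrite mulrA.
have cP : continuous (fun y => \sum_(m < k) c m * h m y).
  elim: k {hk} => [|k IH] y.
    by under eq_fun do rewrite big_ord0; exact: cst_continuous.
  have -> : (fun y => \sum_(m < k.+1) c m * h m y) =
      (fun y => \sum_(m < k) c m * h m y + c k * h k y).
    by apply/funext => z; rewrite big_ord_recr.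
  by apply: cvgD; [exact: IH|apply: cvgM; [exact: cvg_cst|exact: ch]].
near=> y.
have T z := geo_tail k (geo_coef (fun m => hM m z)).
have C : `|(\sum_(m < k) c m * h m x) - (\sum_(m < k) c m * h m y)| <= eps / 3.
  near: y; have /cvgrPdist_le := cP x; apply; lra.
have := T x; have := T y; move: C.
set A := gsum _; set B := gsum _; set a := \sum_(_ < _) _; set b := \sum_(_ < _) _.
rewrite !ler_norml => /andP[? ?] /andP[? ?] /andP[? ?]; apply/andP; split; lra.
Unshelve. all: by end_near. Qed.

Lemma smooth_gsum : (forall m, smooth_real (f m)) ->
  (forall s, exists M, forall m x, `|pderivs s (f m) x| <= M) ->
  smooth_real (fun x => gsum (fun m => c m * f m x)) /\
  forall s x, pderivs s (fun x => gsum (fun m => c m * f m x)) x =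
    gsum (fun m => c m * pderivs s (f m) x).
Proof.
move=> sf bf.
have step s j x : is_derive x (delta_mx 0 j)
    (fun y => gsum (fun m => c m * pderivs s (f m) y))
    (gsum (fun m => c m * pderivs (j :: s) (f m) x)).
  have [M hM] := bf s; have [M1 hM1] := bf (j :: s); have [M2 hM2] := bf (j :: j :: s).
  apply: (is_derive_gsum (h2 := fun m => pderivs (j :: j :: s) (f m))) hM hM1 hM2 => m y.
    by apply: DeriveDef => //; have [_ +] := sf m s; apply.
  by apply: DeriveDef => //; have [_ +] := sf m (j :: s); apply.
have E s : pderivs s (fun x => gsum (fun m => c m * f m x)) =
    fun x => gsum (fun m => c m * pderivs s (f m) x).
  elim: s => // j s IH; apply/funext => x.
  rewrite [LHS]/(pderiv j (pderivs s _) x) IH /pderiv; exact: derive_val.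
split=> s; last by move=> x; rewrite E.
split; rewrite E.
  have [M hM] := bf s.
  by apply: continuous_gsum hM => m; have [] := sf m s.
by move=> j x; have [] := step s j x.
Qed.

End termwise.

Section complex_gsum.
Context {R : realType} {n : nat}.

Definition cgsum (c : nat -> R) (f : nat -> 'rV[R]_n -> R[i]) (x : 'rV[R]_n) : R[i] :=
  (gsum (fun m => c m * complex.Re (f m x)) +i* gsum (fun m => c m * complex.Im (f m x)))%C.

Lemma cmeasurable_cgsum c f M : (forall m, `|c m| <= 2^-1 ^+ m) ->
  (forall m x, normc (f m x) <= M) -> (forall m, cmeasurable (f m)) ->
  cmeasurable (cgsum c f).
Proof.
move=> c2 fM mf.
have K (part : R[i] -> R) : (forall m x, `|part (f m x)| <= M) ->
    (forall m, measurable_fun setT (fun x => part (f m x))) ->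
    measurable_fun setT (fun x => gsum (fun m => c m * part (f m x))).
  move=> pM mp; pose h k x := \sum_(m < k) c m * part (f m x).
  apply: (@measurable_fun_cvg _ _ _ _ h) => [k|x _].
    apply: measurable_sum => j; apply: measurable_funM; first exact: measurable_cst.
    exact: mp.
  have E : series (fun m => c m * part (f m x)) = h ^~ x.
    by apply/funext => k; rewrite /series/= big_mkord.
  by have := geo_cvg (geo_coef c2 (fun m => pM m x)); rewrite /gsum E.
split.
  apply: (K (@complex.Re R)) => m; last by have [] := mf m.
  by move=> x; exact: le_trans (Re_le_normc _) (fM m x).
apply: (K (@complex.Im R)) => m; last by have [] := mf m.
by move=> x; exact: le_trans (Im_le_normc _) (fM m x).
Qed.

(** Real and imaginary part contribute [2 * e] each. The parameter [e] records that the coefficients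
    from [k] on are smaller than [c2] alone guarantees. *)
Lemma cgsum_split_bound c f M k e x : (forall m, `|c m| <= 2^-1 ^+ m) ->
  (forall m x, normc (f m x) <= M) -> 0 <= e ->
  (forall m, (k <= m)%N -> `|c m| * M <= e * 2^-1 ^+ m) ->
  normc (cgsum c f x - \sum_(m < k) (c m)%:C%C * f m x) <= 4 * e.
Proof.
move=> c2 fM e0 ce.
have K (part : R[i] -> R) : (forall m x, `|part (f m x)| <= M) ->
    `|gsum (fun m => c m * part (f m x)) - \sum_(m < k) c m * part (f m x)| <= 2 * e.
  move=> pM; apply: (gsum_bound_split (geo_coef c2 (fun m => pM m x))) => // m km.
  rewrite normrM; apply: le_trans (ce m km); exact: ler_wpM2l.
apply: le_trans (normc_le_Re_Im _) _.
have -> : 4 * e = 2 * e + 2 * e by ring.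
have ReB (z w : R[i]) : complex.Re (z - w) = complex.Re z - complex.Re w by case: z; case: w.
have ImB (z w : R[i]) : complex.Im (z - w) = complex.Im z - complex.Im w by case: z; case: w.
apply: lerD.
  rewrite ReB Rec_sum; under eq_bigr do rewrite RecM/= mul0r subr0.
  by apply: (K (@complex.Re R)) => m y; exact: le_trans (Re_le_normc _) (fM m y).
rewrite ImB Imc_sum; under eq_bigr do rewrite ImcM/= mul0r addr0.
by apply: (K (@complex.Im R)) => m y; exact: le_trans (Im_le_normc _) (fM m y).
Qed.

End complex_gsum.

(** * The gliding hump *)

Section gliding_hump.
Context {R : realType} {n : nat} {I : Type}.
Notation mu := (@lebesgue_rV R n).
Variables (sigma g : I -> 'rV[R]_n -> R[i]) (d : I -> R) (L0 K : R).
Variable bnd : ('rV[R]_n -> R[i]) -> R -> Prop.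
Hypothesis d0 : forall i, 0 < d i.
Hypothesis L00 : 0 <= L0.
Hypothesis sigmaL : forall i x, normc (sigma i x) <= L0.
Hypothesis msigma : forall i, cmeasurable (sigma i).
Hypothesis gi : forall i, cintegrable mu (g i).
Hypothesis bnd_pair : forall s M i A, cmeasurable s -> (forall x, normc (s x) <= M) ->
  0 <= A -> bnd s A -> normc (cint mu (fun x => s x * g i x)) <= K * A * d i.
Hypothesis unbounded : forall A, exists i,
  A * d i <= normc (cint mu (fun x => sigma i x * g i x)).
Hypothesis bounded_pieces : forall i, exists B, 0 <= B /\ bnd (sigma i) B.

(** [bnd s A] stands for: [A] bounds the operator with symbol [s]; it enters through [bnd_pair] and
    [bounded_pieces]. Tested against the [k]-th kernel, earlier pieces are harmless because the
    [k]-th index is chosen after their finite bounds are known, and later ones because their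
    coefficients are chosen small relative to that kernel. The [k]-th piece leaves a pairing of at
    least [k * d], which contradicts any fixed [A]. *)
Lemma gliding_hump : exists (c : nat -> R) (idx : nat -> I),
  (forall m, 0 <= c m <= 2^-1 ^+ m) /\
  forall A, 0 <= A -> ~ bnd (cgsum c (fun m => sigma (idx m))) A.
Proof.
have [B HB] := choice bounded_pieces.
have B0 i : 0 <= B i by have [] := HB i.
have [pk Hpk] := choice unbounded.
pose E i := \int[mu]_x normc (g i x).
have E0 i : 0 <= E i by apply: Rintegral_ge0 => x _; exact: normc_ge0.
(* [TS.1] sums the ratios [L0 * E / d] of the kernels used so far, and [TS.2] the pairing bounds
   [c * (K * B)] of the pieces used so far. *)
pose cf (k : nat) (TS : R * R) := 2^-1 ^+ k / (1 + TS.1).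
(* In the threshold, [TS.2] pays for the earlier pieces, 8 for the later ones, and [k] is what
   survives. *)
pose ix (k : nat) (TS : R * R) := pk ((k%:R + TS.2 + 8) / cf k TS).
pose st := fix st k : R * R := if k is k'.+1 then
    ((st k').1 + L0 * E (ix k' (st k')) / d (ix k' (st k')),
     (st k').2 + cf k' (st k') * (K * B (ix k' (st k'))))
  else (0, 0).
pose c k := cf k (st k); pose idx k := ix k (st k).
have stT k : (st k.+1).1 = (st k).1 + L0 * E (idx k) / d (idx k) by [].
have LEd i : 0 <= L0 * E i / d i by rewrite divr_ge0 ?mulr_ge0// ltW.
have T0 k : 0 <= (st k).1.
  by elim: k => // k IH; rewrite stT addr_ge0.
have T1 k : 0 < 1 + (st k).1 by rewrite ltr_pwDl.
have Tmono j k : (j <= k)%N -> (st j).1 <= (st k).1.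
  move=> /subnK <-; elim: (k - j)%N => // i IH.
  by rewrite addSn stT (le_trans IH)// lerDl.
have c0 k : 0 < c k by rewrite divr_gt0// exprn_gt0// invr_gt0.
have c2 k : c k <= 2^-1 ^+ k.
  by rewrite ler_pdivrMr// ler_peMr ?exprn_ge0// lerDl.
have S_E k : (st k).2 = \sum_(m < k) c m * (K * B (idx m)).
  by elim: k => [|k IH]; rewrite ?big_ord0// big_ord_recr/= -IH.
exists c, idx; split; first by move=> m; rewrite c2 ltW.
move=> A A0 bA.
pose f m := sigma (idx m).
have fL m x : normc (f m x) <= L0 by exact: sigmaL.
have c2' m : `|c m| <= 2^-1 ^+ m by rewrite ger0_norm// ltW.
have mG : cmeasurable (cgsum c f) by exact: (@cmeasurable_cgsum R n c f L0 c2' fL (fun m => msigma (idx m))).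
have GL x : normc (cgsum c f x) <= 4 * L0.
  have := @cgsum_split_bound R n c f L0 0 L0 x c2' fL L00.
  rewrite big_ord0 subr0; apply=> m _; rewrite mulrC; exact: ler_wpM2l.
have key k : k%:R * d (idx k) <= K * A * d (idx k).
  apply: le_trans (bnd_pair (idx k) mG GL A0 bA).
  set i := idx k.
  pose P x := \sum_(m < k.+1) (c m)%:C%C * f m x.
  pose t x := cgsum c f x - P x.
  have tb x : normc (t x) <= 4 * (L0 / (1 + (st k.+1).1)).
    apply: (cgsum_split_bound _ c2' fL); first by rewrite divr_ge0// ltW.
    move=> m km; rewrite (gtr0_norm (c0 m)) /c /cf.
    rewrite mulrC mulrA mulrAC ler_wpM2r ?exprn_ge0// ler_wpM2l//.
    by rewrite lef_pV2 ?posrE// lerD2l Tmono.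
  have mf m : cmeasurable (f m) by exact: msigma.
  have mP : cmeasurable P.
    apply: cmeasurable_sum => m; apply: cmeasurableM; first exact: cmeasurable_cst.
    exact: mf.
  have mt : cmeasurable t.
    have := cmeasurableD mG (cmeasurableM (cmeasurable_cst (-1)) mP).
    by rewrite /t; under eq_fun do rewrite mulN1r.
  have it : cintegrable mu (fun x => t x * g i x) by exact: cintegrableM_bounded tb.
  have ifm m : cintegrable mu (fun x => f m x * g i x) by exact: cintegrableM_bounded (fL m).
  have icfm (m : 'I_k.+1) : cintegrable mu (fun x => (c m)%:C%C * (f m x * g i x)).
    exact: cintegrableZ.
  have eE : cint mu (fun x => cgsum c f x * g i x) =
      \sum_(m < k) (c m)%:C%C * cint mu (fun x => f m x * g i x) +
      (c k)%:C%C * cint mu (fun x => f k x * g i x) + cint mu (fun x => t x * g i x).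
    transitivity (cint mu (fun x => (\sum_(m < k.+1) (c m)%:C%C * (f m x * g i x)) + t x * g i x)).
      congr cint; apply/funext => x; rewrite /t mulrBl /P mulr_suml.
      under [X in _ = X + _]eq_bigr do rewrite mulrA.
      by rewrite addrC subrK.
    rewrite cintD//; last exact: cintegrable_sum.
    rewrite cint_sum//; congr (_ + _); rewrite big_ord_recr/=; congr (_ + _); last exact: cintZ.
    by apply: eq_bigr => m _; rewrite cintZ.
  have main : (k%:R + (st k).2 + 8) * d i <= c k * normc (cint mu (fun x => f k x * g i x)).
    have := Hpk ((k%:R + (st k).2 + 8) / cf k (st k)).
    rewrite -/(ix k (st k)) -/(idx k) mulrAC ler_pdivrMr; last exact: c0. by rewrite [_ * cf _ _]mulrC.
  have head : normc (\sum_(m < k) (c m)%:C%C * cint mu (fun x => f m x * g i x)) <=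
      (st k).2 * d i.
    apply: le_trans (normc_sum _ _ _) _; rewrite S_E mulr_suml; apply: ler_sum => m _.
    rewrite normcM normc_real gtr0_norm// -[c m * _ * d i]mulrA; apply: ler_wpM2l; first exact: ltW.
    exact: (bnd_pair i (msigma (idx m)) (sigmaL (idx m)) (B0 _) (HB _).2).
  (* 8 is the 2 of [normc_cint_le] times the 4 of [cgsum_split_bound]. The denominator absorbs
     [L0 * E i / d i], since [(st k.+1).1] already contains that summand. *)
  have tail : normc (cint mu (fun x => t x * g i x)) <= 8 * d i.
    apply: le_trans (normc_cint_le it) _.
    apply: (@le_trans _ _ (2 * (4 * (L0 / (1 + (st k.+1).1)) * E i))).
      rewrite ler_wpM2l// /E -RintegralZl//; last exact: rintegrable_normc.
      apply: le_Rintegral => //.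
      - exact: rintegrable_normc.
      - by apply: rintegrableZ; exact: rintegrable_normc.
      by move=> x _; rewrite normcM ler_wpM2r ?normc_ge0.
    have h : L0 * E i <= (1 + (st k.+1).1) * d i.
      rewrite -ler_pdivrMr// stT; have := T0 k; have := LEd i; rewrite -/i; lra.
    have -> : 2 * (4 * (L0 / (1 + (st k.+1).1)) * E i) =
        8 * ((L0 * E i) / (1 + (st k.+1).1)) by ring.
    by rewrite ler_wpM2l// ler_pdivrMr// [d i * _]mulrC.
  have tri (x y z : R[i]) : normc y <= normc (x + y + z) + normc x + normc z.
    have E1 : y = (x + y + z) + (- x) + (- z) by ring.
    rewrite {1}E1; apply: le_trans (le_normcD _ _) _; rewrite [normc (- z)]normcN lerD2r.
    by apply: le_trans (le_normcD _ _) _; rewrite [normc (- x)]normcN.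
  have := tri (\sum_(m < k) (c m)%:C%C * cint mu (fun x => f m x * g i x))
     ((c k)%:C%C * cint mu (fun x => f k x * g i x)) (cint mu (fun x => t x * g i x)).
  rewrite -eE [normc (_%:C%C * _)]normcM normc_real gtr0_norm//.
  move: main head tail; rewrite !mulrDl; lra.
have kA k : k%:R <= K * A.
  by have := key k; rewrite ler_pM2r.
have [k hk] : exists k : nat, K * A < k%:R.
  by exists (Num.truncn (K * A)).+1; exact: truncnS_gt.
by have := kA k; rewrite leNgt hk.
Qed.

End gliding_hump.

(** * Scalar multiples and membership in the symbol class *)

Section smooth_scale.
Context {R : realType} {n : nat}.

Lemma pderivs_scale (a : R) (g : 'rV[R]_n -> R) s : smooth_real g ->
  pderivs s (fun x => a * g x) = fun x => a * pderivs s g x.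
Proof.
move=> sg; elim: s => // j s IH; apply/funext => x.
rewrite [LHS]/(pderiv j (pderivs s _) x) IH /pderiv.
have [_ /(_ j x) dg] := sg s.
have H : is_derive x (delta_mx 0 j) (pderivs s g) (pderivs (j :: s) g x).
  exact: DeriveDef.
by have [_ ->] := is_derive_mulrf a H.
Qed.

Lemma smooth_real_scale (a : R) (g : 'rV[R]_n -> R) : smooth_real g ->
  smooth_real (fun x => a * g x).
Proof.
move=> sg s; rewrite pderivs_scale//; have [cg dg] := sg s; split.
  by move=> x; apply: continuousM; [exact: cst_continuous|exact: cg].
move=> j x.
have H : is_derive x (delta_mx 0 j) (pderivs s g) (pderivs (j :: s) g x).
  exact: DeriveDef.
by have [] := is_derive_mulrf a H.
Qed.

Lemma symbol_class_intro (lam : 'rV[R]_n -> R) (psi : 'I_n -> 'rV[R]_n -> R)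
    (sigma : 'rV[R]_n -> R[i]) : smooth sigma ->
  (forall s, exists M, 0 <= M /\ forall x,
    `|pderivs s (fun y => complex.Re (sigma y)) x| <= M * lam x * \prod_(j <- s) (psi j x)^-1 /\
    `|pderivs s (fun y => complex.Im (sigma y)) x| <= M * lam x * \prod_(j <- s) (psi j x)^-1) ->
  symbol_class lam psi sigma.
Proof.
move=> ss H; split => // alpha; have [M [M0 hM]] := H (mderiv_word alpha).
exists (2 * M); split; first by rewrite mulr_ge0.
move=> xi; have [hR hI] := hM xi.
have -> : \prod_(j < n) psi j xi ^- alpha j = \prod_(j <- mderiv_word alpha) (psi j xi)^-1.
  by rewrite big_mderiv_word; apply: eq_bigr => j _; rewrite exprVn.
apply: le_trans (normc_le_Re_Im _) _.
rewrite -!mulrA mulr_natl mulr2n !mulrA; exact: lerD hR hI.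
Qed.

End smooth_scale.

(** For [x > 1] the exponent is one less than the least [k] with [x <= 2 ^ k]. For [x <= 1], which
    occurs for the ratios l/psi when the constant [c] is below 1, it is 0; hence the maximum. *)
Lemma dyadic_between {R : realType} (x : R) :
  exists m : nat, 2 ^+ m <= Num.max 1 x /\ x <= 2 * 2 ^+ m.
Proof.
have [x1|x1] := leP x 1.
  by exists 0%N; rewrite expr0 lexx mulr1; split => //; lra.
have ex : exists k : nat, x <= 2 ^+ k.
  exists (Num.truncn x).+1; apply: le_trans (ltW (truncnS_gt x)) _.
  by rewrite -natrX ler_nat ltnW// ltn_expl.
have [[|k] hk mink] := ex_minnP ex.
  by move: x1; rewrite ltNge -[1](expr0 2) hk.
exists k; split; last by rewrite -exprS.
apply: ltW; rewrite ltNge; apply/negP => xk.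
by have := mink k xk; rewrite ltnn.
Qed.

Lemma sqrtr_prod {R : realType} I (r : seq I) (F : I -> R) : (forall i, 0 <= F i) ->
  Num.sqrt (\prod_(i <- r) F i) = \prod_(i <- r) Num.sqrt (F i).
Proof.
move=> F0; elim: r => [|i r IH]; first by rewrite !big_nil sqrtr1.
by rewrite !big_cons sqrtrM// IH.
Qed.

Section pairing_kernel.
Context {R : realType} {n : nat}.
Notation mu := (@lebesgue_rV R n).

Lemma cintegrable_fourier_pair (u v : 'rV[R]_n -> R[i]) :
  cintegrable mu (fourier u) -> cintegrable mu v ->
  cintegrable mu (fun xi => fourier u xi * cint mu (fun x => cexp_i (dotrV xi x) * v x)).
Proof.
move=> iu iv.
pose V xi := cint mu (fun x => cexp_i (dotrV xi x) * v x).
have iV xi : cintegrable mu (fun x => cexp_i (dotrV xi x) * v x).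
  apply: (@cintegrableM_bounded _ _ _ _ _ _ 1) => //; last by move=> x; rewrite normc_cexp_i.
  apply: cmeasurable_cexp_i; apply: measurable_sum => j; apply: measurable_funM.
    exact: measurable_cst.
  exact: measurable_rV_coord.
have mV : cmeasurable V.
  have [KR KI] : cmeasurable (fun z : 'rV[R]_n * 'rV[R]_n => cexp_i (dotrV z.1 z.2) * v z.2).
    apply: cmeasurableM.
      apply: cmeasurable_cexp_i; apply: measurable_sum => j; apply: measurable_funM.
        exact: (measurableT_comp (measurable_rV_coord j) measurable_fst).
      exact: (measurableT_comp (measurable_rV_coord j) measurable_snd).
    exact: (cmeasurable_comp (cintegrable_measurable iv) measurable_snd).
  by split; [exact: (measurable_Rintegral_inner mu KR)|exact: (measurable_Rintegral_inner mu KI)].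
have E : (fun xi => fourier u xi * cint mu (fun x => cexp_i (dotrV xi x) * v x)) =
    fun xi => V xi * fourier u xi by apply/funext => xi; rewrite mulrC.
rewrite E; apply: (@cintegrableM_bounded _ _ _ _ _ _ (2 * \int[mu]_x normc (v x))) => // xi.
apply: le_trans (normc_cint_le (iV xi)) _.
rewrite ler_wpM2l// le_eqVlt; apply/orP; left; apply/eqP.
by apply: eq_Rintegral => x _; rewrite normcM normc_cexp_i mul1r.
Qed.

End pairing_kernel.

(** * Choice of the pieces *)

Section pieces.
Context {R : realType} {n : nat}.
Notation mu := (@lebesgue_rV R n).
Variables (p : R) (lam : 'rV[R]_n -> R) (psi : 'I_n -> 'rV[R]_n -> R) (c C : R).
Hypothesis lam0 : forall xi, 0 < lam xi.
Hypothesis psi0 : forall j xi, 0 < psi j xi.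
Hypothesis c0 : 0 < c.
Hypothesis C0 : 0 < C.
Let theta := `|p^-1 - 2^-1|.

Definition inf_sublevel xi : R := inf (lam @` sublevel psi xi).

Lemma inf_sublevel_ge0 xi : 0 <= inf_sublevel xi.
Proof.
apply: lb_le_inf; first by exists (lam xi); exists xi => // j.
by move=> _ [eta _ <-]; exact: ltW.
Qed.

Lemma inf_sublevel_le xi eta : sublevel psi xi eta -> inf_sublevel xi <= lam eta.
Proof.
move=> S; apply: ge_inf; last by exists eta.
by exists 0 => _ [zeta _ <-]; exact: ltW.
Qed.

(** [x] consists of the widths and the Rudin-Shapiro words of a piece. The third clause is the
    oscillation condition behind the symbol estimates; the last one transfers the unboundedness of
    [Fp] to the quantity that the pairing controls. *)
Definition piece_spec (kappa : R) xi (x : ('I_n -> R) * ('I_n -> bool * nat)) : Prop :=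
  [/\ forall j, 0 < x.1 j,
      interval_rV x.1 `<=` sublevel psi xi,
      forall j, psi j xi <= Num.max 1 c^-1 * (x.1 j / 2 ^+ (x.2 j).2),
      forall j, kappa * 2 ^+ (x.2 j).2 <= bump_energy (x.2 j) &
      Fp p lam psi xi <= (C * 4 ^+ n) `^ theta *
        (inf_sublevel xi * (\prod_j 2 ^+ (x.2 j).2) `^ theta)].

(** If the ratio l/psi exceeds 1, then psi * 2^m <= l; otherwise m = 0 and psi <= l / c, which
    explains [Num.max 1 c^-1]. In [4 ^+ n] each coordinate has a 2 from the side [2 * l j] and a 2
    from rounding the ratio down. *)
Lemma piece_exists kappa xi :
  (forall m, exists b, kappa * 2 ^+ m <= bump_energy (b, m)) ->
  (exists l : 'I_n -> R,
      [/\ forall j, c * psi j xi <= l j,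
          interval_rV l `<=` sublevel psi xi &
          (lebesgue_rV n (sublevel psi xi)
             <= C%:E * lebesgue_rV n (interval_rV l))%E]) ->
  exists x, piece_spec kappa xi x.
Proof.
move=> /choice[bsel hb] [l [lpsi lS lC]].
have l0 j : 0 < l j by apply: lt_le_trans (lpsi j); rewrite mulr_gt0.
have /choice[m hm] : forall j, exists m : nat,
    2 ^+ m <= Num.max 1 (l j / psi j xi) /\ l j / psi j xi <= 2 * 2 ^+ m.
  by move=> j; exact: dyadic_between.
exists (l, fun j => (bsel (m j), m j)); split => //=.
- move=> j; have [h _] := hm j.
  have N0 : 0 < 2 ^+ m j :> R by rewrite exprn_gt0.
  rewrite mulrA ler_pdivlMr//.
  apply: (@le_trans _ _ (psi j xi * Num.max 1 (l j / psi j xi))).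
    by rewrite ler_wpM2l// ltW.
  have lc : psi j xi <= c^-1 * l j by rewrite mulrC ler_pdivlMr// mulrC.
  rewrite /Num.max; case: ifP => _; case: ifP => h1; rewrite ?mulr1 ?mul1r.
  + rewrite mulrC divfK ?gt_eqF// ler_peMl ?(ltW (l0 j))// ltW//.
  + by rewrite mulrC divfK ?gt_eqF.
  + exact: lc.
  + apply: le_trans lc _; rewrite ler_piMl ?(ltW (l0 j))// leNgt; exact/negbT.
have [mE _] := lebesgue_interval_rV (fun j => ltW (l0 j)).
rewrite mE -EFinM in lC.
set Q := \prod_j _.
have Q0 : 0 <= Q by apply: prodr_ge0 => j _; rewrite exprn_ge0.
have fin : mu (sublevel psi xi) \is a fin_num.
  by rewrite ge0_fin_numE// (le_lt_trans lC)// ltry.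
have Sle : fine (mu (sublevel psi xi)) <= C * \prod_j (2 * l j).
  by rewrite -lee_fin fineK.
have S0 : 0 <= fine (mu (sublevel psi xi)) by rewrite fine_ge0.
have P0 : 0 <= \prod_j (psi j xi)^-1 by apply: prodr_ge0 => j _; rewrite invr_ge0 ltW.
rewrite /Fp -/(inf_sublevel xi) mulrCA ler_wpM2l ?inf_sublevel_ge0//.
rewrite -powRM//; last by rewrite mulr_ge0 ?exprn_ge0// ltW.
apply: ge0_ler_powR; rewrite ?nnegrE ?normr_ge0//.
- by rewrite mulr_ge0.
- by rewrite mulr_ge0// mulr_ge0 ?exprn_ge0// ltW.
apply: le_trans (ler_wpM2r P0 Sle) _.
rewrite -!mulrA ler_wpM2l ?(ltW C0)// -big_split/=.
have -> : 4 ^+ n * Q = \prod_j (4 * 2 ^+ m j).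
  by rewrite big_split/= prodr_const card_ord.
apply: ler_prod => j _; have [_ h] := hm j.
apply/andP; split; first by rewrite !mulr_ge0 ?invr_ge0 ?ltW.
have -> : 4 * 2 ^+ m j = 2 * (2 * 2 ^+ m j) :> R by ring.
by rewrite -mulrA; exact: ler_wpM2l.
Qed.

End pieces.

Section tensor_symbol_bounds.
Context {R : realType} {n : nat}.

Lemma cmeasurable_tensor_symbol (l : 'I_n -> R) bm : cmeasurable (tensor_symbol l bm).
Proof.
apply: cmeasurable_prod => j.
have mdiv : measurable_fun setT (fun x : 'rV[R]_n => x 0 j / l j).
  by apply: measurable_funM => //; exact: measurable_rV_coord.
apply: cmeasurableM.
  apply: cmeasurable_real; apply: measurable_funM => //.
  exact: (measurableT_comp measurable_bump mdiv).
exact: (cmeasurable_comp (measurable_rs_sum (bm j).1 (bm j).2 0) mdiv).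
Qed.

Lemma normc_tensor_symbol_le (l : 'I_n -> R) bm x :
  normc (tensor_symbol l bm x) <= Num.sqrt 2 ^+ n.
Proof.
rewrite /tensor_symbol normc_prod.
have -> : Num.sqrt 2 ^+ n = \prod_(j < n) Num.sqrt 2 :> R by rewrite prodr_const card_ord.
apply: ler_prod => j _; rewrite normc_ge0/= /symbol_factor normcM normc_real.
set N := 2 ^+ _; have N0 : 0 < Num.sqrt N :> R by rewrite sqrtr_gt0 exprn_gt0.
rewrite normrM ger0_norm ?bump_ge0// ger0_norm ?invr_ge0 ?(ltW N0)//.
apply: (@le_trans _ _ (1 * (Num.sqrt N)^-1 * (Num.sqrt 2 * Num.sqrt N))).
  apply: ler_pM; [|exact: normc_ge0| |exact: normc_rs_sum_le].
    by rewrite mulr_ge0 ?bump_ge0 ?invr_ge0 ?(ltW N0).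
  by apply: ler_wpM2r; [rewrite invr_ge0 (ltW N0)|exact: bump_le1].
by rewrite mul1r mulrCA mulVf ?mulr1// gt_eqF.
Qed.

End tensor_symbol_bounds.

(** * Lower bound for the pairing of a piece with its test functions *)

Section piece_pairing.
Context {R : realType} {n : nat}.
Notation mu := (@lebesgue_rV R n).
Variables (p q : R).
Hypotheses (p1 : 1 < p) (pq : p^-1 + q^-1 = 1).
Let theta := `|p^-1 - 2^-1|.

(** The word of length one: [rs_bumps] becomes a single bump and [rs_sum] at order 0 the constant
    1. *)
Definition trivial_bm (j : 'I_n) : bool * nat := (true, 0%N).

(** The box bound for a sum of N bumps grows like N^(1/r) in L^r, so the long word goes to the
    function measured with the larger of the exponents [p] and [q]. *)
Definition bm_u (bm : 'I_n -> bool * nat) := if 2 <= p then bm else trivial_bm.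
Definition bm_v (bm : 'I_n -> bool * nat) := if 2 <= p then trivial_bm else bm.

Definition pair_u l bm : 'rV[R]_n -> R[i] := test_fun 1 l (bm_u bm).
Definition pair_v l bm : 'rV[R]_n -> R[i] := test_fun (-1) l (bm_v bm).

Definition pair_g l bm (xi : 'rV[R]_n) : R[i] :=
  fourier (pair_u l bm) xi * cint mu (fun x => cexp_i (dotrV xi x) * pair_v l bm x).

Definition box_norm (r : R) (l : 'I_n -> R) (bm : 'I_n -> bool * nat) : R :=
  (\prod_j (2 * (2 ^+ (bm j).2 / l j))) `^ r^-1.

Definition pair_d l bm : R := box_norm p l (bm_u bm) * box_norm q l (bm_v bm).

(** The widths occur to the power 1/p + 1/q = 1, and the word lengths to the power min(1/p, 1/q) =
    1/2 - |1/p - 1/2|. *)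
Lemma pair_dE l bm : (forall j, 0 < l j) ->
  pair_d l bm = \prod_j (2 / l j) * (\prod_j 2 ^+ (bm j).2) `^ (2^-1 - theta).
Proof.
move=> l0; set P := \prod_j (2 / l j); set Q := \prod_j _.
have P0 : 0 < P by apply: prodr_gt0 => j _; rewrite divr_gt0.
have Q0 : 0 < Q by apply: prodr_gt0 => j _; rewrite exprn_gt0.
have bE (r : R) : box_norm r l bm = P `^ r^-1 * Q `^ r^-1.
  rewrite -powRM ?ltW// /P /Q -big_split/=; congr (_ `^ _).
  by apply: eq_bigr => j _; ring.
have b1 (r : R) : box_norm r l trivial_bm = P `^ r^-1.
  by congr (_ `^ _); apply: eq_bigr => j _; rewrite expr0 mul1r.
have PP : P `^ p^-1 * P `^ q^-1 = P.
  by rewrite -powRD pq ?powRr1 ?ltW// oner_eq0.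
have p0 : 0 < p by exact: lt_trans ltr01 p1.
rewrite /pair_d /bm_u /bm_v /theta; case: ifPn => [p2|p2]; rewrite bE b1.
  rewrite mulrAC PP; congr (_ * _ `^ _).
  have : p^-1 <= 2^-1 by rewrite lef_pV2 ?posrE.
  by move=> h; rewrite ler0_norm; lra.
rewrite mulrA PP; congr (_ * _ `^ _).
have : 2^-1 <= p^-1 by move: p2; rewrite -ltNge => /ltW; rewrite lef_pV2 ?posrE.
by move=> h; rewrite ger0_norm; move: pq h; lra.
Qed.

Lemma pair_d_gt0 l bm : (forall j, 0 < l j) -> 0 < pair_d l bm.
Proof.
move=> l0; rewrite pair_dE// mulr_gt0//; first by apply: prodr_gt0 => j _; rewrite divr_gt0.
by apply: powR_gt0; apply: prodr_gt0 => j _; rewrite exprn_gt0.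
Qed.

(** By [pairing_value] and the energy bound each coordinate contributes at least kappa * sqrt N / l,
    whereas [pair_d] contributes 2 N^(1/2 - theta) / l. The quotient is (kappa / 2) * N^theta. *)
Lemma pairing_lower l bm kappa a : (forall j, 0 < l j) -> 0 <= a -> 0 < kappa ->
  (forall j, kappa * 2 ^+ (bm j).2 <= bump_energy (bm j)) ->
  (kappa / 2) ^+ n * (a * (\prod_j 2 ^+ (bm j).2) `^ theta) * pair_d l bm <=
  normc (cint mu (fun xi => (a%:C%C * tensor_symbol l bm xi) * pair_g l bm xi)).
Proof.
move=> l0 a0 k0 hk.
have rs0 t : rs_sum true 0 0 t = 1 :> R[i] by rewrite rs_sum0 expr0.
have H j t : rs_sum (bm_u bm j).1 (bm_u bm j).2 0 (- t) *
    rs_sum (bm_v bm j).1 (bm_v bm j).2 0 (- t) = rs_sum (bm j).1 (bm j).2 0 (- t) :> R[i].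
  by rewrite /bm_u /bm_v; case: ifP => _; rewrite rs0 ?mulr1 ?mul1r.
have V := pairing_value l0 H.
have i1 : cintegrable mu (pair_g l bm).
  by apply: cintegrable_fourier_pair; [exact: cintegrable_fourier_test_fun|exact: cintegrable_test_fun].
have iT : cintegrable mu (fun xi => tensor_symbol l bm xi * pair_g l bm xi).
  exact: (cintegrableM_bounded i1 (cmeasurable_tensor_symbol l bm) (normc_tensor_symbol_le l bm)).
have -> : (fun xi => (a%:C%C * tensor_symbol l bm xi) * pair_g l bm xi) =
    (fun xi => a%:C%C * (tensor_symbol l bm xi * pair_g l bm xi)).
  by apply/funext => xi; rewrite mulrA.
rewrite cintZ// V -rmorphM normc_real.
apply: le_trans (ler_norm _); rewrite pair_dE//.
set P := \prod_j (2 / l j); set Q := \prod_j 2 ^+ (bm j).2.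
have Q0 : 0 < Q by apply: prodr_gt0 => j _; rewrite exprn_gt0.
have QE : Q `^ theta * Q `^ (2^-1 - theta) = \prod_j Num.sqrt (2 ^+ (bm j).2).
  rewrite -powRD; last by rewrite (gt_eqF Q0) implybT.
  rewrite addrC subrK powR12_sqrt ?ltW// sqrtr_prod// => j; exact: exprn_ge0.
have -> : (kappa / 2) ^+ n * (a * Q `^ theta) * (P * Q `^ (2^-1 - theta)) =
    a * ((kappa / 2) ^+ n * P * (Q `^ theta * Q `^ (2^-1 - theta))) by ring.
rewrite QE; apply: ler_wpM2l => //.
have -> : (kappa / 2) ^+ n = \prod_(j < n) (kappa / 2) by rewrite prodr_const card_ord.
rewrite /P -!big_split/=; apply: ler_prod => j _; apply/andP; split.
  by rewrite !mulr_ge0 ?sqrtr_ge0 ?invr_ge0 ?ltW// divr_gt0.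
have N0 : 0 < 2 ^+ (bm j).2 :> R by rewrite exprn_gt0.
have sN0 : 0 < Num.sqrt (2 ^+ (bm j).2) :> R by rewrite sqrtr_gt0.
have E : kappa / 2 * (2 / l j) * Num.sqrt (2 ^+ (bm j).2) =
    (l j)^-1 * (Num.sqrt (2 ^+ (bm j).2))^-1 * (kappa * (Num.sqrt (2 ^+ (bm j).2) ^+ 2)).
  by field; rewrite !gt_eqF.
rewrite E sqr_sqrtr ?(ltW N0)//; apply: ler_wpM2l => //; apply: mulr_ge0; by rewrite invr_ge0 ltW.
Qed.

End piece_pairing.

(** * The unbounded symbol *)

Section unbounded_symbol.
Context {R : realType} {n : nat}.
Notation mu := (@lebesgue_rV R n).
Variables (p : R) (lam : 'rV[R]_n -> R) (psi : 'I_n -> 'rV[R]_n -> R) (c C : R).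
Hypothesis p1 : 1 < p.
Hypothesis lam0 : forall xi, 0 < lam xi.
Hypothesis lam_bounded : bounded_fun lam.
Hypothesis psi0 : forall j xi, 0 < psi j xi.
Hypothesis c0 : 0 < c.
Hypothesis C0 : 0 < C.
Hypothesis intervals : forall xi, C <= enorm xi ->
    exists l : 'I_n -> R,
      [/\ forall j, c * psi j xi <= l j,
          interval_rV l `<=` sublevel psi xi &
          (lebesgue_rV n (sublevel psi xi)
             <= C%:E * lebesgue_rV n (interval_rV l))%E].
Hypothesis Fp_unbounded : ~ [bounded Fp p lam psi xi | xi in [set xi | C <= enorm xi]].

(** A common weakening of the two notions of boundedness in the theorem: its failure for every [A]
    makes [multiplier_norm] infinite and excludes a bounded extension. *)
Definition bounded_on_tests (sigma : 'rV[R]_n -> R[i]) (A : R) : Prop :=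
  forall l bm, (forall j, 0 < l j) ->
    (cLnorm p (multiplier sigma (test_fun 1 l bm)) <= A%:E * cLnorm p (test_fun 1 l bm))%E.

Let index := {xi : 'rV[R]_n | C <= enorm xi}.

Lemma Fp_large A : exists i : index, A < Fp p lam psi (val i).
Proof.
apply: contrapT => /forallNP H; apply: Fp_unbounded.
exists A; split; first exact: num_real.
move=> M AM xi /= Cxi; apply: le_trans (ltW AM).
rewrite ger0_norm; last by rewrite mulr_ge0 ?powR_ge0// inf_sublevel_ge0.
by have := H (exist _ xi Cxi); rewrite /= => /negP; rewrite -leNgt.
Qed.

Lemma lam_bound : exists L, 0 <= L /\ forall xi, lam xi <= L.
Proof.
have [M [_ hM]] := lam_bounded.
exists `|M + 1|; split => // xi.
have := hM (M + 1) ltac:(by rewrite ltrDl) xi I.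
by move=> /= h; apply: le_trans (ler_norm _) (le_trans h (ler_norm _)).
Qed.

Section pieces_chosen.
Variables (kappa : R) (x : index -> ('I_n -> R) * ('I_n -> bool * nat)).
Hypothesis kappa0 : 0 < kappa.
Hypothesis xP : forall i, piece_spec p lam psi c C kappa (val i) (x i).

Let a (i : index) := inf_sublevel lam psi (val i).

Let piece_symbol (i : index) (xi : 'rV[R]_n) : R[i] :=
  (a i)%:C%C * tensor_symbol (x i).1 (x i).2 xi.

Let a0 i : 0 <= a i. Proof. exact: inf_sublevel_ge0. Qed.

Let l0 i j : 0 < (x i).1 j. Proof. by have [h _ _ _ _] := xP i; exact: h. Qed.

Let symbolE i : (fun xi => complex.Re (piece_symbol i xi)) =
    (fun xi => a i * complex.Re (tensor_symbol (x i).1 (x i).2 xi)) /\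
  (fun xi => complex.Im (piece_symbol i xi)) =
    (fun xi => a i * complex.Im (tensor_symbol (x i).1 (x i).2 xi)).
Proof.
split; apply/funext => xi; first by rewrite RecM/= mul0r subr0.
by rewrite ImcM/= mul0r addr0.
Qed.

Let tensor_ctame k : ctame (fun j => delta_mx 0 j : 'rV[R]_n)
  (fun (i : index) j => psi j (val i)) k (fun i => tensor_symbol (x i).1 (x i).2).
Proof.
apply: (@ctame_tensor_symbol R n index (fun i => (x i).1) (fun i j => psi j (val i))
  (fun i => (x i).2) (Num.max 1 c^-1)) => // i j.
by have [_ _ h _ _] := xP i; exact: h.
Qed.

Let tensor_smooth i : smooth (tensor_symbol (x i).1 (x i).2).
Proof. exact: (ctame_smooth tensor_ctame). Qed.

Let piece_smooth i : smooth (piece_symbol i).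
Proof.
have [sR sI] := tensor_smooth i; have [eR eI] := symbolE i.
by split; rewrite ?eR ?eI; exact: smooth_real_scale.
Qed.

Let piece_pderivs s : exists M, 0 <= M /\ forall i xi,
  `|pderivs s (fun y => complex.Re (piece_symbol i y)) xi| <=
     M * (a i * \prod_(j <- s) (psi j (val i))^-1) /\
  `|pderivs s (fun y => complex.Im (piece_symbol i y)) xi| <=
     M * (a i * \prod_(j <- s) (psi j (val i))^-1).
Proof.
have [M [M0 hM]] := ctame_mderiv (fun i j => psi0 j (val i)) tensor_ctame s.
exists M; split => // i xi; have [hR hI] := hM i xi.
have [sR sI] := tensor_smooth i; have [eR eI] := symbolE i.
rewrite eR eI !pderivs_scale// !normrM !(ger0_norm (a0 i)) mulrCA.
by split; apply: ler_wpM2l.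
Qed.

Let piece_eq0 i s xi : ~ interval_rV (x i).1 xi ->
  pderivs s (fun y => complex.Re (piece_symbol i y)) xi = 0 /\
  pderivs s (fun y => complex.Im (piece_symbol i y)) xi = 0.
Proof.
by move=> out; split; apply: (pderivs_eq0 (l := (x i).1)) => // y outy;
  rewrite /piece_symbol tensor_symbol_eq0// mulr0.
Qed.

(** On its support a piece lies over the sublevel set of its own point, where the infimum [a i] is
    at most [lam xi] and [psi j xi] is at most the value used in the estimates. Elsewhere all
    derivatives vanish. *)
Let piece_pderivs_lam s : exists M, 0 <= M /\ forall i xi,
  `|pderivs s (fun y => complex.Re (piece_symbol i y)) xi| <=
     M * lam xi * \prod_(j <- s) (psi j xi)^-1 /\
  `|pderivs s (fun y => complex.Im (piece_symbol i y)) xi| <=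
     M * lam xi * \prod_(j <- s) (psi j xi)^-1.
Proof.
have [M [M0 hM]] := piece_pderivs s; exists M; split => // i xi.
have P0 : 0 <= \prod_(j <- s) (psi j xi)^-1.
  by apply: prodr_ge0 => j _; rewrite invr_ge0 ltW.
have [inI|out] := pselect (interval_rV (x i).1 xi); last first.
  have [-> ->] := piece_eq0 s out; rewrite normr0.
  by split; rewrite mulr_ge0// mulr_ge0// ltW.
have [_ /(_ _ inI) S _ _ _] := xP i.
have [hR hI] := hM i xi.
have H : M * (a i * \prod_(j <- s) (psi j (val i))^-1) <=
    M * lam xi * \prod_(j <- s) (psi j xi)^-1.
  rewrite -mulrA; apply: ler_wpM2l => //; apply: ler_pM => //.
  - by apply: prodr_ge0 => j _; rewrite invr_ge0 ltW.
  - exact: inf_sublevel_le.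
  apply: ler_prod => j _; rewrite invr_ge0 ltW//= lef_pV2 ?posrE//; exact: S.
by split; [exact: le_trans hR H|exact: le_trans hI H].
Qed.

(** Bounds independent of both the piece and the point are what [smooth_gsum] requires for termwise
    differentiation. *)
Let piece_pderivs_bounded s : exists M, forall i xi,
  `|pderivs s (fun y => complex.Re (piece_symbol i y)) xi| <= M /\
  `|pderivs s (fun y => complex.Im (piece_symbol i y)) xi| <= M.
Proof.
have [M [M0 hM]] := piece_pderivs s; have [L [L0 hL]] := lam_bound.
exists (M * (L * \prod_(j <- s) (psi j 0)^-1)) => i xi.
have [hR hI] := hM i xi; have [_ S _ _ _] := xP i.
(* The centre of the interval lies in the sublevel set, so [psi j 0 <= psi j xi_i]. *)
have S0 : sublevel psi (val i) 0.
  by apply: S => j; rewrite mxE normr0 ltW.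
have H : M * (a i * \prod_(j <- s) (psi j (val i))^-1) <=
    M * (L * \prod_(j <- s) (psi j 0)^-1).
  apply: ler_wpM2l => //; apply: ler_pM => //.
  - by apply: prodr_ge0 => j _; rewrite invr_ge0 ltW.
  - exact: le_trans (inf_sublevel_le lam0 S0) (hL _).
  apply: ler_prod => j _; rewrite invr_ge0 ltW//= lef_pV2 ?posrE//; exact: S0.
by split; [exact: le_trans hR H|exact: le_trans hI H].
Qed.

Let piece_symbol_class i : symbol_class lam psi (piece_symbol i).
Proof.
apply: symbol_class_intro; first exact: piece_smooth.
by move=> s; have [M [M0 hM]] := piece_pderivs_lam s; exists M; split => // xi; exact: hM.
Qed.

Let cgsum_symbol_class (w : nat -> R) (idx : nat -> index) :
  (forall m, 0 <= w m <= 2^-1 ^+ m) ->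
  symbol_class lam psi (cgsum w (fun m => piece_symbol (idx m))).
Proof.
move=> w2; have w2' m : `|w m| <= 2^-1 ^+ m.
  by have /andP[? ?] := w2 m; rewrite ger0_norm.
have bR s : exists M, forall m xi,
    `|pderivs s (fun y => complex.Re (piece_symbol (idx m) y)) xi| <= M.
  by have [M hM] := piece_pderivs_bounded s; exists M => m xi; have [] := hM (idx m) xi.
have bI s : exists M, forall m xi,
    `|pderivs s (fun y => complex.Im (piece_symbol (idx m) y)) xi| <= M.
  by have [M hM] := piece_pderivs_bounded s; exists M => m xi; have [] := hM (idx m) xi.
have [sR eR] := smooth_gsum w2' (fun m => (piece_smooth (idx m)).1) bR.
have [sI eI] := smooth_gsum w2' (fun m => (piece_smooth (idx m)).2) bI.
apply: symbol_class_intro; first by split.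
move=> s; have [M [M0 hM]] := piece_pderivs_lam s.
exists (2 * M); split; first by rewrite mulr_ge0.
move=> xi; rewrite /cgsum/= eR eI -!mulrA [M * (_ * _)]mulrA; split;
  by apply: geo_gsum_le; apply: (geo_coef w2') => m; have [] := hM (idx m) xi.
Qed.

Lemma unbounded_symbol_of_pieces : exists sigma, [/\ symbol_class lam psi sigma,
  cmeasurable sigma & forall A, 0 <= A -> ~ bounded_on_tests sigma A].
Proof.
have [L [L0 hL]] := lam_bound.
have aL i : a i <= L by apply: le_trans (inf_sublevel_le lam0 _) (hL (val i)) => j.
have mpiece i : cmeasurable (piece_symbol i).
  by apply: cmeasurableM; [exact: cmeasurable_cst|exact: cmeasurable_tensor_symbol].
have [bp|/existsNP[i nb]] := pselect (forall i, exists B, 0 <= B /\ bounded_on_tests (piece_symbol i) B);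
  last first.
  exists (piece_symbol i); split; [exact: piece_symbol_class|exact: mpiece|].
  by move=> A A0 bA; apply: nb; exists A.
have p0 : 0 < p by exact: lt_trans ltr01 p1.
pose q := (1 - p^-1)^-1.
have p1' : p^-1 < 1 by rewrite invf_lt1.
have q0 : 0 < q by rewrite invr_gt0 subr_gt0.
have pq : p^-1 + q^-1 = 1 by rewrite invrK addrC subrK.
pose u i := pair_u p (x i).1 (x i).2; pose v i := pair_v p (x i).1 (x i).2.
pose g i := pair_g p (x i).1 (x i).2; pose d i := pair_d p q (x i).1 (x i).2.
pose L' := L * Num.sqrt 2 ^+ n.
have d0 i : 0 < d i by apply: (pair_d_gt0 p1 pq) => j; exact: l0.
have L'0 : 0 <= L' by rewrite mulr_ge0// exprn_ge0// sqrtr_ge0.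
have pieceL i xi : normc (piece_symbol i xi) <= L'.
  rewrite normcM normc_real (ger0_norm (a0 i)).
  by apply: ler_pM => //; [exact: normc_ge0|exact: normc_tensor_symbol_le].
have iu i : cintegrable mu (fourier (u i)) by exact: cintegrable_fourier_test_fun.
have iv i : cintegrable mu (v i) by exact: cintegrable_test_fun.
have ig i : cintegrable mu (g i) by exact: (cintegrable_fourier_pair (iu i) (iv i)).
have bnd_pair s M i A : cmeasurable s -> (forall xi, normc (s xi) <= M) -> 0 <= A ->
    bounded_on_tests s A ->
    normc (cint mu (fun xi => s xi * g i xi)) <= 2 * (2 * pi) ^+ n * A * d i.
  move=> ms sM A0 bA.
  apply: (@multiplier_pairing_le R n p q s (u i) (v i) M A _ _ p0 q0 pq) => //.
  - exact: powR_ge0.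
  - exact: powR_ge0.
  - by apply: cLnorm_test_fun => //; rewrite normr1.
  - by apply: cLnorm_test_fun => //; rewrite normrN normr1.
  - exact: bA.
have unb A : exists i, A * d i <= normc (cint mu (fun xi => piece_symbol i xi * g i xi)).
  pose K1 := (C * 4 ^+ n) `^ `|p^-1 - 2^-1|.
  have K10 : 0 < K1 by rewrite powR_gt0// mulr_gt0// exprn_gt0.
  have k2 : 0 < (kappa / 2) ^+ n by rewrite exprn_gt0// divr_gt0.
  (* The threshold compensates the constant [(kappa / 2) ^+ n] of [pairing_lower] and the constant
     [K1] of [piece_spec]. *)
  have [i hi] := Fp_large (A / (kappa / 2) ^+ n * K1).
  exists i; have [_ _ _ hk hF] := xP i.
  apply: le_trans (pairing_lower p1 pq (l0 i) (a0 i) kappa0 hk).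
  rewrite ler_pM2r// mulrC -ler_pdivrMr//.
  rewrite -(ler_pM2r K10) [leRHS]mulrC; exact: le_trans (ltW hi) hF.
have [w [idx [w2 H]]] := gliding_hump d0 L'0 pieceL mpiece ig bnd_pair unb bp.
exists (cgsum w (fun m => piece_symbol (idx m))); split => //.
- exact: cgsum_symbol_class.
- apply: (@cmeasurable_cgsum R n w _ L') => // m.
  by have /andP[? ?] := w2 m; rewrite ger0_norm.
Qed.

End pieces_chosen.

Lemma exists_unbounded_symbol : exists sigma, [/\ symbol_class lam psi sigma,
  cmeasurable sigma & forall A, 0 <= A -> ~ bounded_on_tests sigma A].
Proof.
have [kappa [kappa0 hk]] := @bump_energy_lower R.
have /choice[x xP] : forall i : index, exists x, piece_spec p lam psi c C kappa (val i) x.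
  by move=> i; apply: (piece_exists p lam0 psi0 c0 C0 hk); exact: intervals (valP i).
exact: unbounded_symbol_of_pieces kappa0 xP.
Qed.

End unbounded_symbol.

(** * From the test functions to the operator norm and to extensions *)

Section test_consequences.
Context {R : realType} {n : nat}.
Notation mu := (@lebesgue_rV R n).

Lemma cLp_test_fun (p : R) l (bm : 'I_n -> bool * nat) : 0 < p -> (forall j, 0 < l j) ->
  cLp p (test_fun 1 l bm).
Proof.
move=> p0 l0; have [mR mI] := cintegrable_measurable (cintegrable_test_fun 1 bm l0).
split => //; apply: le_lt_trans (cLnorm_test_fun bm p0 (normr1 R) l0) _.
exact: ltry.
Qed.

Lemma multiplier0 (sigma : 'rV[R]_n -> R[i]) : multiplier sigma (fun=> 0) = fun=> 0.
Proof.
have z (f : 'rV[R]_n -> R[i]) : (forall x, f x = 0) -> cint mu f = 0.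
  move=> f0; rewrite /cint; under eq_Rintegral do rewrite f0.
  under [X in (_ +i* X)%C]eq_Rintegral do rewrite f0.
  by rewrite !Rintegral_cst//= !mul0r.
apply/funext => x; rewrite /multiplier [cintegral _](z _)// ?mulr0// => xi.
by rewrite [fourier _ _](z _) ?mulr0// => y; rewrite mulr0.
Qed.

Lemma multiplier_norm_unbounded (p : R) (sigma : 'rV[R]_n -> R[i]) : 0 < p ->
  (forall A, 0 <= A -> ~ bounded_on_tests p sigma A) -> multiplier_norm p sigma = +oo%E.
Proof.
move=> p0 H; apply/eqyP => A A0.
have /existsNP[l /existsNP[bm /not_implyP[l0 /negP]]] := H A (ltW A0).
rewrite -ltNge => lt; set u := test_fun 1 l bm in lt *.
have [_ _ ufin] := cLp_test_fun bm p0 l0.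
apply: ereal_sup_ge; exists (cLnorm p (multiplier sigma u) / cLnorm p u)%E.
  exists u => //; split; first by apply: schwartz_test_fun => //; rewrite normr1.
  move=> u0; move: lt; rewrite u0 multiplier0 ltNge => /negP; apply.
  have -> : cLnorm p (fun _ : 'rV[R]_n => 0 : R[i]) = 0%E.
    rewrite /cLnorm (_ : EFin \o _ = cst 0%E); last first.
      by apply/funext => x; congr (_%:E); exact: normc0.
    by rewrite Lnorm0// eqe gt_eqF.
  by rewrite mule0.
have u0 : (0 <= cLnorm p u)%E by exact: Lnorm_ge0.
move: lt ufin u0; case: (cLnorm p u) => [r| |] //= lt _; rewrite lee_fin le_eqVlt => /predU1P[r0|r0].
  (* A zero denominator has inverse [+oo], and [lt] makes the numerator positive, so the quotient is
     [+oo]. *)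
  rewrite -r0 inve0 gt0_muley ?leey//.
  by move: lt; rewrite -r0 mule0.
by rewrite inver gt_eqF// lee_pdivlMr// ltW.
Qed.

(** The extension and the multiplier agree almost everywhere on a test function, so their norms
    coincide; measurability of [sigma] makes the multiplier measurable. *)
Lemma extends_bounded_on_tests (p : R) (sigma : 'rV[R]_n -> R[i]) : 0 < p ->
  cmeasurable sigma -> extends_bounded p sigma ->
  exists A, 0 <= A /\ bounded_on_tests p sigma A.
Proof.
move=> p0 ms [T [TLp _ [A [A0 hA]] hT]]; exists A; split => // l bm l0.
have uLp := cLp_test_fun bm p0 l0.
have uS : schwartz (test_fun 1 l bm) by apply: schwartz_test_fun => //; rewrite normr1.
apply: le_trans (hA _ uLp); rewrite le_eqVlt; apply/orP; left; apply/eqP.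
have [mR mI _] := TLp _ uLp.
have mT := measurable_normc (conj mR mI).
have mM := measurable_normc (cmeasurable_multiplier ms
  (cintegrable_measurable (cintegrable_fourier_test_fun 1 bm l0))).
rewrite /cLnorm unlock; congr (_ `^ _)%E; apply: ae_eq_integral => //.
- apply: (measurableT_comp (measurable_poweR p)).
  by apply: measurableT_comp => //; apply/measurable_EFinP.
- apply: (measurableT_comp (measurable_poweR p)).
  by apply: measurableT_comp => //; apply/measurable_EFinP.
by move: (hT _ uS); apply: filterS => x E _ /=; rewrite E.
Qed.

End test_consequences.

Theorem theorem1p5 (R : realType) (n : nat) (p : R)
    (lam : 'rV[R]_n -> R) (psi : 'I_n -> 'rV[R]_n -> R) (c C : R) :
  (1 <= n)%N -> 1 < p -> p != 2 ->
  (forall xi, 0 < lam xi) -> continuous lam -> bounded_fun lam ->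
  (forall j xi, 0 < psi j xi) -> (forall j, continuous (psi j)) ->
  0 < c -> 0 < C ->
  (forall xi, C <= enorm xi ->
    exists l : 'I_n -> R,
      [/\ forall j, c * psi j xi <= l j,
          interval_rV l `<=` sublevel psi xi &
          (lebesgue_rV n (sublevel psi xi)
             <= C%:E * lebesgue_rV n (interval_rV l))%E]) ->
  (~ [bounded Fp p lam psi xi | xi in [set xi | C <= enorm xi]] ->
    exists sigma : 'rV[R]_n -> R[i],
      symbol_class lam psi sigma /\ multiplier_norm p sigma = +oo%E) /\
  ((forall sigma : 'rV[R]_n -> R[i], symbol_class lam psi sigma ->
      extends_bounded p sigma) ->
    [bounded Fp p lam psi xi | xi in [set xi | C <= enorm xi]]).
Proof.
move=> _ p1 _ lam0 _ lamb psi0 _ c0 C0 intervals.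
have p0 : 0 < p by exact: lt_trans ltr01 p1.
split=> [unb|ext].
  have [sigma [S _ H]] := exists_unbounded_symbol p1 lam0 lamb psi0 c0 C0 intervals unb.
  by exists sigma; split => //; exact: multiplier_norm_unbounded.
apply: contrapT => unb.
have [sigma [S ms H]] := exists_unbounded_symbol p1 lam0 lamb psi0 c0 C0 intervals unb.
by have [A [A0 /(H A A0)]] := extends_bounded_on_tests p0 ms (ext _ S).
Qed.
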